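(* Let $(\Omega,\mathcal A,\mathrm P)$ be a probability space, $E$ and $F$ be separable Banach spaces, and $X:\Omega\to E$ and $Y:\Omega\to F$ be jointly Gaussian random variables. Moreover, let $\mathfrak A:=(A_n)$ be a filtering sequence for $F$, let $Y_n:=A_n\circ Y$ for all $n\ge1$, and let $$F_{\mathrm{conv},\mathfrak A}:=\Bigl\{y\in F:\ \lim_{n\to\infty}\operatorname{cov}(X,Y_n)(\operatorname{cov}Y_n)^\dagger(A_n(y)-\mathbb E Y_n)\ \text{exists in }E\Bigr\}.$$ Then the following statements hold true: (i) We have $F_{\mathrm{conv},\mathfrak A}\in\sigma(F')$ with $\mathrm P_Y(F_{\mathrm{conv},\mathfrak A})=1$. (ii) The set $F_{X|Y,\mathfrak A}:=-\mathbb E Y+F_{\mathrm{conv},\mathfrak A}$ is a measurable subspace of $F$ with $\operatorname{ran}\operatorname{cov}(Y,X)\subset F_{X|Y,\mathfrak A}$. (iii) The map $\mu_{X|Y,\mathfrak A}:F\to E$ defined by $$\mu_{X|Y,\mathfrak A}(y):=\mathbb E X+\lim_{n\to\infty}\mathbf 1_{F_{\mathrm{conv},\mathfrak A}}(y)\operatorname{cov}(X,Y_n)(\operatorname{cov}Y_n)^\dagger(A_n(y)-\mathbb E Y_n),\qquad y\in F,$$ is measurable and $\mu_{X|Y,\mathfrak A}\circ Y$ is a version of $\mathbb E(X|Y)$. (iv) The map $\mathrm P_{X|Y,\mathfrak A}(\cdot|\cdot):\mathfrak B(E)\times F\to[0,1]$ defined by $$\mathrm P_{X|Y,\mathfrak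 A}(\cdot|y):=\mathcal N\bigl(\mu_{X|Y,\mathfrak A}(y),\operatorname{cov}(X)-\operatorname{cov}(\mu_{X|Y,\mathfrak A}\circ Y)\bigr),\qquad y\in F,$$ is a version of the regular conditional probability of $X$ given $Y$.
   Context: All Banach spaces are real; $E'$ is the dual of $E$ and $\langle x',x\rangle_{E',E}:=x'(x)$. $\mathfrak B(E)$ is the Borel $\sigma$-algebra of $E$; $\sigma(F')$ is the smallest $\sigma$-algebra on $F$ making all $y'\in F'$ measurable (it equals $\mathfrak B(F)$ for separable $F$). Measurability of maps between separable Banach spaces is Borel measurability. Real Gaussian random variables may be degenerate (variance $0$ allowed). A random variable $X:\Omega\to E$ is Gaussian if $\langle x',X\rangle_{E',E}$ is a real Gaussian random variable for all $x'\in E'$; a probability measure on $\mathfrak B(E)$ is Gaussian if its image under every $x'\in E'$ is a real Gaussian measure. $X:\Omega\to E$ and $Y:\Omega\to F$ are jointly Gaussian if $(X,Y):\Omega\to E\times F$ is Gaussian. $\mathbb E X$ denotes the Bochner integral. For square Bochner integrable $X:\Omega\to E$, $Y:\Omega\to F$, the cross covariance is the bounded linear operator $\operatorname{cov}(X,Y):F'\to E$, $\operatorname{cov}(X,Y)(y')=\int_\Omega\langle y',Y-\mathbb E Y\rangle_{F',F}\,(X-\mathbb E X)\,d\mathrm P$, and $\operatorname{cov}(X):=\operatorname{cov}(X,X):E'\to E$. A Gaussian measure $\mathrm Q$ on $\mathfrak B(E)$ has mean $\mu=\int_E x\,d\mathrm Q(x)$ and covariance $K:E'\to E$, $Kx'=\int_E\langle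 x',x-\mu\rangle_{E',E}(x-\mu)\,d\mathrm Q(x)$; it is uniquely determined by $(\mu,K)$ and is denoted $\mathcal N(\mu,K)$. $A^\dagger$ denotes the Moore–Penrose pseudo-inverse; $(\operatorname{cov}Y_n)^\dagger:\mathbb R^n\to(\mathbb R^n)'$ is that of $\operatorname{cov}(Y_n):(\mathbb R^n)'\to\mathbb R^n$ (with the canonical Euclidean structures). Filtering sequence: a sequence $(A_n)$ of bounded linear operators $A_n:F\to\mathbb R^n$ is a filtering sequence for the separable Banach space $F$ if $\sigma(A_n)\subset\sigma(A_{n+1})$ for all $n\ge1$ and $\sigma(F')=\sigma(A_n:n\ge1)$. A version of the regular conditional probability of $X:\Omega\to E$ given $Y:\Omega\to F$ is a map $\mathrm P_{X|Y}(\cdot|\cdot):\mathfrak B(E)\times F\to[0,1]$ such that $\mathrm P_{X|Y}(\cdot|y)$ is a probability measure for all $y\in F$, $\mathrm P_{X|Y}(B|\cdot)$ is measurable for all $B\in\mathfrak B(E)$, and $\mathrm P(X\in B,Y\in A)=\int_A\mathrm P_{X|Y}(B|y)\,d\mathrm P_Y(y)$ for all $B\in\mathfrak B(E)$, $A\in\mathfrak B(F)$, where $\mathrm P_Y$ is the distribution of $Y$. A version of $\mathbb E(X|Y)$ is a $\sigma(Y)$-measurable Bochner integrable $Z:\Omega\to E$ with $\int_C Z\,d\mathrm P=\int_C X\,d\mathrm P$ for all $C\in\sigma(Y)$. *)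

(* Defs.v *)
From HB Require Import structures.
From mathcomp Require Import all_boot all_order all_algebra.
From mathcomp Require Import all_classical all_reals all_analysis.
From mathcomp Require Import measurable_realfun.

Set Implicit Arguments.
Unset Strict Implicit.
Unset Printing Implicit Defensive.

Import Order.TTheory GRing.Theory Num.Theory.
Import numFieldNormedType.Exports.

Local Open Scope classical_set_scope.
Local Open Scope ring_scope.

Definition separable_space (T : topologicalType) : Prop :=
  exists2 D : set T, countable D & dense D.

Notation borelType E := (g_sigma_algebraType (@open E)).

Definition borel {R : realType} (E : normedModType R) : set (set E) :=
  @measurable _ (borelType E).

Definition borel_fun {R : realType} d (T : measurableType d)
    (E : normedModType R) (f : T -> E) : Prop :=
  measurable_fun [set: T] (f : T -> borelType E).

Definition sigma_fun {R : realType} (T : Type) (E : normedModType R)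
    (f : T -> E) : set (set T) :=
  preimage_set_system [set: T] f (@borel R E).

Record topdual {R : realType} (E : normedModType R) := TopDual {
  topdual_val :> {scalar E} ;
  topdual_continuous : continuous topdual_val }.

Definition sigma_dual {R : realType} (E : normedModType R) : set (set E) :=
  <<s \bigcup_(x' in [set: topdual E])
        preimage_set_system [set: E] x' (@measurable _ R) >>.
Arguments sigma_dual {R} E.

(* Bochner integral over a probability space: the limit of the integrals of
   simple functions [u n] such that [\int `|f - u n|] tends to [0]. *)
Section bochner.
Context {R : realType} {d : measure_display} {T : measurableType d}.
Variables (P : probability T R) (E : normedModType R).
Implicit Types (f s : T -> E) (u : nat -> T -> E).

Definition simple_fun s : Prop :=
  finite_set (range s) /\ forall x, measurable (s @^-1` [set x]).

Definition simple_integral s : E :=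
  \sum_(x \in range s) fine (P (s @^-1` [set x])) *: x.

Definition bochner_approx f u : Prop :=
  [/\ borel_fun f, forall n, simple_fun (u n) &
      (\int[P]_w (`|f w - u n w|)%:E)%E @[n --> \oo] --> 0%E].

Definition bochner_integrable f : Prop := exists u, bochner_approx f u.

Definition bochner f : E :=
  get [set x | exists2 u, bochner_approx f u &
                           simple_integral (u n) @[n --> \oo] --> x].

End bochner.

Definition cov_op {R : realType} {d : measure_display} {T : measurableType d}
    (P : probability T R) (E F : normedModType R) (X : T -> E) (Y : T -> F)
    (y' : topdual F) : E :=
  bochner P (fun w => y' (Y w - bochner P Y) *: (X w - bochner P X)).

(* [normal_prob m 0] is not the Dirac mass at [m], hence the case distinction. *)
Definition real_gaussian_law {R : realType} (m s : R) : set R -> \bar R :=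
  if s == 0 then \d_m else normal_prob m s.

Definition real_gaussian {R : realType} {d : measure_display}
    {T : measurableType d} (P : probability T R) (f : T -> R) : Prop :=
  measurable_fun [set: T] f /\
  exists m s : R, forall B : set R, measurable B ->
    P (f @^-1` B) = real_gaussian_law m s B.

Definition gaussian_rv {R : realType} {d : measure_display}
    {T : measurableType d} (P : probability T R)
    (E : normedModType R) (X : T -> E) : Prop :=
  borel_fun X /\ forall x' : topdual E, real_gaussian P (fun w => x' (X w)).

Definition jointly_gaussian {R : realType} {d : measure_display}
    {T : measurableType d} (P : probability T R)
    (E F : normedModType R) (X : T -> E) (Y : T -> F) : Prop :=
  gaussian_rv P (fun w => (X w, Y w)).

Definition is_normal {R : realType} (E : normedModType R) (m : E)
    (K : topdual E -> E) (Q : probability (borelType E) R) : Prop :=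
  let X : borelType E -> E := id in
  [/\ gaussian_rv Q X, bochner Q X = m & cov_op Q X X =1 K].

(* [is_normal m K] determines [Q] on the Borel sets of a separable space, so the
   choice made by [xget] is harmless there; the Dirac mass is a junk value, used
   when no Gaussian measure has mean [m] and covariance operator [K]. *)
Definition normal_law {R : realType} (E : normedModType R) (m : E)
    (K : topdual E -> E) : probability (borelType E) R :=
  xget (\d_(m : borelType E) : probability (borelType E) R) (is_normal m K).

Definition is_mp_inverse {R : realType} (m n : nat)
    (A : 'M[R]_(m, n)) (B : 'M[R]_(n, m)) : Prop :=
  [/\ A *m B *m A = A, B *m A *m B = B,
      (A *m B)^T = A *m B & (B *m A)^T = B *m A].

Definition mp_inverse {R : realType} (m n : nat) (A : 'M[R]_(m, n)) :
    'M[R]_(n, m) :=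
  xget 0 (is_mp_inverse A).

Section riesz.
Context {R : realType} {n : nat}.

Definition rdot (u v : 'rV[R]_n) : R := \sum_j v 0 j * u 0 j.

Lemma rdot_scalar (u : 'rV[R]_n) : scalar (rdot u).
Proof.
move=> a v w; rewrite /rdot mulr_sumr -big_split /=.
by apply: eq_bigr => j _; rewrite !mxE mulrDl mulrA.
Qed.

HB.instance Definition _ (u : 'rV[R]_n) :=
  GRing.isLinear.Build R 'rV[R]_n R *%R (rdot u) (rdot_scalar u).

Lemma rdot_continuous (u : 'rV[R]_n) : continuous (rdot u).
Proof.
apply: continuous_big => [|j _ v]; first exact: add_continuous.
have vj : (w 0 j @[w --> v] --> v 0 j) by exact: coord_continuous.
exact: cvgM vj (cvg_cst (u 0 j)).
Qed.

Definition riesz (u : 'rV[R]_n) : topdual 'rV[R]_n :=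
  @TopDual R 'rV[R]_n (rdot u) (@rdot_continuous u).

(* [T (riesz u) = u *m riesz_mx T] for linear [T]. *)
Definition riesz_mx (T : topdual 'rV[R]_n -> 'rV[R]_n) : 'M[R]_n :=
  \matrix_(i, j) T (riesz (delta_mx 0 i)) 0 j.

(* Moore-Penrose inverse of [T] when the dual of R^n carries the Euclidean
   structure transported by [riesz]; the topology on ['rV_n] comes from the
   sup norm, but only the Euclidean inner product matters here. *)
Definition pinv (T : topdual 'rV[R]_n -> 'rV[R]_n) (v : 'rV[R]_n) :
    topdual 'rV[R]_n :=
  riesz (v *m mp_inverse (riesz_mx T)).

End riesz.

(* [A n] is the operator of index [n + 1] with values in R^(n + 1). *)
Definition filtering_sequence {R : realType} (F : normedModType R)
    (A : forall n, {linear F -> 'rV[R]_n.+1}) : Prop :=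
  [/\ forall n, continuous (A n),
      forall n, sigma_fun (A n) `<=` sigma_fun (A n.+1) &
      sigma_dual F = <<s \bigcup_n sigma_fun (A n) >>].

Definition is_subspace {R : realType} (F : normedModType R) (S : set F) : Prop :=
  S 0 /\ forall (a : R) (x y : F), S x -> S y -> S (a *: x + y).

Section conditioning.
Context {R : realType} {d : measure_display} {T : measurableType d}.
Variables (P : probability T R) (E F : completeNormedModType R).
Variables (X : T -> E) (Y : T -> F).

Definition is_cond_expectation (Z : T -> E) : Prop :=
  [/\ sigma_fun Z `<=` sigma_fun Y, bochner_integrable P Z &
      forall C, sigma_fun Y C ->
        bochner P (fun w => \1_C w *: Z w) = bochner P (fun w => \1_C w *: X w)].

Definition is_reg_cond_prob (k : F -> probability (borelType E) R) : Prop :=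
  (forall B, borel B ->
     measurable_fun [set: borelType F] (fun y : borelType F => k y B)) /\
  forall B A, borel B -> borel A ->
    P (X @^-1` B `&` Y @^-1` A) =
    (\int[pushforward P (Y : T -> borelType F)]_(y in A) k y B)%E.

Variable A : forall n, {linear F -> 'rV[R]_n.+1}.

Definition cond_mean_approx (n : nat) (y : F) : E :=
  let Yn := fun w => A n (Y w) in
  cov_op P X Yn (pinv (cov_op P Yn Yn) (A n y - bochner P Yn)).

Definition F_conv : set F :=
  [set y | cvgn (fun n => cond_mean_approx n y)].

Definition F_cond : set F := [set - bochner P Y + y | y in F_conv].

Definition cond_mean (y : F) : E :=
  bochner P X + limn (fun n => \1_F_conv y *: cond_mean_approx n y).

Definition cond_cov (x' : topdual E) : E :=
  let Z := fun w => cond_mean (Y w) in cov_op P X X x' - cov_op P Z Z x'.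

Definition cond_prob (y : F) : probability (borelType E) R :=
  normal_law (cond_mean y) cond_cov.

End conditioning.

(* Main.v *)
Require Import Defs.
From HB Require Import structures.
From mathcomp Require Import all_boot all_order all_algebra.
From mathcomp Require Import all_classical all_reals all_analysis.
From mathcomp Require Import measurable_realfun.
From mathcomp Require Import ring lra.

Set Implicit Arguments.
Unset Strict Implicit.
Unset Printing Implicit Defensive.

Import Order.TTheory GRing.Theory Num.Theory.
Import numFieldNormedType.Exports.

Local Open Scope classical_set_scope.
Local Open Scope ring_scope.

(** Let [Z n] be the regression of [X - E X] on [A n (Y - E Y)]. For a functional [x'], the
    increments of [x' (Z n)] are uncorrelated with the past, so [X - 2 (Z n - Z m)] has the law
    of [X]. Hence [Z n - Z m] is, in mean square, close to a fixed finite set, on which finitely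
    many functionals control the norm; since each [x' (Z n)] is Cauchy in mean square, so is
    [Z n]. The increments are moreover independent of the past and symmetric, and Levy's maximal
    inequality turns this into almost sure convergence. The residual [X - E X - lim Z n] is
    jointly Gaussian with [Y] and uncorrelated with it, hence independent of it, so that the law
    of [X] given [Y = y] is the law of the residual translated by the conditional mean at [y].
    Gaussian laws are compared through [E cos (f + a)] for linear functionals [f], and Fernique's
    inequality gives the second moments that Bochner integrability needs. *)

(** The hard point is convergence in the norm of [E]. There is no orthogonality in [E], and
    mean-square convergence of every [x' (Z n)] says nothing about the norm unless the increments
    stay near a compact set. That compactness is borrowed from [X]: in the Hilbert space of Gaussian
    variables [X - 2 (Z n - Z m)] is the image of [X] under an orthogonal reflection, whence the
    factor 2, so [Z n - Z m] is half the difference of two variables with one common law,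
    independent of [m] and [n]. The filtering property enters twice. Nested sigma-algebras make the
    kernels of the [A n] nested, so what is observed at stage [n] is a linear function of what is
    observed at stage [n + 1]; and since the [A n] generate the Borel sets of [F], being
    uncorrelated with every [A n Y] already gives independence of [Y]. The covariance of [A n Y] may
    be singular: the pseudo-inverse still solves the normal equations, because the cross covariance
    lies in the range of the Gram matrix. Cosines identify laws because their span is closed under
    products, hence under polynomials, which approximate the sign and thereby indicators of
    half-spaces. *)

(** * Expectations, integrable and square integrable real random variables *)

Section expectation.
Context {d : measure_display} {T : measurableType d} {R : realType}.
Variable P : probability T R.
Implicit Types f g : T -> R.

Definition Ex f : R := Rintegral P setT f.
Definition L1 f : Prop := P.-integrable setT (EFin \o f).
Definition L2 f : Prop := measurable_fun setT f /\ L1 (fun w => f w ^+ 2).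

Lemma L1_measurable f : L1 f -> measurable_fun setT f.
Proof. by move=> /measurable_int /measurable_EFinP. Qed.

Lemma L1_le f g : measurable_fun setT f -> (forall w, `|f w| <= g w) ->
  L1 g -> L1 f.
Proof.
move=> mf fg; apply: le_integrable => //; first exact/measurable_EFinP.
by move=> w _ /=; rewrite lee_fin (le_trans (fg w))// ler_norm.
Qed.

Lemma L1_bounded f M : measurable_fun setT f -> (forall w, `|f w| <= M) -> L1 f.
Proof.
move=> mf fM; apply: measurable_bounded_integrable => //.
  by rewrite (le_lt_trans (probability_le1 P measurableT))// ltry.
exists M; split; first exact: num_real.
by move=> x Mx w _; exact: le_trans (fM w) (ltW Mx).
Qed.

Lemma L1_cst c : L1 (fun=> c).
Proof. by apply: (@L1_bounded _ `|c|) => //; exact: measurable_cst. Qed.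

Lemma L1D f g : L1 f -> L1 g -> L1 (fun w => f w + g w).
Proof. exact: integrableD. Qed.

Lemma L1Z c f : L1 f -> L1 (fun w => c * f w).
Proof. exact: integrableZl. Qed.

Lemma L1N f : L1 f -> L1 (fun w => - f w).
Proof. exact: integrableN. Qed.

Lemma L1B f g : L1 f -> L1 g -> L1 (fun w => f w - g w).
Proof. by move=> f1 g1; apply: L1D => //; exact: L1N. Qed.

Lemma L1_norm f : L1 f -> L1 (fun w => `|f w|).
Proof. exact: integrable_norm. Qed.

Lemma L1_sum I (s : seq I) (Q : pred I) (h : I -> T -> R) :
  (forall i, Q i -> L1 (h i)) -> L1 (fun w => \sum_(i <- s | Q i) h i w).
Proof.
move=> hL; elim: s => [|i s IH].
  by rewrite (_ : (fun _ => _) = fun=> 0)//; [exact: L1_cst|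
    apply/funext => w; rewrite big_nil].
have [Qi|Qi] := boolP (Q i).
  rewrite (_ : (fun _ => _) = fun w => h i w + \sum_(j <- s | Q j) h j w).
    by apply: L1D => //; exact: hL.
  by apply/funext => w; rewrite big_cons Qi.
rewrite (_ : (fun _ => _) = fun w => \sum_(j <- s | Q j) h j w)//.
by apply/funext => w; rewrite big_cons (negbTE Qi).
Qed.

Lemma ExE f : L1 f -> (Ex f)%:E = (\int[P]_w (f w)%:E)%E.
Proof. by move=> f1; rewrite /Ex /Rintegral fineK// integrable_fin_num. Qed.

Lemma Ex_cst c : Ex (fun=> c) = c.
Proof. by rewrite /Ex Rintegral_cst//= probability_setT mulr1. Qed.

Lemma ExD f g : L1 f -> L1 g -> Ex (fun w => f w + g w) = Ex f + Ex g.
Proof. exact: RintegralD. Qed.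

Lemma ExZ c f : L1 f -> Ex (fun w => c * f w) = c * Ex f.
Proof. exact: RintegralZl. Qed.

Lemma ExN f : L1 f -> Ex (fun w => - f w) = - Ex f.
Proof.
move=> f1; rewrite -mulN1r -ExZ//; congr Ex; apply/funext => w.
by rewrite mulN1r.
Qed.

Lemma ExB f g : L1 f -> L1 g -> Ex (fun w => f w - g w) = Ex f - Ex g.
Proof. exact: RintegralB. Qed.

Lemma Ex_sum I (s : seq I) (Q : pred I) (h : I -> T -> R) :
  (forall i, Q i -> L1 (h i)) ->
  Ex (fun w => \sum_(i <- s | Q i) h i w) = \sum_(i <- s | Q i) Ex (h i).
Proof.
move=> hL; elim: s => [|i s IH].
  by rewrite big_nil -[RHS]Ex_cst; congr Ex; apply/funext => w; rewrite big_nil.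
rewrite big_cons; case: ifPn => Qi.
  rewrite -IH -ExD; [|exact: hL|exact: L1_sum].
  by congr Ex; apply/funext => w; rewrite big_cons Qi.
by rewrite -IH; congr Ex; apply/funext => w; rewrite big_cons (negbTE Qi).
Qed.

Lemma Ex_ge0 f : (forall w, 0 <= f w) -> 0 <= Ex f.
Proof. by move=> f0; apply: Rintegral_ge0. Qed.

Lemma Ex_le f g : L1 f -> L1 g -> (forall w, f w <= g w) -> Ex f <= Ex g.
Proof. by move=> f1 g1 fg; apply: le_Rintegral. Qed.

Lemma Ex_norm f : L1 f -> `|Ex f| <= Ex (fun w => `|f w|).
Proof. exact: le_normr_Rintegral. Qed.

Lemma Ex_dct (f_ : nat -> T -> R) f g :
  (forall n, measurable_fun setT (f_ n)) -> (forall w, f_ n w @[n --> \oo] --> f w) ->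
  (forall n w, `|f_ n w| <= g w) -> L1 g ->
  L1 f /\ Ex (f_ n) @[n --> \oo] --> Ex f.
Proof.
move=> mf cf fg g1.
have mf0 : measurable_fun setT f.
  by apply: (measurable_fun_cvg mf) => w _; exact: cf.
have [f1 _ c] : [/\ L1 f, [sequence \int[P]_x `|(f_ n x)%:E - (f x)%:E|]_n%E @ \oo --> 0%E
    & [sequence (\int[P]_x (f_ n x)%:E)%E]_n @ \oo --> (\int[P]_x (f x)%:E)%E].
  apply: (@dominated_convergence _ _ _ P setT measurableT (fun n => EFin \o f_ n)
    (EFin \o f) (EFin \o g)) => //.
  - by move=> n; exact/measurable_EFinP.
  - exact/measurable_EFinP.
  - by apply: aeW => w _; apply: cvg_EFin; [exact: nearW|exact: cf].
  - by apply: aeW => w n _ /=; rewrite lee_fin.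
split => //; rewrite -ExE// in c.
have fn1 n : L1 (f_ n) by exact: L1_le g1.
by move: c => /fine_cvgP[_].
Qed.

Lemma Ex_indic A : measurable A -> Ex \1_A = fine (P A).
Proof.
by move=> mA; rewrite /Ex /Rintegral integral_indic// setIT.
Qed.

Lemma L1_indic A : measurable A -> L1 \1_A.
Proof.
move=> mA; apply: (@L1_bounded _ 1); first exact: measurable_indic.
by move=> w; rewrite indicE; case: (w \in A); rewrite ?normr1 ?normr0.
Qed.

Lemma Ex_ae A f g : measurable A -> P A = 1%E -> measurable_fun setT f ->
  measurable_fun setT g -> (forall w, A w -> f w = g w) -> Ex f = Ex g.
Proof.
move=> mA PA mf mg fg; rewrite /Ex /Rintegral; congr fine.
apply: ae_eq_integral => //; [exact/measurable_EFinP|exact/measurable_EFinP|].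
exists (~` A); split.
- exact: measurableC.
- by transitivity (P (~` A)) => //; rewrite probability_setC// PA subee.
- move=> w /= h Aw; apply: h => _; by rewrite fg.
Qed.

Lemma Ex0_ae f : L1 f -> (forall w, 0 <= f w) -> Ex f = 0 ->
  P [set w | f w = 0] = 1%E /\ measurable [set w | f w = 0].
Proof.
move=> f1 f0 E0; have mf := L1_measurable f1.
have m0 : measurable [set w | f w = 0].
  rewrite (_ : [set w | _] = f @^-1` [set 0])//.
  by rewrite -[_ @^-1` _]setTI; apply: mf.
split=> //.
have : (\int[P]_w `|(f w)%:E|)%E = 0%E.
  transitivity (\int[P]_w (f w)%:E)%E.
    by apply: eq_integral => w _ /=; rewrite ger0_norm.
  by rewrite -ExE// E0.
have mEf : measurable_fun setT (EFin \o f) by exact/measurable_EFinP.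
move/(ae_eq_integral_abs P measurableT mEf) => [N [mN N0 sN]].
have sub : ~` N `<=` [set w | f w = 0].
  move=> w; apply: contra_notP => /= fw; apply: sN => /= h.
  by have /= [] := h I.
have PN : P (~` N) = 1%E.
  by rewrite probability_setC//; move: N0 => /= ->; rewrite sube0.
apply/eqP; rewrite eq_le probability_le1//= -PN.
by apply: le_measure => //; rewrite inE//; exact: measurableC.
Qed.

Lemma L2_measurable f : L2 f -> measurable_fun setT f. Proof. by case. Qed.

Lemma L2_mul f g : L2 f -> L2 g -> L1 (fun w => f w * g w).
Proof.
move=> [mf f2] [mg g2]; apply: (L1_le _ _ (L1D f2 g2)).
  exact: measurable_funM.
move=> w; rewrite normrM -(real_normK (num_real (f w))) -(real_normK (num_real (g w))).
have := normr_ge0 (f w); have := normr_ge0 (g w).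
move: `|f w| `|g w| => x y x0 y0; have := sqr_ge0 (x - y); nra.
Qed.

Lemma L2_bounded f M : measurable_fun setT f -> (forall w, `|f w| <= M) -> L2 f.
Proof.
move=> mf fM; split => //; apply: (@L1_bounded _ (M ^+ 2)).
  exact: measurable_funX.
by move=> w; rewrite normrX lerXn2r ?nnegrE// (le_trans _ (fM w)).
Qed.

Lemma L2_cst c : L2 (fun=> c).
Proof. by apply: (@L2_bounded _ `|c|) => //; exact: measurable_cst. Qed.

Lemma L2_L1 f : L2 f -> L1 f.
Proof.
move=> f2; have := L2_mul f2 (L2_cst 1).
by congr L1; apply/funext => w; rewrite mulr1.
Qed.

Lemma L2Z c f : L2 f -> L2 (fun w => c * f w).
Proof.
move=> [mf f2]; split; first exact: measurable_funM.
have := L1Z (c ^+ 2) f2.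
by congr L1; apply/funext => w; rewrite exprMn.
Qed.

Lemma L2D f g : L2 f -> L2 g -> L2 (fun w => f w + g w).
Proof.
move=> f2 g2; split; first exact: measurable_funD f2.1 g2.1.
have := L1D (L1D f2.2 g2.2) (L1Z 2 (L2_mul f2 g2)).
by congr L1; apply/funext => w; ring.
Qed.

Lemma L2N f : L2 f -> L2 (fun w => - f w).
Proof.
move=> /(L2Z (-1)); congr L2; apply/funext => w; exact: mulN1r.
Qed.

Lemma L2B f g : L2 f -> L2 g -> L2 (fun w => f w - g w).
Proof. by move=> f2 g2; apply: L2D => //; exact: L2N. Qed.

Lemma L2_le f g : measurable_fun setT f -> (forall w, `|f w| <= g w) ->
  L2 g -> L2 f.
Proof.
move=> mf fg [mg g2]; split => //; apply: L1_le g2; first exact: measurable_funX.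
by move=> w; rewrite normrX lerXn2r ?nnegrE// (le_trans _ (fg w)).
Qed.

Lemma L2_norm f : L2 f -> L2 (fun w => `|f w|).
Proof.
move=> [mf f2]; split; first exact: measurableT_comp.
by move: f2; congr L1; apply/funext => w; rewrite real_normK// num_real.
Qed.

Lemma L2_sum I (s : seq I) (h : I -> T -> R) :
  (forall i, L2 (h i)) -> L2 (fun w => \sum_(i <- s) h i w).
Proof.
move=> hL; elim: s => [|i s IH].
  by rewrite (_ : (fun _ => _) = fun=> 0)//; [exact: L2_cst|
    apply/funext => w; rewrite big_nil].
rewrite (_ : (fun _ => _) = fun w => h i w + \sum_(j <- s) h j w).
  exact: L2D.
by apply/funext => w; rewrite big_cons.
Qed.

End expectation.

(** * Polynomial approximation of the sign *)

Section sign_approximation.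
Context {R : realType}.
Implicit Types v y : R.

(* On [-1, 1] the iterates of [sign_step] converge to the sign. *)
Definition sign_step v : R := (3 * v - v ^+ 3) / 2.

Lemma sign_stepN v : sign_step (- v) = - sign_step v.
Proof. by rewrite /sign_step; field. Qed.

Lemma iter_sign_stepN k v : iter k sign_step (- v) = - iter k sign_step v.
Proof. by elim: k => //= k ->; rewrite sign_stepN. Qed.

(** [sign_step] is the Newton-Schulz iteration for the sign. Since [1 - sign_step x = (1 - x) (1 - x
    / 2 - x ^ 2 / 2)] and the iterates never fall below [v], each step contracts the distance to [1]
    by the factor [1 - v / 2] at least. *)
Lemma iter_sign_step_bound k v : 0 < v -> v <= 1 ->
  v <= iter k sign_step v <= 1 /\ 1 - iter k sign_step v <= (1 - v / 2) ^+ k.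
Proof.
move=> v0 v1; elim: k => [|k [/andP[h1 h2] h3]] /=.
  by rewrite expr0 lexx v1; split=> //; lra.
rewrite exprS; set x := iter _ _ _ in h1 h2 h3 *; rewrite /sign_step.
have E : 1 - (3 * x - x ^+ 3) / 2 = (1 - x) * (1 - x / 2 - x ^+ 2 / 2) by field.
split.
  apply/andP; split; first by have : 0 <= x * (1 - x) * (1 + x); nra.
  have : 0 <= (1 - x) * ((1 - x) * (1 + x / 2)).
    by rewrite !mulr_ge0//; lra.
  by move: E; nra.
rewrite E mulrC; apply: ler_pM => //; [|lra|].
  have : 0 <= (1 - x) * (1 + x / 2) by rewrite !mulr_ge0//; lra.
  by lra.
by have := sqr_ge0 x; lra.
Qed.

Lemma iter_sign_step_norm k v : `|v| <= 1 -> `|iter k sign_step v| <= 1.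
Proof.
move=> v1; have [v0|v0|<-] := ltgtP 0 v.
- rewrite gtr0_norm// in v1.
  have [/andP[h1 h2] _] := iter_sign_step_bound k v0 v1.
  by rewrite ger0_norm// (le_trans _ h1)// ltW.
- rewrite ltr0_norm// in v1.
  have [|/andP[h1 h2] _] := iter_sign_step_bound k _ v1; first by rewrite oppr_gt0.
  rewrite iter_sign_stepN in h1 h2.
  by rewrite -normrN ger0_norm// (le_trans _ h1)// oppr_ge0 ltW.
- suff -> : iter k sign_step 0 = 0 by rewrite normr0.
  by elim: k => //= k ->; rewrite /sign_step; field.
Qed.

Lemma cvg_iter_sign_step v : `|v| <= 1 -> iter k sign_step v @[k --> \oo] --> Num.sg v.
Proof.
have pos y : 0 < y -> y <= 1 -> iter k sign_step y @[k --> \oo] --> (1 : R).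
  move=> y0 y1; apply: (@squeeze_cvgr _ _ _ _ (fun k => 1 - (1 - y / 2) ^+ k) (fun=> 1)).
  - apply: nearW => k; have [/andP[_ h1] h2] := iter_sign_step_bound k y0 y1.
    by rewrite h1 andbT; lra.
  - rewrite -[X in _ --> X]subr0; apply: cvgB; first exact: cvg_cst.
    by apply: cvg_expr; rewrite ger0_norm; lra.
  - exact: cvg_cst.
move=> v1; have [v0|v0|<-] := ltgtP 0 v.
- by rewrite gtr0_sg//; apply: pos => //; rewrite gtr0_norm// in v1.
- rewrite ltr0_sg//; rewrite ltr0_norm// in v1.
  have -> : (fun k => iter k sign_step v) = (fun k => - iter k sign_step (- v)).
    by apply/funext => k; rewrite iter_sign_stepN opprK.
  by apply: cvgN; apply: pos => //; rewrite oppr_gt0.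
- rewrite sgr0; apply: cvg_near_cst; apply: nearW => k.
  by elim: k => //= k ->; rewrite /sign_step; field.
Qed.

Lemma sgr_sin y : `|y| < pi -> Num.sg (sin y) = Num.sg y.
Proof.
rewrite ltr_norml => /andP[y1 y2]; have [y0|y0|<-] := ltgtP 0 y.
- by rewrite !gtr0_sg// sin_gt0_pi// y0.
- have : 0 < sin (- y) by rewrite sin_gt0_pi//; apply/andP; split; lra.
  by rewrite sinN oppr_gt0 => ?; rewrite !ltr0_sg.
- by rewrite sin0.
Qed.

(** Eventually [y / (n + 1)] lies between [-pi] and [pi], where the sine has the sign of its
    argument. This removes the periodicity inherent in trigonometric polynomials. *)
Lemma cvg_sgr_sin y : Num.sg (sin (n.+1%:R^-1 * y)) @[n --> \oo] --> Num.sg y.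
Proof.
apply: cvg_near_cst.
have : (n.+1%:R^-1 * y : R) @[n --> \oo] --> (0 * y : R).
  by apply: cvgM; [exact: cvg_harmonic|exact: cvg_cst].
rewrite mul0r => /cvgr0Pnorm_lt/(_ _ (pi_gt0 R)).
apply: filterS => n /= h; rewrite sgr_sin//.
by rewrite sgrM gtr0_sg ?mul1r ?invr_gt0.
Qed.

End sign_approximation.

(** * Laws determined by the expectations of cosines of linear functionals *)

Section cramer_wold.
Context {R : realType} {d1 d2 : measure_display}.
Context {T1 : measurableType d1} {T2 : measurableType d2}.
Variables (P1 : probability T1 R) (P2 : probability T2 R).
Variables (G : Type) (D : set (G -> R)) (U1 : T1 -> G) (U2 : T2 -> G).
Hypothesis D_add : forall f g, D f -> D g -> D (fun x => f x + g x).
Hypothesis D_scale : forall c f, D f -> D (fun x => c * f x).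
Hypothesis mU1 : forall f, D f -> measurable_fun setT (fun w => f (U1 w)).
Hypothesis mU2 : forall f, D f -> measurable_fun setT (fun w => f (U2 w)).
Hypothesis D_cos : forall f a, D f ->
  Ex P1 (fun w => cos (f (U1 w) + a)) = Ex P2 (fun w => cos (f (U2 w) + a)).

(** The phase [a] makes a single kind of generator serve for sines and cosines, and the product
    formula for two cosines makes this linear span an algebra. *)
Inductive trig : (G -> R) -> Prop :=
| trig_cos f a : D f -> trig (fun x => cos (f x + a))
| trig_add g h : trig g -> trig h -> trig (fun x => g x + h x)
| trig_scale c g : trig g -> trig (fun x => c * g x).

Let trig_eq g h : g =1 h -> trig g -> trig h.
Proof. by move=> /funext ->. Qed.

Let trig_mul g h : trig g -> trig h -> trig (fun x => g x * h x).
Proof.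
move=> tg; elim: tg h => {g} [f a Df h|g g' _ IH _ IH' h th|c g _ IH h th].
- elim=> {h} [f' a' Df'|h h' _ IH _ IH'|c h _ IH].
  + apply: (@trig_eq (fun x => 2^-1 * (cos ((f x + f' x) + (a + a')) +
      cos ((f x + (-1) * f' x) + (a - a'))))).
      move=> x; have -> : f x + f' x + (a + a') = (f x + a) + (f' x + a') by ring.
      have -> : f x + (-1) * f' x + (a - a') = (f x + a) - (f' x + a') by ring.
      by rewrite cosD cosB; field.
    by apply: trig_scale; apply: trig_add; apply: trig_cos; apply: D_add => //;
      exact: D_scale.
  + by apply: trig_eq (trig_add IH IH') => x; rewrite mulrDr.
  + by apply: trig_eq (trig_scale c IH) => x; rewrite mulrCA.
- by apply: trig_eq (trig_add (IH _ th) (IH' _ th)) => x; rewrite mulrDl.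
- by apply: trig_eq (trig_scale c (IH _ th)) => x; rewrite mulrA.
Qed.

Let trig_sin f a c : D f -> trig (fun x => sin (c * (f x - a))).
Proof.
move=> Df; apply: (@trig_eq (fun x => cos (c * f x + (- (c * a) - pi / 2)))).
  by move=> x; rewrite addrA -mulrBr cosB cos_pihalf sin_pihalf mulr0 mulr1 add0r.
by apply: (trig_cos (f := fun x => c * f x)); exact: D_scale.
Qed.

Let trig_iter k g : trig g -> trig (fun x => iter k sign_step (g x)).
Proof.
move=> tg; elim: k => //= k IH.
apply: (@trig_eq (fun x => 2^-1 * (3 * iter k sign_step (g x) +
   (-1) * (iter k sign_step (g x) * (iter k sign_step (g x) * iter k sign_step (g x)))))).
  by move=> x; rewrite /sign_step; field.
apply: trig_scale; apply: trig_add; apply: trig_scale => //.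
by apply: (trig_mul IH); exact: trig_mul.
Qed.

Let adm (g : G -> R) := [/\ measurable_fun setT (g \o U1),
  measurable_fun setT (g \o U2) & exists M : R, forall x, `|g x| <= M].

Let adm_mul g h : adm g -> adm h -> adm (fun x => g x * h x).
Proof.
move=> [g1 g2 [M gM]] [h1 h2 [N hN]]; split.
- exact: (measurable_funM g1 h1).
- exact: (measurable_funM g2 h2).
- by exists (M * N) => x; rewrite normrM ler_pM.
Qed.

Let trig_adm g : trig g -> adm g /\ Ex P1 (g \o U1) = Ex P2 (g \o U2).
Proof.
elim=> {g} [f a Df|g h _ [[g1 g2 [M gM]] gE] _ [[h1 h2 [N hN]] hE]|
            c g _ [[g1 g2 [M gM]] gE]].
- split; last exact: D_cos.
  split; [| |by exists 1 => x; exact: cos_max].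
  + apply: (@measurableT_comp _ _ _ _ _ _ (@cos R)).
      by apply: continuous_measurable_fun => x; exact: continuous_cos.
    by apply: measurable_funD => //; exact: mU1.
  + apply: (@measurableT_comp _ _ _ _ _ _ (@cos R)).
      by apply: continuous_measurable_fun => x; exact: continuous_cos.
    by apply: measurable_funD => //; exact: mU2.
- split.
    split; [exact: (measurable_funD g1 h1)|exact: (measurable_funD g2 h2)|].
    by exists (M + N) => x; rewrite (le_trans (ler_normD _ _))// lerD.
  have L d (T : measurableType d) (P : probability T R) (U : T -> G) (k : G -> R) (K : R) :
      measurable_fun setT (k \o U) -> (forall x, `|k x| <= K) -> L1 P (k \o U).
    by move=> mk kK; apply: (L1_bounded _ mk) => w; exact: kK.
  have := ExD (L _ _ P1 U1 g M g1 gM) (L _ _ P1 U1 h N h1 hN); rewrite /comp => ->.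
  have := ExD (L _ _ P2 U2 g M g2 gM) (L _ _ P2 U2 h N h2 hN); rewrite /comp => ->.
  by rewrite -[Ex P1 _]/(Ex P1 (g \o U1)) -[Ex P1 (fun x => h _)]/(Ex P1 (h \o U1)) gE hE.
- split.
    split; [exact: (measurable_funM (measurable_cst c) g1)|
            exact: (measurable_funM (measurable_cst c) g2)|].
    by exists (`|c| * M) => x; rewrite normrM ler_wpM2l.
  rewrite /comp !ExZ.
  - by congr (_ * _); exact: gE.
  - by apply: (@L1_bounded _ _ _ _ _ M) => // w; exact: gM.
  - by apply: (@L1_bounded _ _ _ _ _ M) => // w; exact: gM.
Qed.

(** Dominated convergence in one factor only. The weight [h] keeps the freedom to multiply by
    trigonometric functions, and [p] stores the half-space indicators obtained so far. *)
Let lim_eq (g : nat -> G -> R) (h p : G -> R) (phi : G -> R) (K : R) :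
  adm h -> adm p ->
  (forall k, adm (g k)) -> (forall k x, `|g k x| <= K) ->
  (forall x, g k x @[k --> \oo] --> phi x) ->
  (forall k, Ex P1 (fun w => h (U1 w) * g k (U1 w) * p (U1 w)) =
             Ex P2 (fun w => h (U2 w) * g k (U2 w) * p (U2 w))) ->
  adm phi /\ Ex P1 (fun w => h (U1 w) * phi (U1 w) * p (U1 w)) =
             Ex P2 (fun w => h (U2 w) * phi (U2 w) * p (U2 w)).
Proof.
move=> ah ap ag gK gphi gE.
have phiK x : `|phi x| <= K.
  have c : `|g k x| @[k --> \oo] --> `|phi x| by apply: cvg_norm; exact: gphi.
  by rewrite -(cvg_lim _ c)//; apply: limr_le; [exact: cvgP c|exact: nearW].
have mg1 k : measurable_fun setT (g k \o U1) by case: (ag k).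
have mg2 k : measurable_fun setT (g k \o U2) by case: (ag k).
split.
  split; last by exists K.
  - by apply: (measurable_fun_cvg mg1) => w _; exact: (gphi (U1 w)).
  - by apply: (measurable_fun_cvg mg2) => w _; exact: (gphi (U2 w)).
have [h1 h2 [M hM]] := ah; have [p1 p2 [N pN]] := ap.
have cvx x : (h x * g k x * p x) @[k --> \oo] --> h x * phi x * p x.
  apply: cvgM; last exact: cvg_cst.
  by apply: cvgM; [exact: cvg_cst|exact: gphi].
have bnd k x : `|h x * g k x * p x| <= M * K * N.
  by rewrite !normrM ler_pM// ?mulr_ge0// ler_pM.
have [_ c1] : L1 P1 (fun w => h (U1 w) * phi (U1 w) * p (U1 w)) /\
  Ex P1 (fun w => h (U1 w) * g k (U1 w) * p (U1 w)) @[k --> \oo] -->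
  Ex P1 (fun w => h (U1 w) * phi (U1 w) * p (U1 w)).
  apply: (@Ex_dct _ _ _ P1 _ _ (fun=> M * K * N)) => //; last exact: L1_cst.
  by move=> k; have [] := adm_mul (adm_mul ah (ag k)) ap.
have [_ c2] : L1 P2 (fun w => h (U2 w) * phi (U2 w) * p (U2 w)) /\
  Ex P2 (fun w => h (U2 w) * g k (U2 w) * p (U2 w)) @[k --> \oo] -->
  Ex P2 (fun w => h (U2 w) * phi (U2 w) * p (U2 w)).
  apply: (@Ex_dct _ _ _ P2 _ _ (fun=> M * K * N)) => //; last exact: L1_cst.
  by move=> k; have [] := adm_mul (adm_mul ah (ag k)) ap.
by rewrite -(cvg_lim _ c1)// -(cvg_lim _ c2)//; congr (lim (_ @ \oo)); exact/funext.
Qed.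

Let ind (q : (G -> R) * R) x : R := ((q.2 < q.1 x)%R : nat)%:R.

(** By induction on the list: each new indicator is a double limit of trigonometric polynomials, and
    the weight [h] in the statement leaves room for them in the induction hypothesis. *)
Let rays_eq (l : seq ((G -> R) * R)) : (forall q, List.In q l -> D q.1) ->
  adm (fun x => \prod_(q <- l) ind q x) /\ forall h, trig h ->
  Ex P1 (fun w => h (U1 w) * \prod_(q <- l) ind q (U1 w)) =
  Ex P2 (fun w => h (U2 w) * \prod_(q <- l) ind q (U2 w)).
Proof.
elim: l => [|[f a] l IH] Dl.
  split; last first.
    move=> h /trig_adm[_ hE].
    have E d (T : measurableType d) (P : probability T R) (U : T -> G) :
        Ex P (fun w => h (U w) * \prod_(q <- [::]) ind q (U w)) = Ex P (h \o U).
      by congr Ex; apply/funext => w; rewrite big_nil mulr1.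
    by rewrite !E.
  have -> : (fun x => \prod_(q <- [::]) ind q x) = fun=> 1.
    by apply/funext => x; rewrite big_nil.
  by split; [exact: measurable_cst|exact: measurable_cst|exists 1 => x; rewrite normr1].
have Df : D f by apply: (Dl (f, a)); left.
have [|ap lE] := IH; first by move=> q ql; apply: Dl; right.
set p := fun x => _ in ap.
(* Inner limit, at fixed [n]: the iterates of [sign_step] at a sine are trigonometric and converge
   to its sign. The outer limit in [n] is taken in [key]. *)
have step n h : trig h -> adm (fun x => Num.sg (sin (n.+1%:R^-1 * (f x - a)))) /\
   Ex P1 (fun w => h (U1 w) * ((Num.sg (sin (n.+1%:R^-1 * (f (U1 w) - a))) +
      Num.sg (sin (n.+1%:R^-1 * (f (U1 w) - a))) ^+ 2) / 2) * p (U1 w)) =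
   Ex P2 (fun w => h (U2 w) * ((Num.sg (sin (n.+1%:R^-1 * (f (U2 w) - a))) +
      Num.sg (sin (n.+1%:R^-1 * (f (U2 w) - a))) ^+ 2) / 2) * p (U2 w)).
  move=> th; set z := fun x => sin (n.+1%:R^-1 * (f x - a)).
  have z1 x : `|z x| <= 1 by rewrite ler_norml sin_geN1 sin_le1.
  have tz k : trig (fun x => iter k sign_step (z x)) by apply: trig_iter; exact: trig_sin.
  have cz x : iter k sign_step (z x) @[k --> \oo] --> Num.sg (z x).
    exact: cvg_iter_sign_step.
  have one : trig (fun=> 1).
    apply: (@trig_eq (fun x => cos (0 * f x + 0))) => [x|].
      by rewrite mul0r addr0 cos0.
    by apply: (trig_cos (f := fun x => 0 * f x)); exact: D_scale.
  split.
    have [] := @lim_eq (fun k x => iter k sign_step (z x)) (fun=> 1) (fun=> 1)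
       (fun x => Num.sg (z x)) 1; rewrite //; try exact: (trig_adm one).1.
    - by move=> k; exact: (trig_adm (tz k)).1.
    - by move=> k x; exact: iter_sign_step_norm.
    - move=> k; have [_] := trig_adm (trig_mul (trig_mul one (tz k)) one).
      by [].
  have tg k : trig (fun x => (iter k sign_step (z x) + iter k sign_step (z x) ^+ 2) / 2).
    apply: (@trig_eq (fun x => 2^-1 * (iter k sign_step (z x) +
       iter k sign_step (z x) * iter k sign_step (z x)))) => [x|]; first by field.
    by apply: trig_scale; apply: trig_add => //; exact: trig_mul.
  have [] := @lim_eq (fun k x => (iter k sign_step (z x) + iter k sign_step (z x) ^+ 2) / 2)
     h p (fun x => (Num.sg (z x) + Num.sg (z x) ^+ 2) / 2) 1 (trig_adm th).1 ap; rewrite //.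
  - by move=> k; exact: (trig_adm (tg k)).1.
  - move=> k x; have := iter_sign_step_norm k (z1 x); rewrite !ler_norml => /andP[].
    by move: (iter _ _ _) => u u1 u2; apply/andP; split; nra.
  - move=> x; apply: cvgM; last exact: cvg_cst.
    by apply: cvgD => //; rewrite expr2; apply: cvgM.
  - by move=> k; exact: lE (trig_mul th (tg k)).
have s01 (t : R) : `|(Num.sg t + Num.sg t ^+ 2) / 2| <= 1.
  by rewrite ler_norml; have [|_|_] := sgrP t => *; apply/andP; split; lra.
(* [(s + s ^ 2) / 2] sends the signs [-1], [0], [1] to [0], [0], [1], as the strict inequality in
   [ind] requires. *)
have indE x : (Num.sg (f x - a) + Num.sg (f x - a) ^+ 2) / 2 = ind (f, a) x.
  by rewrite /ind/= -subr_gt0; have [h|h|h] := sgrP (f x - a) => /=; field.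
have key h : trig h -> adm (ind (f, a)) /\
    Ex P1 (fun w => h (U1 w) * ind (f, a) (U1 w) * p (U1 w)) =
    Ex P2 (fun w => h (U2 w) * ind (f, a) (U2 w) * p (U2 w)).
  move=> th.
  have [] := @lim_eq (fun n x => (Num.sg (sin (n.+1%:R^-1 * (f x - a))) +
      Num.sg (sin (n.+1%:R^-1 * (f x - a))) ^+ 2) / 2)
     h p (ind (f, a)) 1 (trig_adm th).1 ap; rewrite //.
  - move=> n; have [[g1 g2 gM] _] := step n h th; split.
    + rewrite /comp/=; apply: measurable_funM => //.
      by apply: measurable_funD => //; apply: measurable_funX.
    + rewrite /comp/=; apply: measurable_funM => //.
      by apply: measurable_funD => //; apply: measurable_funX.
    + by exists 1.
  - move=> x; rewrite -indE; apply: cvgM; last exact: cvg_cst.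
    by apply: cvgD; [exact: cvg_sgr_sin|rewrite expr2; apply: cvgM; exact: cvg_sgr_sin].
  - by move=> n; exact: (step n h th).2.
have pE x : \prod_(q <- (f, a) :: l) ind q x = ind (f, a) x * p x.
  by rewrite big_cons.
split.
  under eq_fun do rewrite pE; apply: adm_mul => //.
  apply: (key (fun x => cos (f x + 0)) _).1; exact: trig_cos.
move=> h th; under eq_fun do rewrite pE mulrA; under [in RHS]eq_fun do rewrite pE mulrA.
exact: (key h th).2.
Qed.

Definition sigma_of (F : set (G -> R)) : set (set G) :=
  <<s \bigcup_(f in F) preimage_set_system setT f (@measurable _ R) >>.

(** Finite intersections of open half-spaces: a pi-system that generates [sigma_of D]. *)
Let rays : set (set G) := [set B | exists2 l : seq ((G -> R) * R),
  (forall q, List.In q l -> D q.1) & B = [set x | forall q, List.In q l -> q.2 < q.1 x]].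

Let prod_ind l x : \prod_(q <- l) ind q x =
  \1_[set x | forall q, List.In q l -> q.2 < q.1 x] x.
Proof.
elim: l => [|q l IH]; first by rewrite big_nil indicE mem_set.
rewrite big_cons IH !indicE /ind; case: ltP => /= qx; last first.
  rewrite mul0r memNset//= => /(_ q) h; move: qx; rewrite leNgt h//; by left.
rewrite mul1r; congr (_%:R); congr nat_of_bool; apply/idP/idP; rewrite !inE/=.
  by move=> h r [<-//|/h].
by move=> h r rl; apply: h; right.
Qed.

Let rays_law B : rays B -> [/\ measurable (U1 @^-1` B), measurable (U2 @^-1` B) &
  P1 (U1 @^-1` B) = P2 (U2 @^-1` B)].
Proof.
move=> [l Dl ->]; have [[m1 m2 _] lE] := rays_eq Dl; set B0 := [set x | _].
have mB1 : measurable (U1 @^-1` B0).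
  rewrite (_ : _ @^-1` _ = ((fun x => \prod_(q <- l) ind q x) \o U1) @^-1` [set 1]).
    by rewrite -[_ @^-1` _]setTI; exact: m1.
  apply/seteqP; split => w /=; rewrite prod_ind indicE -/B0.
    by move=> h; rewrite mem_set.
  by case: (boolP (_ \in B0)) => [/set_mem//|_] /esym/eqP; rewrite oner_eq0.
have mB2 : measurable (U2 @^-1` B0).
  rewrite (_ : _ @^-1` _ = ((fun x => \prod_(q <- l) ind q x) \o U2) @^-1` [set 1]).
    by rewrite -[_ @^-1` _]setTI; exact: m2.
  apply/seteqP; split => w /=; rewrite prod_ind indicE -/B0.
    by move=> h; rewrite mem_set.
  by case: (boolP (_ \in B0)) => [/set_mem//|_] /esym/eqP; rewrite oner_eq0.
split => //.
(* The empty list is settled apart: it provides no member of [D] from which to build the constant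
   [1] as a [trig] function, namely as the cosine of [0 * q.1 x]. *)
case: l Dl lE @B0 mB1 mB2 {m1 m2} => [|q l] Dl lE B0 mB1 mB2.
  have BT : B0 = setT by rewrite -subTset => x _ q [].
  by rewrite BT !preimage_setT !probability_setT.
have one : trig (fun=> 1).
  apply: (@trig_eq (fun x => cos (0 * q.1 x + 0))) => [x|].
    by rewrite mul0r addr0 cos0.
  by apply: (trig_cos (f := fun x => 0 * q.1 x)); apply: D_scale; apply: Dl; left.
have E d (T : measurableType d) (P : probability T R) (U : T -> G) :
  measurable (U @^-1` B0) ->
  (Ex P (fun w => 1 * \prod_(r <- q :: l) ind r (U w)))%:E = P (U @^-1` B0).
  move=> mB; under eq_fun do rewrite mul1r prod_ind.
  rewrite (_ : (fun w => _) = \1_(U @^-1` B0)).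
    by rewrite Ex_indic// fineK//; exact: fin_num_measure.
  by apply/funext => w; rewrite !indicE; congr (nat_of_bool _)%:R.
by rewrite -E// -[RHS]E//; congr EFin; exact: (lE _ one).
Qed.

(** Dynkin's pi-lambda theorem. Measurability of the two preimages is carried along in the
    lambda-system, because [G] bears no sigma-algebra of its own. *)
Lemma sigma_of_law S : sigma_of D S -> [/\ measurable (U1 @^-1` S),
  measurable (U2 @^-1` S) & P1 (U1 @^-1` S) = P2 (U2 @^-1` S)].
Proof.
suff sub : sigma_of D `<=` <<s rays >>.
  move=> /sub {sub} sS.
  suff: <<s rays >> `<=` [set S | [/\ measurable (U1 @^-1` S),
    measurable (U2 @^-1` S) & P1 (U1 @^-1` S) = P2 (U2 @^-1` S)]] by apply.
  apply: lambda_system_subset => //.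
  - move=> A B [l Dl ->] [k Dk ->]; exists (l ++ k).
      by move=> q ql; have [/Dl|/Dk] := List.in_app_or _ _ _ ql.
    apply/seteqP; split => x.
      by move=> [h1 h2] q ql; have [/h1|/h2] := List.in_app_or _ _ _ ql.
    by move=> h; split => q ql; apply: h; apply: List.in_or_app; [left|right].
  - apply/dynkin_lambda_system; split.
    + by rewrite /= !preimage_setT !probability_setT; split.
    + move=> A [mA1 mA2 AE] /=; rewrite -!preimage_setC; split; try exact: measurableC.
      by rewrite !probability_setC// AE.
    + move=> F tF FE /=; rewrite !preimage_bigcup; split.
      * by apply: bigcupT_measurable => k; case: (FE k).
      * by apply: bigcupT_measurable => k; case: (FE k).
      * rewrite !measure_bigcup//=.
        -- by apply: eq_eseriesr => k _; case: (FE k).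
        -- by move=> k _; case: (FE k).
        -- by apply/trivIsetP => i j _ _ ij; rewrite -preimage_setI;
             move/trivIsetP : tF => ->//; rewrite preimage_set0.
        -- by move=> k _; case: (FE k).
        -- by apply/trivIsetP => i j _ _ ij; rewrite -preimage_setI;
             move/trivIsetP : tF => ->//; rewrite preimage_set0.
apply: smallest_sub; first exact: smallest_sigma_algebra.
move=> _ [f Df [B mB <-]].
have mB' : <<s @RGenOInfty.G R >> B.
  by rewrite -[<<s _ >>]/(@RGenOInfty.G R).-sigma.-measurable -RGenOInfty.measurableE.
suff : <<s @RGenOInfty.G R >> `<=` image_set_system setT f <<s rays >> by apply.
apply: smallest_sub; first by apply: sigma_algebra_image; exact: smallest_sigma_algebra.
move=> _ [a ->]; rewrite /image_set_system/=; apply: sub_sigma_algebra.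
exists [:: (f, a)]; first by move=> q [<-|].
apply/seteqP; split => x /=; rewrite in_itv/= andbT.
  by move=> [_ h] q [<-|].
by move=> h; split => //; apply: (h (f, a)); left.
Qed.

End cramer_wold.

(** * Integration against a density, and integrals that depend only on a law *)

Section density.
Context {d : measure_display} {T : measurableType d} {R : realType}.
Variables (mu nu : {measure set T -> \bar R}) (p : T -> R).
Hypothesis mp : measurable_fun setT p.
Hypothesis p0 : forall x, 0 <= p x.
Hypothesis nuE : forall A, measurable A -> nu A = (\int[mu]_(x in A) (p x)%:E)%E.

Import HBNNSimple.

Lemma ge0_integral_density (f : T -> \bar R) : measurable_fun setT f ->
  (forall x, 0 <= f x)%E -> (\int[nu]_x f x = \int[mu]_x (f x * (p x)%:E))%E.
Proof.
move=> mf f0; have mpE : measurable_fun setT (EFin \o p) by exact/measurable_EFinP.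
have step (g : {nnsfun T >-> R}) :
    (\int[nu]_x (g x)%:E = \int[mu]_x ((g x)%:E * (p x)%:E))%E.
  under eq_integral do rewrite fimfunE -fsumEFin//.
  rewrite ge0_integral_fsum//; last 2 first.
    - by move=> r; exact/measurable_EFinP/measurableT_comp.
    - by move=> n x _; rewrite EFinM nnfun_muleindic_ge0.
  under [RHS]eq_integral.
    move=> x _; rewrite fimfunE -fsumEFin// muleC ge0_mule_fsumr; last first.
      by move=> r; rewrite EFinM nnfun_muleindic_ge0.
    over.
  rewrite [RHS]ge0_integral_fsum//; last 2 first.
    - by move=> r; apply: emeasurable_funM => //; exact/measurable_EFinP/measurableT_comp.
    - by move=> r x _; apply: mule_ge0; [rewrite lee_fin|rewrite EFinM nnfun_muleindic_ge0].
  apply: eq_fsbigr => r _.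
  have mr : measurable (g @^-1` [set r]) by exact: measurable_sfunP.
  rewrite integralZl_indic_nnsfun//= integral_indic// setIT nuE//.
  have [r0|r0] := leP 0 r; last first.
    rewrite preimage_nnfun0// integral_set0 mule0 integral0_eq// => x _.
    by rewrite indic0 /= mulr0 mule0.
  rewrite [in LHS]integral_mkcond -ge0_integralZl//; last 2 first.
    - by apply: (measurable_restrictT (EFin \o p) mr).1; exact: measurable_funTS.
    - by move=> x _; apply: erestrict_ge0 => y _; rewrite lee_fin.
  apply: eq_integral => x _; rewrite patchE indicE.
  by case: (x \in _); rewrite /= ?mulr1 ?mulr0 ?mule0// muleC.
pose f_ := nnsfun_approx measurableT mf.
have cf x : EFin (f_ n x) @[n --> \oo] --> f x by exact: cvg_nnsfun_approx.
have nd x m n : (m <= n)%N -> ((f_ m x)%:E <= (f_ n x)%:E)%E.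
  by move=> mn; rewrite lee_fin; exact/lefP/nd_nnsfun_approx.
transitivity (limn (fun n => \int[nu]_x (f_ n x)%:E)%E).
  rewrite -monotone_convergence//=.
  - by apply: eq_integral => x _; apply/esym/cvg_lim.
  - by move=> n; exact/measurable_EFinP.
  - by move=> n x _; rewrite lee_fin.
  - by move=> x _ m n mn; exact: nd.
under eq_fun do rewrite step.
rewrite -monotone_convergence//=.
- apply: eq_integral => x _; apply/cvg_lim => //.
  by apply: cvgeZr => //.
- by move=> n; apply: emeasurable_funM => //; exact/measurable_EFinP.
- by move=> n x _; rewrite mule_ge0 ?lee_fin.
- by move=> x _ m n mn; rewrite lee_wpmul2r ?lee_fin//; move: (nd x _ _ mn); rewrite lee_fin.
Qed.

End density.

Section same_law.
Context {d1 d2 d : measure_display} {T1 : measurableType d1} {T2 : measurableType d2}.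
Context {S : measurableType d} {R : realType}.
Variables (P1 : probability T1 R) (P2 : probability T2 R) (f1 : T1 -> S) (f2 : T2 -> S).
Hypotheses (mf1 : measurable_fun setT f1) (mf2 : measurable_fun setT f2).
Hypothesis law : forall B, measurable B -> P1 (f1 @^-1` B) = P2 (f2 @^-1` B).

Lemma ge0_integral_same_law (h : S -> \bar R) : measurable_fun setT h ->
  (forall x, 0 <= h x)%E -> (\int[P1]_w h (f1 w) = \int[P2]_w h (f2 w))%E.
Proof.
move=> mh h0.
have := @ge0_integral_pushforward _ _ _ _ R f1 mf1 P1 setT h measurableT mh (fun x _ => h0 x).
rewrite preimage_setT => <-.
have := @ge0_integral_pushforward _ _ _ _ R f2 mf2 P2 setT h measurableT mh (fun x _ => h0 x).
rewrite preimage_setT => <-.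
by apply: eq_measure_integral => A mA _; exact: law.
Qed.

Lemma L1_same_law (h : S -> R) : measurable_fun setT h ->
  L1 P2 (fun w => h (f2 w)) -> L1 P1 (fun w => h (f1 w)).
Proof.
move=> mh /integrableP[_ i2]; apply/integrableP; split.
  by apply/measurable_EFinP; apply: measurableT_comp mh mf1.
rewrite (_ : (\int[P1]_x _)%E = (\int[P2]_w `|(h (f2 w))%:E|)%E)//.
apply: (ge0_integral_same_law (h := fun x => `|(h x)%:E|%E)) => //.
by apply: measurableT_comp => //; exact/measurable_EFinP.
Qed.

Lemma Ex_same_law (h : S -> R) : measurable_fun setT h ->
  Ex P1 (fun w => h (f1 w)) = Ex P2 (fun w => h (f2 w)).
Proof.
move=> mh; rewrite /Ex /Rintegral; congr fine; rewrite integralE [RHS]integralE.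
have mhE : measurable_fun setT (EFin \o h) by exact/measurable_EFinP.
congr (_ - _)%E.
  have := ge0_integral_same_law (measurable_funepos mhE) (funepos_ge0 _).
  by rewrite !funepos.unlock.
have := ge0_integral_same_law (measurable_funeneg mhE) (funeneg_ge0 _).
by rewrite !funeneg.unlock.
Qed.

End same_law.

Definition image_measure {d1 d2} {T1 : measurableType d1} {T2 : measurableType d2}
    {R : realType} (m : {measure set T1 -> \bar R}) (f : T1 -> T2)
    (mf : measurable_fun setT f) : {measure set T2 -> \bar R} :=
  measure_function_pushforward__canonical__measure_function_Measure m mf.

(** * The standard normal law: affine images, moments and convolution *)

Section standard_normal.
Context {R : realType}.
Notation mu := (@lebesgue_measure R).

Definition std_normal : probability _ R := normal_prob (0 : R) 1.
Notation gam := std_normal.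

(** Both sides are measures of [A] that agree on half-open intervals, which determine Lebesgue
    measure. *)
Lemma lebesgue_measure_affine (m s : R) (A : set R) : 0 < s -> measurable A ->
  (s%:E * mu ((fun x : measurableTypeR R => m + s * x)%R @^-1` A))%E = mu A.
Proof.
move=> s0 mA; have ms : measurable_fun setT (fun x : measurableTypeR R => (m + s * x)%R : measurableTypeR R).
  by apply: measurable_funD => //; exact: measurable_funM.
pose nu := mscale (NngNum (ltW s0)) (image_measure mu ms).
suff /(_ A mA) -> : forall B, measurable B -> mu B = nu B by [].
apply: (@lebesgue_measure_unique R nu) => //= _ [[a b]] _ <-.
rewrite /nu /mscale/= /image_measure/= /pushforward.
have -> : (fun x : R => m + s * x) @^-1` `]a, b]%classic =
    `](a - m) / s, (b - m) / s]%classic.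
  apply/seteqP; split => x /=; rewrite !in_itv/= ltr_pdivrMr// ler_pdivlMr//;
    by move=> /andP[? ?]; apply/andP; split; lra.
rewrite !lebesgue_measure_itv/= !lte_fin ltr_pM2r ?invr_gt0// ltrD2r.
case: ifPn => ab; last by rewrite mule0.
by rewrite -!EFinD -EFinM; congr EFin; field; rewrite gt_eqF.
Qed.

Lemma normal_prob_affine (m s : R) (B : set R) : 0 < s -> measurable B ->
  normal_prob m s B = gam ((fun x => m + s * x) @^-1` B).
Proof.
move=> s0 mB; set F := fun x : measurableTypeR R => (m + s * x)%R : measurableTypeR R.
have mF : measurable_fun setT F.
  by apply: measurable_funD => //; exact: measurable_funM.
have mFB : measurable (F @^-1` B) by rewrite -[_ @^-1` _]setTI; exact: mF.
rewrite /gam/= /normal_prob.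
transitivity (s%:E * \int[mu]_(x in F @^-1` B) (normal_pdf m s (F x))%:E)%E.
  have -> : (\int[mu]_(x in F @^-1` B) (normal_pdf m s (F x))%:E =
     \int[pushforward mu F]_(x in B) (normal_pdf m s x)%:E)%E.
    rewrite (ge0_integral_pushforward mF)//.
    - by apply/measurable_EFinP/measurable_funTS; exact: measurable_normal_pdf.
    - by move=> x _; rewrite lee_fin normal_pdf_ge0.
  have := @ge0_integral_mscale _ _ R (image_measure mu mF) B mB (NngNum (ltW s0))
    (fun x => (normal_pdf m s x)%:E).
  rewrite /= => <-.
  - by apply: eq_measure_integral => A mA _; exact/esym/(lebesgue_measure_affine m s0 mA).
  - by apply/measurable_EFinP/measurable_funTS; exact: measurable_normal_pdf.
  - by move=> x _; rewrite lee_fin normal_pdf_ge0.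
rewrite -ge0_integralZl//; last 3 first.
- apply/measurable_EFinP/measurable_funTS.
  by apply: measurableT_comp mF; exact: measurable_normal_pdf.
- by move=> x _; rewrite lee_fin normal_pdf_ge0.
- by rewrite lee_fin ltW.
apply: eq_integral => x _; rewrite -EFinM; congr EFin.
rewrite !normal_pdfE ?oner_neq0 ?gt_eqF// /normal_peak /normal_fun mulrA; congr (_ * expR _).
  rewrite expr1n mul1r -mulrnAr sqrtrM ?sqr_ge0// sqrtr_sqr gtr0_norm// invfM mulrA mulfV ?mul1r//.
  by rewrite gt_eqF.
by rewrite /F; field; rewrite gt_eqF.
Qed.


(** [real_gaussian] puts no sign on its scale parameter; this allows the absolute value to be
    taken. *)
Lemma normal_probN (m s : R) : normal_prob m (- s) = normal_prob m s.
Proof.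
apply/funext => B; rewrite /normal_prob; apply: eq_integral => x _; congr EFin.
by rewrite /normal_pdf oppr_eq0 /normal_peak /normal_fun sqrrN.
Qed.

Lemma std_normalN (B : set R) : measurable B ->
  gam B = gam ((fun x => - x) @^-1` B).
Proof.
move=> mB; pose F : measurableTypeR R -> measurableTypeR R := -%R.
have mF : measurable_fun setT F by exact: measurable_funN.
transitivity (\int[mu]_(x in F @^-1` B) (normal_pdf 0 1 (F x))%:E)%E; last first.
  apply: eq_integral => x _; congr EFin.
  by rewrite !normal_pdfE ?oner_neq0// /normal_fun !subr0 sqrrN.
rewrite -[RHS](ge0_integral_pushforward mF mu (f := fun x => (normal_pdf 0 1 x)%:E))//.
- apply: eq_measure_integral => A mA _; exact/esym/lebesgue_measureN.
- by apply/measurable_EFinP/measurable_funTS; exact: measurable_normal_pdf.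
- by move=> x _; rewrite lee_fin normal_pdf_ge0.
Qed.

Lemma std_normal_L2 : L2 gam (fun x => x).
Proof.
split; first exact: measurable_id.
apply/integrableP; split; first by apply/measurable_EFinP; exact: measurable_funX.
have -> : (\int[gam]_x `|(x ^+ 2)%:E| = \int[gam]_x (x ^+ 2)%:E)%E.
  by apply: eq_integral => x _; rewrite gee0_abs// lee_fin sqr_ge0.
have mpdf : measurable_fun setT (normal_pdf (0 : R) 1) by exact: measurable_normal_pdf.
rewrite (@ge0_integral_density _ _ R mu gam (normal_pdf 0 1) mpdf)//; first last.
- by move=> x; rewrite lee_fin sqr_ge0.
- by apply/measurable_EFinP; exact: exprn_measurable.
- by move=> x; exact: normal_pdf_ge0.
(* Domination by a multiple of the density of deviation [2]: the two exponentials differ by the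
   factor [expR (- 3 x ^ 2 / 8)], and [x ^ 2 <= 4 expR (3 x ^ 2 / 8)] follows from
   [1 + u <= expR u]. *)
pose C : R := 4 * normal_peak (1 : R) / normal_peak (2 : R).
have p1 : 0 < normal_peak (1 : R) by rewrite normal_peak_gt0 ?oner_neq0.
have p2 : 0 < normal_peak (2 : R) by rewrite normal_peak_gt0 ?pnatr_eq0.
apply: (@le_lt_trans _ _ (\int[mu]_x (C * normal_pdf 0 2 x)%:E)%E).
  apply: ge0_le_integral => //.
  - by move=> x _; rewrite -EFinM lee_fin mulr_ge0 ?sqr_ge0 ?normal_pdf_ge0.
  - apply/measurable_EFinP; apply: measurable_funM => //; exact: exprn_measurable.
  - by apply/measurable_EFinP; apply: measurable_funM => //; exact: measurable_normal_pdf.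
  - move=> x _; rewrite -EFinM lee_fin !normal_pdfE ?oner_neq0 ?pnatr_eq0// /normal_fun !subr0.
    have -> : C * (normal_peak 2 * expR (- x ^+ 2 / (2 ^+ 2 *+ 2))) =
       normal_peak 1 * (4 * expR (- x ^+ 2 / (2 ^+ 2 *+ 2))).
      by rewrite /C; field; rewrite gt_eqF.
    rewrite mulrCA ler_pM2l//.
    have -> : - x ^+ 2 / (1 ^+ 2 *+ 2) = - x ^+ 2 / (2 ^+ 2 *+ 2) + - (3 / 8 * x ^+ 2) :> R.
      by field.
    rewrite expRD mulrCA [leRHS]mulrC ler_pM2l ?expR_gt0// expRN ler_pdivrMr ?expR_gt0//.
    have := expR_ge1Dx (3 / 8 * x ^+ 2); have := sqr_ge0 x; lra.
under eq_integral do rewrite EFinM.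
rewrite ge0_integralZl//.
- by rewrite integral_normal_pdf mule1 ltry.
- by apply/measurable_EFinP; exact: measurable_normal_pdf.
- by move=> x _; rewrite lee_fin normal_pdf_ge0.
- by rewrite lee_fin /C divr_ge0 ?mulr_ge0// ltW.
Qed.

Lemma std_normal_mean : Ex gam (fun x => x) = 0.
Proof.
have mi : measurable_fun setT (fun x : measurableTypeR R => x : measurableTypeR R).
  exact: measurable_id.
have mN : measurable_fun setT (fun x : measurableTypeR R => - x : measurableTypeR R).
  exact: measurable_funN.
have := @Ex_same_law _ _ _ _ _ _ R gam gam _ _ mi mN std_normalN _ mi.
rewrite ExN; last exact/L2_L1/std_normal_L2.
by rewrite /=; lra.
Qed.

(** Kept as a symbol: it is the ratio of variance to squared scale, and dividing by it recovers the
    scale of a Gaussian law. *)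
Definition std_var : R := Ex gam (fun x => x ^+ 2).

(** A vanishing second moment would concentrate the law at [0], a point without mass for a law with
    a density. *)
Lemma std_var_gt0 : 0 < std_var.
Proof.
rewrite lt_neqAle Ex_ge0 ?andbT; last by move=> x; exact: sqr_ge0.
apply/eqP => /esym v0.
have [h _] := Ex0_ae std_normal_L2.2 (fun x => sqr_ge0 x) v0.
have : gam [set 0] = 1%E.
  by rewrite -h; congr (gam _); apply/seteqP; split => x /= => [->|/eqP];
    rewrite ?expr0n// sqrf_eq0 => /eqP.
rewrite /gam /= /normal_prob integral_set1 => /eqP.
by rewrite eqe eq_sym oner_eq0.
Qed.

End standard_normal.

Section convolution.
Context {R : realType}.
Notation mu := (@lebesgue_measure R).
Notation gam := (@std_normal R).

(** Bayes' formula for [y = s x + t z] with [x], [z] independent standard normal: given [y], the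
    variable [x] has mean [s y / r ^ 2] and deviation [t / r]. It amounts to completing the
    square. *)
Lemma normal_pdf_convolution (s t r x y : R) : 0 < s -> 0 < t -> 0 < r ->
  r ^+ 2 = s ^+ 2 + t ^+ 2 ->
  normal_pdf 0 1 x * normal_pdf (s * x) t y =
  normal_pdf 0 r y * normal_pdf (s * y / r ^+ 2) (t / r) x.
Proof.
move=> s0 t0 r0 rE; have t0' := lt0r_neq0 t0; have r0' := lt0r_neq0 r0.
rewrite !normal_pdfE ?oner_neq0// ?mulf_neq0 ?invr_eq0// /normal_fun /normal_peak.
rewrite mulrACA -expRD [RHS]mulrACA -expRD; congr (_ * expR _).
  rewrite -!invfM -!sqrtrM; first last.
  - by rewrite pmulrn_lge0// mulr_ge0 ?sqr_ge0 ?pi_ge0.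
  - by rewrite pmulrn_lge0// mulr_ge0 ?sqr_ge0 ?pi_ge0.
  by congr (Num.sqrt _)^-1; field.
have -> : t ^+ 2 = r ^+ 2 - s ^+ 2 by rewrite rE; ring.
have H : r ^+ 2 - s ^+ 2 != 0 by rewrite rE addrAC subrr add0r expf_neq0.
have -> : (t / r) ^+ 2 = (r ^+ 2 - s ^+ 2) / r ^+ 2.
  by rewrite expr_div_n rE; congr (_ / _); ring.
by field; rewrite H r0'.
Qed.

(** Tonelli's theorem exchanges the integrals. By the Bayes factorization the inner density in [x]
    then integrates to [1] and leaves the normal density of deviation [r]. *)
Lemma std_normal_convolution (s t : R) (B : set R) : 0 < s -> 0 < t -> measurable B ->
  (\int[gam]_x gam ((fun y => s * x + t * y)%R @^-1` B) =
  gam ((fun x => Num.sqrt (s ^+ 2 + t ^+ 2) * x)%R @^-1` B))%E.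
Proof.
move=> s0 t0 mB; set r := Num.sqrt _.
have rE : r ^+ 2 = s ^+ 2 + t ^+ 2 by rewrite sqr_sqrtr// addr_ge0 ?sqr_ge0.
have r0 : 0 < r by rewrite sqrtr_gt0 addr_gt0 ?exprn_gt0.
have -> : (fun x => r * x) = (fun x => 0 + r * x) by apply/funext => x; rewrite add0r.
rewrite -normal_prob_affine//.
under eq_integral do rewrite -normal_prob_affine//.
have mpdf : measurable_fun setT (normal_pdf (0 : R) 1) by exact: measurable_normal_pdf.
have mpdf2 : measurable_fun setT (fun z : measurableTypeR R * measurableTypeR R =>
    normal_pdf (s * z.1) t z.2).
  rewrite (_ : (fun _ => _) = fun z => normal_pdf 0 t (z.2 - s * z.1)).
    apply: measurableT_comp; first exact: measurable_normal_pdf.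
    apply: measurable_funB; first exact: measurable_snd.
    by apply: measurable_funM => //; exact: measurable_fst.
  by apply/funext => z; rewrite !normal_pdfE ?gt_eqF// /normal_fun subr0.
have mF : measurable_fun setT (fun z : measurableTypeR R * measurableTypeR R =>
    (\1_B z.2 * normal_pdf (s * z.1) t z.2)%:E).
  apply/measurable_EFinP/measurable_funM => //.
  by apply: measurableT_comp; [exact: measurable_indic|exact: measurable_snd].
have F0 (z : measurableTypeR R * measurableTypeR R) :
    (0 <= (\1_B z.2 * normal_pdf (s * z.1) t z.2)%:E)%E.
  by rewrite lee_fin mulr_ge0 ?normal_pdf_ge0.
have NE x : normal_prob (s * x) t B =
    (\int[mu]_y (\1_B y * normal_pdf (s * x) t y)%:E)%E.
  rewrite /normal_prob integral_mkcond; apply: eq_integral => y _.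
  by rewrite patchE indicE; case: (y \in B); rewrite ?mul1r ?mul0r.
rewrite (@ge0_integral_density _ _ R mu gam (normal_pdf 0 1) mpdf)//; first last.
- by under eq_fun do rewrite NE; exact: (measurable_fun_fubini_tonelli_F _ mF F0).
- by move=> x; exact: normal_pdf_ge0.
pose K := fun z : measurableTypeR R * measurableTypeR R =>
  (normal_pdf 0 1 z.1 * (\1_B z.2 * normal_pdf (s * z.1) t z.2))%:E.
have mK : measurable_fun setT K.
  apply/measurable_EFinP/measurable_funM; last exact/measurable_EFinP.
  by apply: measurableT_comp; [exact: measurable_normal_pdf|exact: measurable_fst].
have K0 z : (0 <= K z)%E.
  by rewrite lee_fin !mulr_ge0 ?normal_pdf_ge0.
transitivity (\int[mu]_x \int[mu]_y K (x, y))%E.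
  apply: eq_integral => x _; rewrite NE muleC -ge0_integralZl//.
  - by apply/measurable_EFinP/measurable_funM => //; exact: measurable_normal_pdf.
  - by move=> y _; rewrite lee_fin mulr_ge0 ?normal_pdf_ge0.
  - by rewrite lee_fin normal_pdf_ge0.
rewrite (fubini_tonelli K mK K0) /normal_prob [RHS]integral_mkcond.
apply: eq_integral => y _; rewrite patchE.
transitivity (\int[mu]_x ((\1_B y * normal_pdf 0 r y)%:E *
    (normal_pdf (s * y / r ^+ 2) (t / r) x)%:E))%E.
  apply: eq_integral => x _; rewrite -EFinM; congr EFin.
  by rewrite /= mulrCA (@normal_pdf_convolution s t r)// mulrA.
rewrite ge0_integralZl//.
- rewrite integral_normal_pdf mule1 indicE.
  by case: (y \in B); rewrite ?mul1r ?mul0r.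
- by apply/measurable_EFinP; exact: measurable_normal_pdf.
- by move=> x _; rewrite lee_fin normal_pdf_ge0.
- by rewrite lee_fin mulr_ge0 ?normal_pdf_ge0.
Qed.

End convolution.

(** * Real Gaussian laws, possibly degenerate *)

Section gauss_law.
Context {R : realType}.
Notation gam := (@std_normal R).

Lemma measurable_affine (m s : R) : measurable_fun setT (fun x : R => m + s * x).
Proof. by apply: measurable_funD => //; exact: measurable_funM. Qed.

Definition variance_of {d} {T : measurableType d} (P : probability T R) (f : T -> R) : R :=
  Ex P (fun w => (f w - Ex P f) ^+ 2).

Section one_space.
Context {d : measure_display} {T : measurableType d}.
Variable P : probability T R.
Implicit Types (f : T -> R) (m s : R).

(* Degenerate laws are included as [s = 0]. *)
Definition gauss_law f m s : Prop := [/\ measurable_fun setT f, 0 <= s &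
  forall B, measurable B -> P (f @^-1` B) = gam ((fun x => m + s * x) @^-1` B)].

Lemma gauss_law0 m (B : set R) : gam ((fun x : R => m + 0 * x) @^-1` B) = \d_m B.
Proof.
have -> : (fun x : R => m + 0 * x) = (fun=> m) by apply/funext => x; rewrite mul0r addr0.
rewrite diracE; case: (boolP (m \in B)) => [/set_mem mB|/negP mB].
  rewrite (_ : _ @^-1` _ = setT) ?probability_setT//.
  by rewrite -subTset.
rewrite (_ : _ @^-1` _ = set0) ?measure0//.
by rewrite -subset0 => x /=; rewrite -in_setE.
Qed.

Lemma real_gaussianP f : real_gaussian P f <-> exists m s, gauss_law f m s.
Proof.
split=> [[mf [m [s fE]]]|[m [s [mf s0 fE]]]].
  exists m, `|s|; split => // B mB; rewrite fE// /real_gaussian_law.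
  have [->|s0] := eqVneq s 0; first by rewrite normr0 gauss_law0.
  rewrite -normal_prob_affine ?normr_gt0//.
  by have [_|_] := ger0P s; rewrite ?normal_probN.
split => //; exists m, s => B mB; rewrite fE// /real_gaussian_law.
have [->|sn0] := eqVneq s 0; first by rewrite gauss_law0.
by rewrite normal_prob_affine// lt0r sn0.
Qed.

Lemma gauss_law_Ex f m s (h : R -> R) : gauss_law f m s -> measurable_fun setT h ->
  Ex P (fun w => h (f w)) = Ex gam (fun x => h (m + s * x)).
Proof. by case=> mf s0 fE mh; apply: Ex_same_law => //; exact: measurable_affine. Qed.

Lemma std_normal_affine_L2 m s : L2 gam (fun x => m + s * x).
Proof. by apply: L2D; [exact: L2_cst|exact/L2Z/std_normal_L2]. Qed.

Lemma gauss_law_L2 f m s : gauss_law f m s -> L2 P f.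
Proof.
case=> mf s0 fE; split => //.
apply: (@L1_same_law _ _ _ _ _ _ _ P gam f (fun x => m + s * x) mf
  (measurable_affine m s) fE (fun x => x ^+ 2)); first exact: exprn_measurable.
exact: (std_normal_affine_L2 m s).2.
Qed.

Lemma gauss_law_mean f m s : gauss_law f m s -> Ex P f = m.
Proof.
move=> fG; rewrite (gauss_law_Ex (h := id) fG)//.
rewrite ExD; [|exact: L1_cst|exact/L1Z/L2_L1/std_normal_L2].
by rewrite Ex_cst ExZ ?std_normal_mean ?mulr0 ?addr0//; exact/L2_L1/std_normal_L2.
Qed.

Lemma gauss_law_variance f m s : gauss_law f m s -> variance_of P f = s ^+ 2 * std_var.
Proof.
move=> fG; rewrite /variance_of (gauss_law_mean fG).
rewrite (gauss_law_Ex (h := fun x => (x - m) ^+ 2) fG); last first.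
  by apply: measurable_funX; exact: measurable_funB.
rewrite /std_var -ExZ; last exact: std_normal_L2.2.
by congr Ex; apply/funext => x; rewrite addrAC subrr add0r exprMn.
Qed.

Lemma gauss_law_sd f m s : gauss_law f m s -> s = Num.sqrt (variance_of P f / std_var).
Proof.
move=> fG; rewrite (gauss_law_variance fG) mulfK ?gt_eqF ?std_var_gt0//.
by rewrite sqrtr_sqr ger0_norm//; case: fG.
Qed.

Lemma real_gaussian_law_mean_var f : real_gaussian P f ->
  gauss_law f (Ex P f) (Num.sqrt (variance_of P f / std_var)).
Proof.
by move=> /real_gaussianP[m [s fG]]; rewrite (gauss_law_mean fG) -(gauss_law_sd fG).
Qed.

Lemma real_gaussian_L2 f : real_gaussian P f -> L2 P f.
Proof. by move=> /real_gaussianP[m [s]]; exact: gauss_law_L2. Qed.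

Lemma gauss_law_affine f m s a b : gauss_law f m s ->
  real_gaussian P (fun w => a * f w + b).
Proof.
move=> [mf s0 fE]; apply/real_gaussianP; exists (a * m + b), (`|a| * s); split.
- by apply: measurable_funD => //; exact: measurable_funM.
- by rewrite mulr_ge0.
move=> B mB; have mA : measurable_fun setT (fun x : R => a * x + b).
  by apply: measurable_funD => //; exact: measurable_funM.
have := fE _ (mA measurableT B mB); rewrite setTI => E.
transitivity (P (f @^-1` ((fun x => a * x + b) @^-1` B))) => //.
rewrite E; have [a0|a0] := ger0P a.
  by congr (gam _); apply/funext => x /=; congr B; ring.
rewrite std_normalN; last first.
  rewrite -[X in measurable X]setTI; apply: measurable_affine => //.
  by have := mA measurableT B mB; rewrite setTI.
by congr (gam _); apply/funext => x /=; congr B; ring.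
Qed.

Lemma real_gaussian_affine f a b : real_gaussian P f ->
  real_gaussian P (fun w => a * f w + b).
Proof. by move=> /real_gaussianP[m [s]]; exact: gauss_law_affine. Qed.

(* By symmetry about the mean. *)
Lemma real_gaussian_median f : real_gaussian P f ->
  (2^-1%:E <= P [set w | (Ex P f <= f w)%R])%E.
Proof.
move=> fg; have [mf s0 fE] := real_gaussian_law_mean_var fg.
set m := Ex P f in fE *; set s := Num.sqrt _ in s0 fE *.
have mray : measurable [set x : R | m <= x].
  rewrite (_ : [set _ | _] = `[m, +oo[%classic)//.
  by apply/seteqP; split => x /=; rewrite in_itv/= andbT.
rewrite (_ : [set w | _] = f @^-1` [set x | m <= x])// fE//.
set A := _ @^-1` _.
have mA : measurable A by rewrite -[A]setTI; exact: measurable_affine.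
have mNA : measurable ((fun x : R => - x) @^-1` A).
  by rewrite -[X in measurable X]setTI; apply: measurable_funN => //; exact: measurable_id.
have U : A `|` (fun x => - x) @^-1` A = setT.
  rewrite -subTset => x _; rewrite /A /=; have [x0|x0] := leP 0 x.
    by left; have := mulr_ge0 s0 x0; lra.
  have h : 0 <= s * (- x) by rewrite mulr_ge0//; lra.
  by right; lra.
have : (1 <= gam A + gam A)%E.
  rewrite {2}(std_normalN mA) -(probability_setT gam) -U.
  exact: measureU2.
rewrite -(fineK (fin_num_measure gam _ mA)) -EFinD !lee_fin; lra.
Qed.

End one_space.

Section gaussian_uniqueness.
Context {d1 d2 : measure_display} {T1 : measurableType d1} {T2 : measurableType d2}.
Variables (P1 : probability T1 R) (P2 : probability T2 R).
Variables (G : Type) (D : set (G -> R)) (U1 : T1 -> G) (U2 : T2 -> G).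
Hypothesis D_add : forall f g, D f -> D g -> D (fun x => f x + g x).
Hypothesis D_scale : forall c f, D f -> D (fun x => c * f x).
Hypothesis D1 : forall f, D f -> real_gaussian P1 (fun w => f (U1 w)).
Hypothesis D2 : forall f, D f -> real_gaussian P2 (fun w => f (U2 w)).
Hypothesis D_mean : forall f, D f -> Ex P1 (fun w => f (U1 w)) = Ex P2 (fun w => f (U2 w)).
Hypothesis D_var : forall f, D f ->
  variance_of P1 (fun w => f (U1 w)) = variance_of P2 (fun w => f (U2 w)).

(** A Gaussian law is fixed by its mean and variance, hence so is each [E cos (f + a)], and
    [sigma_of_law] applies. The later comparisons of Gaussian families reduce to variances through
    this lemma. *)
Lemma gaussian_law_unique S : sigma_of D S -> [/\ measurable (U1 @^-1` S),
  measurable (U2 @^-1` S) & P1 (U1 @^-1` S) = P2 (U2 @^-1` S)].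
Proof.
apply: sigma_of_law => //.
- by move=> f /D1[].
- by move=> f /D2[].
- move=> f a Df.
  have mc : measurable_fun setT (fun x : R => cos (x + a)).
    apply: (@measurableT_comp _ _ _ _ _ _ (@cos R)); last exact: measurable_funD.
    by apply: continuous_measurable_fun => x; exact: continuous_cos.
  have g1 := real_gaussian_law_mean_var (D1 Df).
  have g2 := real_gaussian_law_mean_var (D2 Df).
  by rewrite (gauss_law_Ex g1 mc) (gauss_law_Ex g2 mc) D_mean// D_var.
Qed.

End gaussian_uniqueness.

Section limit.
Context {d : measure_display} {T : measurableType d}.
Variables (P : probability T R) (f_ : nat -> T -> R) (f : T -> R) (m v : R).

(** Dominated convergence passes [E cos (z f + a)] to the limit both under [P] and under the
    standard normal law; [sigma_of_law], with the multiples of the identity as [D], then identifies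
    the law of [f]. *)
Lemma real_gaussian_limit : (forall n, real_gaussian P (f_ n)) ->
  (forall w, f_ n w @[n --> \oo] --> f w) ->
  Ex P (f_ n) @[n --> \oo] --> m -> variance_of P (f_ n) @[n --> \oo] --> v ->
  gauss_law P f m (Num.sqrt (v / std_var)).
Proof.
move=> fg cf cm cv; have G n := real_gaussian_law_mean_var (fg n).
have mf : measurable_fun setT f.
  by apply: (measurable_fun_cvg (fun n => (fg n).1)) => w _; exact: cf.
pose s_ n := Num.sqrt (variance_of P (f_ n) / std_var).
pose s := Num.sqrt (v / std_var).
have cs : s_ n @[n --> \oo] --> s.
  apply: (@continuous_cvg _ _ _ _ _ _ (@Num.sqrt R)); first exact: sqrt_continuous.
  by apply: cvgM => //; exact: cvg_cst.
split => // B mB.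
have mcos (b c : R) : measurable_fun setT (fun x : R => cos (b * x + c)).
  apply: (@measurableT_comp _ _ _ _ _ _ (@cos R)).
    by apply: continuous_measurable_fun => x; exact: continuous_cos.
  by apply: measurable_funD => //; exact: measurable_funM.
have ccos (u_ : nat -> R) u a : u_ n @[n --> \oo] --> u ->
    cos (a + u_ n) @[n --> \oo] --> cos (a + u).
  move=> cu; apply: (@continuous_cvg _ _ _ _ _ _ (@cos R)); first exact: continuous_cos.
  by apply: cvgD => //; exact: cvg_cst.
have key z a : Ex P (fun w => cos (z * f w + a)) = Ex gam (fun x => cos (z * (m + s * x) + a)).
  have [_ c1] : L1 P (fun w => cos (z * f w + a)) /\
      Ex P (fun w => cos (z * f_ n w + a)) @[n --> \oo] --> Ex P (fun w => cos (z * f w + a)).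
    apply: (@Ex_dct _ _ _ P _ _ (fun=> 1)); last exact: L1_cst.
    - by move=> n; apply: measurableT_comp (mcos z a) (fg n).1.
    - move=> w; under eq_fun do rewrite addrC; rewrite addrC; apply: ccos.
      by apply: cvgM => //; exact: cvg_cst.
    - by move=> n w; exact: cos_max.
  have [_ c2] : L1 gam (fun x => cos (z * (m + s * x) + a)) /\
      Ex gam (fun x => cos (z * (Ex P (f_ n) + s_ n * x) + a)) @[n --> \oo] -->
      Ex gam (fun x => cos (z * (m + s * x) + a)).
    apply: (@Ex_dct _ _ _ gam _ _ (fun=> 1)); last exact: L1_cst.
    - move=> n; apply: (measurableT_comp (mcos z a) (measurable_affine _ _)).
    - move=> w; under eq_fun do rewrite addrC; rewrite addrC; apply: ccos.
      apply: cvgM; first exact: cvg_cst.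
      by apply: cvgD => //; apply: cvgM => //; exact: cvg_cst.
    - by move=> n w; exact: cos_max.
  rewrite -(cvg_lim _ c1)// -(cvg_lim _ c2)//; congr (lim (_ @ \oo)); apply/funext => n.
  exact: (gauss_law_Ex (G n) (mcos z a)).
pose D := [set h : R -> R | exists z, h = *%R z].
have [] := @sigma_of_law _ _ _ _ _ P gam _ D f (fun x => m + s * x) _ _ _ _ _ B.
- by move=> _ _ [z1 ->] [z2 ->]; exists (z1 + z2); apply/funext => x; rewrite mulrDl.
- by move=> c _ [z ->]; exists (c * z); apply/funext => x; rewrite mulrA.
- by move=> _ [z ->]; exact: measurable_funM.
- by move=> _ [z ->]; apply: measurable_funM => //; exact: measurable_affine.
- by move=> _ a [z ->]; exact: key.
- apply: sub_sigma_algebra; exists id; last by exists B => //; rewrite setTI.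
  by exists 1; apply/funext => x; rewrite mul1r.
- by [].
Qed.

End limit.

Section product.
Context {d1 d2 : measure_display} {T1 : measurableType d1} {T2 : measurableType d2}.
Variables (P1 : probability T1 R) (P2 : probability T2 R).

Lemma gauss_law_product f g m s m' s' : gauss_law P1 f m s -> gauss_law P2 g m' s' ->
  gauss_law (P1 \x P2)%E (fun w => f w.1 + g w.2) (m + m') (Num.sqrt (s ^+ 2 + s' ^+ 2)).
Proof.
move=> [mf s0 fE] [mg s'0 gE].
have mh : measurable_fun setT (fun w : T1 * T2 => f w.1 + g w.2).
  by apply: measurable_funD; apply: measurableT_comp.
split => // B mB; set B' := (fun z : R => (m + m') + z) @^-1` B.
have mB' : measurable B'.
  by rewrite -[B']setTI; apply: measurable_funD => //; exact: measurable_id.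
(* A measurable set of the plane, so that the measure of its sections is a measurable function of
   [f w] and the law of [f] can be replaced by its standard form. *)
pose A := [set z : R * R | B (z.1 + (m' + s' * z.2))].
have mA : measurable A.
  rewrite -[A]setTI; apply: (_ : measurable_fun setT (fun z : R * R => z.1 + (m' + s' * z.2))) => //.
  by apply: measurable_funD => //; apply: measurable_funD => //; apply: measurable_funM.
have mgam : measurable_fun setT (gam \o xsection A) by exact: measurable_fun_xsection.
transitivity (\int[P1]_w gam (xsection A (f w)))%E.
  apply: eq_integral => w _ /=.
  have mS : measurable ((fun x : R => f w + x) @^-1` B).
    by rewrite -[X in measurable X]setTI; apply: measurable_funD => //; exact: measurable_id.
  transitivity (P2 (g @^-1` ((fun x => f w + x) @^-1` B))).
    by congr (P2 _); apply/seteqP; split => y; rewrite /xsection/= inE.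
  rewrite gE//; congr (gam _); apply/seteqP; split => y; rewrite /xsection/= inE//.
rewrite (@ge0_integral_same_law _ _ _ _ _ _ _ P1 gam f (fun x => m + s * x) mf
  (measurable_affine m s) fE (gam \o xsection A))//.
have E x : gam (xsection A (m + s * x)) = gam ((fun y => s * x + s' * y) @^-1` B').
  by congr (gam _); apply/seteqP; split => y; rewrite /xsection/= inE /A /B'/=;
    congr B; ring.
under eq_integral do rewrite /= E.
transitivity (gam ((fun x => Num.sqrt (s ^+ 2 + s' ^+ 2) * x) @^-1` B')); last first.
  by congr (gam _); apply/funext => x /=; rewrite /B'/= addrA.
(* [std_normal_convolution] asks for two positive scales; degenerate summands are treated by
   hand. *)
have [se|sn0] := eqVneq s 0.
  transitivity (\int[gam]_x gam ((fun y => s' * y)%R @^-1` B'))%E.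
    by apply: eq_integral => x _; congr (gam _); apply/funext => y /=; rewrite se mul0r add0r.
  by rewrite integral_cst//= probability_setT mule1 se expr0n/= add0r sqrtr_sqr ger0_norm.
have [se'|s'n0] := eqVneq s' 0; last first.
  by apply: std_normal_convolution => //; rewrite lt0r ?sn0 ?s'n0.
rewrite se' expr0n/= addr0 sqrtr_sqr ger0_norm//.
have msB : measurable ((fun x => s * x) @^-1` B').
  by rewrite -[X in measurable X]setTI; apply: measurable_funM => //; exact: measurable_id.
transitivity (\int[gam]_x (\1_((fun x => s * x)%R @^-1` B') x)%:E)%E; last first.
  by rewrite integral_indic// setIT.
apply: eq_integral => x _.
rewrite indicE; case: (boolP (x \in _)) => [/set_mem h|/negP h].
  rewrite (_ : _ @^-1` _ = setT) ?probability_setT//.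
  by rewrite -subTset => y _ /=; rewrite mul0r addr0.
rewrite (_ : _ @^-1` _ = set0) ?measure0//.
by rewrite -subset0 => y /=; rewrite mul0r addr0 => ?; apply: h; exact/mem_set.
Qed.

End product.

End gauss_law.

(** * Continuous linear functionals and the Hahn-Banach theorem *)

Definition scalar_fun {R : realType} {E : lmodType R} (f : E -> R) of scalar f := f.

HB.instance Definition _ {R : realType} {E : lmodType R} (f : E -> R) (hf : scalar f) :=
  GRing.isLinear.Build R E R *%R (scalar_fun hf) hf.

Section topological_dual.
Context {R : realType} {E : normedModType R}.
Implicit Type f : E -> R.

Definition dual_of f (hf : scalar f) (cf : continuous f) : topdual E :=
  @TopDual R E (scalar_fun hf) cf.

Lemma scalar_bounded_continuous f (hf : scalar f) C :
  (forall y, `|f y| <= C * `|y|) -> continuous f.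
Proof.
move=> fC x; apply/cvgrPdist_lt => e e0; near=> y.
have -> : f x - f y = f (x - y).
  by rewrite [x - y]addrC -(scaleN1r y) hf mulN1r addrC.
have C0 : 0 < `|C| + 1 by rewrite ltr_wpDl.
rewrite (le_lt_trans (fC _))// (@le_lt_trans _ _ ((`|C| + 1) * `|x - y|))//.
  by rewrite ler_wpM2r// (le_trans (ler_norm _))// lerDl.
rewrite mulrC -ltr_pdivlMr//; near: y.
by apply: cvgr_dist_lt; [exact: cvg_id|rewrite divr_gt0].
Unshelve. all: by end_near. Qed.

Lemma dualP (x' : topdual E) : scalar x'.
Proof. by move=> a y z; rewrite linearP. Qed.

Lemma dualD (x' : topdual E) y z : x' (y + z) = x' y + x' z. Proof. exact: linearD. Qed.
Lemma dualB (x' : topdual E) y z : x' (y - z) = x' y - x' z. Proof. exact: linearB. Qed.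
Lemma dualN (x' : topdual E) y : x' (- y) = - x' y. Proof. exact: linearN. Qed.
Lemma dual0 (x' : topdual E) : x' 0 = 0. Proof. exact: linear0. Qed.
Lemma dualZ (x' : topdual E) (a : R) y : x' (a *: y) = a * x' y.
Proof. by have := dualP x' a y 0; rewrite dual0 !addr0. Qed.
Lemma dual_sum (x' : topdual E) I (s : seq I) (Q : pred I) (h : I -> E) :
  x' (\sum_(i <- s | Q i) h i) = \sum_(i <- s | Q i) x' (h i).
Proof. exact: linear_sum. Qed.

Lemma dual_bounded (x' : topdual E) :
  exists2 C, 0 <= C & forall y, `|x' y| <= C * `|y|.
Proof.
have /cvgrPdist_lt/(_ 1 ltr01) := @topdual_continuous R E x' 0.
move=> /nbhs_ballP[e /= e0 he]; exists (2 / e) => [|y]; first by rewrite divr_ge0// ltW.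
have [->|y0] := eqVneq y 0; first by rewrite dual0 !normr0 mulr0.
have ny : 0 < `|y| by rewrite normr_gt0.
have := he ((e / (2 * `|y|)) *: y); rewrite dual0 sub0r normrN dualZ normrM.
have a0 : 0 < e / (2 * `|y|) by rewrite divr_gt0// mulr_gt0.
rewrite gtr0_norm// => h; apply/ltW.
rewrite -(ltr_pM2l a0) (lt_le_trans (h _))//.
  rewrite -ball_normE/= sub0r normrN normrZ gtr0_norm//.
  have -> : e / (2 * `|y|) * `|y| = e / 2 by field; rewrite gt_eqF.
  by lra.
rewrite le_eqVlt; apply/orP; left; apply/eqP.
by field; rewrite !gt_eqF.
Qed.

End topological_dual.

Section hahn_banach.
Context {R : realType} {E : normedModType R}.
Variable x0 : E.

Let line : set (E * R) := [set p | exists a : R, p = (a *: x0, a * `|x0|)].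

(** Sets of pairs stand for graphs of partial functionals. Adjoining [line] inside the predicate
    makes the empty set admissible, so the union of the empty chain causes no trouble in Zorn's
    lemma. *)
Let dominated (A : set (E * R)) : Prop :=
  (forall a p q, (A `|` line) p -> (A `|` line) q ->
     (A `|` line) (a *: p.1 + q.1, a * p.2 + q.2)) /\
  (forall p, (A `|` line) p -> p.2 <= `|p.1|).

Let line_le p : line p -> p.2 <= `|p.1|.
Proof. by move=> [a ->] /=; rewrite normrZ ler_wpM2r// ler_norm. Qed.

Let line_lin a p q : line p -> line q -> line (a *: p.1 + q.1, a * p.2 + q.2).
Proof.
move=> [b ->] [c ->] /=; exists (a * b + c).
by rewrite scalerDl scalerA mulrDl mulrA.
Qed.

Lemma norming_functional : exists x' : topdual E,
  (forall y, `|x' y| <= `|y|) /\ x' x0 = `|x0|.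
Proof.
have [|A [[Alin Ale] Amax]] := @Zorn_bigcup _ dominated.
  move=> F FP Ftot.
  have up B a p q : F B -> (B `|` line) p -> (B `|` line) q ->
      (\bigcup_(X in F) X `|` line) (a *: p.1 + q.1, a * p.2 + q.2).
    move=> FB hp hq; have [h _] := FP _ FB.
    by case: (h a p q hp hq) => [hB|hl]; [left; exists B|right].
  split.
    move=> a p q [[B FB Bp]|lp] [[C FC Cq]|lq].
    - have [BC|CB] := Ftot _ _ FB FC.
        by apply: (up C) => //; left => //; exact: BC.
      by apply: (up B) => //; left => //; exact: CB.
    - by apply: (up B) => //; [left|right].
    - by apply: (up C) => //; [right|left].
    - by right; exact: line_lin.
  move=> p [[B FB Bp]|lp]; last exact: line_le.
  by have [_] := FP _ FB; apply; left.
set G := A `|` line in Alin Ale.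
have G0 : G (0, 0) by right; exists 0; rewrite scale0r mul0r.
have GZ a p : G p -> G (a *: p.1, a * p.2).
  by move=> Gp; have := Alin a _ _ Gp G0; rewrite !addr0.
(* Domination forces the graph to be single-valued: it contains [(0, r - t)] and [(0, t - r)], so
   both numbers are at most [0]. *)
have Gfun y r t : G (y, r) -> G (y, t) -> r = t.
  move=> Gr Gt; have := Ale _ (Alin (-1) _ _ Gr Gt); have := Ale _ (Alin (-1) _ _ Gt Gr).
  rewrite /= scaleN1r addNr normr0; lra.
have Gtot y : exists r, G (y, r).
  apply: contrapT => Gy; have {}Gy r : ~ G (y, r) by move=> h; apply: Gy; exists r.
  (* One-dimensional extension: the value at [y] must lie between all [p.2 - |p.1 - y|] and all
     [|p.1 + y| - p.2]; the supremum of the lower bounds is chosen. *)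
  pose S := [set s | exists2 p, G p & s = p.2 - `|p.1 - y|].
  have SU p : G p -> ubound S (`|p.1 + y| - p.2).
    move=> Gp _ [q Gq ->]; have := Ale _ (Alin 1 _ _ Gq Gp).
    rewrite /= scale1r mul1r => h.
    have : `|q.1 + p.1| <= `|q.1 - y| + `|p.1 + y|.
      rewrite (_ : q.1 + p.1 = (q.1 - y) + (p.1 + y)) ?ler_normD//.
      by rewrite addrACA addNr addr0.
    lra.
  have S0 : S !=set0 by exists (- `|y|); exists (0, 0) => //=; rewrite !sub0r normrN.
  have Ssup : has_sup S by split => //; exists (`|0 + y| - 0); exact: (SU _ G0).
  pose al := sup S.
  have al1 p : G p -> p.2 - `|p.1 - y| <= al.
    by move=> Gp; apply: sup_upper_bound => //; exists p.
  have al2 p : G p -> al <= `|p.1 + y| - p.2.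
    by move=> Gp; apply: ge_sup => //; exact: SU.
  pose G' := [set p | exists q a, G q /\ p = (q.1 + a *: y, q.2 + a * al)].
  have GG' : G `<=` G'.
    by move=> [z r] h; exists (z, r), 0; rewrite scale0r mul0r !addr0.
  have G'line : G' `|` line = G'.
    by apply/seteqP; split => [p [//|lp]|p]; [apply: GG'; right|left].
  apply: (Amax G').
    split; first by move=> p Ap; apply: GG'; left.
    move=> /(_ (y, al)) h; apply: (Gy al); left; apply: h.
    by exists (0, 0), 1; rewrite scale1r mul1r !add0r.
  split; rewrite G'line.
    move=> a _ _ [p [b [Gp ->]]] [q [c [Gq ->]]] /=.
    exists (a *: p.1 + q.1, a * p.2 + q.2), (a * b + c); split; first exact: Alin.
    by rewrite /= scalerDr scalerA scalerDl addrACA; congr (_, _); ring.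
  move=> _ [p [b [Gp ->]]] /=.
  have [b0|b0|->] := ltgtP b 0; last by rewrite scale0r mul0r !addr0; exact: Ale.
  - have b0' : 0 < - b by lra.
    have := al1 _ (GZ (- b)^-1 _ Gp) => /=.
    have -> : (- b)^-1 *: p.1 - y = (- b)^-1 *: (p.1 + b *: y).
      by rewrite scalerDr scalerA invrN mulNr mulVf ?lt_eqF// scaleN1r.
    rewrite normrZ gtr0_norm ?invr_gt0// -mulrBr ler_pdivrMl//; lra.
  - have := al2 _ (GZ b^-1 _ Gp) => /=.
    have -> : b^-1 *: p.1 + y = b^-1 *: (p.1 + b *: y).
      by rewrite scalerDr scalerA mulVf ?gt_eqF// scale1r.
    rewrite normrZ gtr0_norm ?invr_gt0// -mulrBr ler_pdivlMl//; lra.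
pose f y := projT1 (cid (Gtot y)); have fG y : G (y, f y) by exact: (projT2 (cid (Gtot y))).
have fs : scalar f.
  by move=> a y z; apply: (Gfun (a *: y + z)) => //; have := Alin a _ _ (fG y) (fG z).
have f1 y : `|f y| <= `|y|.
  rewrite ler_norml; have := Ale _ (fG y); have /= := Ale _ (fG (- y)).
  rewrite normrN; have -> : f (- y) = - f y.
    apply: (Gfun (- y)) => //; have := GZ (-1) _ (fG y).
    by rewrite /= scaleN1r mulN1r.
  by move=> h1 h2; apply/andP; split; lra.
have fc : continuous f.
  by apply: (scalar_bounded_continuous fs (C := 1)) => y; rewrite mul1r.
exists (dual_of fs fc); split => //=.
by apply: (Gfun x0) => //; right; exists 1; rewrite scale1r mul1r.
Qed.

Lemma dual_eq0 : (forall x' : topdual E, x' x0 = 0) -> x0 = 0.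
Proof.
by move=> h; have [x' [_]] := norming_functional; rewrite h => /esym/normr0_eq0.
Qed.

End hahn_banach.

Lemma dual_inj {R : realType} {E : normedModType R} (x y : E) :
  (forall x' : topdual E, x' x = x' y) -> x = y.
Proof.
move=> h; apply/eqP; rewrite -subr_eq0; apply/eqP/dual_eq0 => x'.
by rewrite dualB h subrr.
Qed.

(** * Borel sets of a separable normed space and weak measurability *)

Lemma continuous_borel_measurable {R : realType} {E : normedModType R} (f : E -> R) :
  continuous f -> measurable_fun setT (f : borelType E -> R).
Proof.
move=> cf; apply: (measurability _ (RGenOpens.measurableE R)) => _ [_ [x [y ->]] <-].
rewrite setTI; apply: sub_sigma_algebra.
by apply: open_comp; [move=> z _; exact: cf|exact: interval_open].
Qed.

Lemma dual_measurable {R : realType} {E : normedModType R} (x' : topdual E) :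
  measurable_fun setT (x' : borelType E -> R).
Proof. exact: continuous_borel_measurable (@topdual_continuous R E x'). Qed.

Section separable.
Context {R : realType} {E : normedModType R}.
Hypothesis sepE : separable_space E.

Lemma dense_sequence : exists d : nat -> E,
  forall y e, 0 < e -> exists k, `|y - d k| < e.
Proof.
have [D /countable_injP[f fi] dD] := sepE.
(* The default [0] stands at the indices that code no point of [D]. *)
exists (fun k => xget 0 [set x | D x /\ f x = k]) => y e e0.
have [z [yz Dz]] : (ball y e `&` D) !=set0.
  by apply: dD; [exists y; exact: ballxx|exact: ball_open].
exists (f z); have [Dx fx] : [set x | D x /\ f x = f z] (xget 0 [set x | D x /\ f x = f z]).
  by apply: xgetPex; exists z.
rewrite (fi _ z _ _ fx) ?inE//.
by move: yz; rewrite -ball_normE.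
Qed.

(** One norming functional for each point of a dense sequence; at [y] it falls short of the norm by
    at most twice the distance from [y] to that point. *)
Lemma norming_sequence : exists u : nat -> topdual E,
  (forall k y, `|u k y| <= `|y|) /\ forall y e, 0 < e -> exists k, `|y| - e < u k y.
Proof.
have [d dd] := dense_sequence.
exists (fun k => projT1 (cid (norming_functional (d k)))); split => [k y|y e e0].
  by case: cid => x' /= [].
have [|k yk] := dd y (e / 2); first by rewrite divr_gt0.
exists k; case: cid => x' /= [h1 h2].
have -> : x' y = x' (d k) + x' (y - d k) by rewrite -dualD addrC subrK.
rewrite h2; have := h1 (y - d k); rewrite ler_norml => /andP[h3 _].
have : `|y| <= `|d k| + `|y - d k|.
  by rewrite (le_trans _ (ler_normD _ _))// addrC subrK.
lra.
Qed.

(** A closed ball is a countable intersection of conditions on norming functionals, and an open set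
    is a countable union of closed balls with dense centres. An arbitrary [S] and [f] are allowed so
    that the lemma yields Pettis' theorem, the identity with [sigma_dual], and the generation of
    Borel sets by families of functionals. *)
Lemma borel_sigma_algebra (T : Type) (S : set (set T)) (f : T -> E) :
  sigma_algebra setT S ->
  (forall (x' : topdual E) B, measurable B -> S ((fun t => x' (f t)) @^-1` B)) ->
  forall B, borel B -> S (f @^-1` B).
Proof.
move=> sS hS; have [d dd] := dense_sequence; have [u [u1 u2]] := norming_sequence.
have [S0 SC SU] := sS.
have SI (F : nat -> set T) : (forall k, S (F k)) -> S (\bigcap_k F k).
  move=> h; rewrite -[\bigcap_k _]setCK setC_bigcap -setTD; apply: (SC).
  by apply: (SU) => k; rewrite -setTD; exact: SC.
suff : <<s @open E >> `<=` image_set_system setT f S.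
  by move=> h B /h; rewrite /image_set_system/= setTI.
apply: smallest_sub; first exact: sigma_algebra_image.
move=> U oU; rewrite /image_set_system/= setTI.
pose cball k n := [set t | `|f t - d k| <= n.+1%:R^-1].
have Sball k n : S (cball k n).
  have -> : cball k n = \bigcap_j ((fun t => u j (f t)) @^-1`
      [set r | `|r - u j (d k)| <= n.+1%:R^-1]).
    apply/seteqP; split => t.
      by move=> h j _ /=; rewrite -dualB (le_trans (u1 _ _)).
    move=> h; rewrite /cball/= leNgt; apply/negP => lt.
    have [|j] := u2 (f t - d k) (`|f t - d k| - n.+1%:R^-1); first by rewrite subr_gt0.
    have /= := h j I; rewrite -dualB => h1 h2.
    by move: h2; rewrite subKr ltNge (le_trans (ler_norm _) h1).
  apply: SI => j; apply: hS.
  have -> : [set r | `|r - u j (d k)| <= n.+1%:R^-1] =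
     (fun r => `|r - u j (d k)|) @^-1` `]-oo, n.+1%:R^-1]%classic.
    by apply/seteqP; split => r /=; rewrite in_itv.
  rewrite -[_ @^-1` _]setTI; apply: (measurableT_comp (f := @Num.norm R R)) => //.
  exact: measurable_funB.
(* A ball that does not fit into [U] is replaced by the empty set, which lets the union run over all
   indices. *)
have -> : f @^-1` U = \bigcup_k \bigcup_n
    (if `[< [set y | `|y - d k| <= n.+1%:R^-1] `<=` U >] then cball k n else set0).
  apply/seteqP; split => t /=; last first.
    move=> [k _ [n _]]; case: asboolP => // h; exact: h.
  move=> Uft; have := open_nbhs_nbhs (conj oU Uft) => /nbhs_ballP[e /= e0 he].
  have [n hn] : exists n : nat, 2 * n.+1%:R^-1 < e.
    have : (2 * n.+1%:R^-1 : R) @[n --> \oo] --> (2 * 0 : R).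
      by apply: cvgM; [exact: cvg_cst|exact: cvg_harmonic].
    rewrite mulr0 => /cvgr0Pnorm_lt/(_ _ e0)[N _ /(_ _ (leqnn N))/= h].
    by exists N; rewrite (le_lt_trans (ler_norm _)).
  have [|k hk] := dd (f t) n.+1%:R^-1; first by rewrite invr_gt0.
  exists k => //; exists n => //; case: asboolP => [_|]; first by rewrite /cball/= ltW.
  case=> y /= hy; apply: he; rewrite -ball_normE/=.
  have tri : `|f t - y| <= `|f t - d k| + `|y - d k|.
    by rewrite -(normrN (y - _)) (le_trans _ (ler_normD _ _))// opprB addrA subrK.
  by rewrite (le_lt_trans _ hn)// (le_trans tri)// mulr_natl mulr2n lerD// ltW.
apply: (SU) => k; apply: (SU) => n; case: asboolP => // _; exact: S0.
Qed.

Lemma borel_sigma_dual : @borel R E = sigma_dual E.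
Proof.
apply/seteqP; split=> [B|].
  apply: (borel_sigma_algebra (f := id)); first exact: smallest_sigma_algebra.
  move=> x' C mC; apply: sub_sigma_algebra; exists x' => //.
  by exists C => //; rewrite setTI.
apply: smallest_sub; first exact: smallest_sigma_algebra.
move=> _ [x' _ [B mB <-]]; rewrite setTI.
by have := dual_measurable x' measurableT mB; rewrite setTI.
Qed.

End separable.

Section borel_functions.
Context {R : realType} {E : normedModType R}.

Lemma continuous_borel_fun {V : normedModType R} (f : E -> V) : continuous f ->
  forall B, borel B -> borel (f @^-1` B).
Proof.
move=> cf B bB.
suff : <<s @open V >> `<=` image_set_system setT f (@borel R E).
  by move=> /(_ B bB); rewrite /image_set_system/= setTI.
apply: smallest_sub.
  by apply: sigma_algebra_image; exact: smallest_sigma_algebra.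
move=> U oU; rewrite /image_set_system/= setTI; apply: sub_sigma_algebra.
by apply: (open_comp _ oU) => y _; exact: cf.
Qed.

Context {d : measure_display} {T : measurableType d}.

Lemma borel_fun_dual (f : T -> E) (x' : topdual E) : borel_fun f ->
  measurable_fun setT (fun w => x' (f w)).
Proof. by move=> bf; exact: (measurableT_comp (dual_measurable x') bf). Qed.

Lemma borel_fun_norm (f : T -> E) : borel_fun f -> measurable_fun setT (fun w => `|f w|).
Proof.
move=> bf.
exact: (measurableT_comp (continuous_borel_measurable (@norm_continuous _ E)) bf).
Qed.

(** Separability reduces measurability in [E] to real functions; sums, multiples and limits of
    [E]-valued maps are all treated this way. *)
Lemma pettis (f : T -> E) : separable_space E ->
  (forall x' : topdual E, measurable_fun setT (fun w => x' (f w))) -> borel_fun f.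
Proof.
move=> sE mf _ B mB; rewrite setTI.
apply: (borel_sigma_algebra sE (S := @measurable _ T)) => //.
  split=> // [A mA|F mF]; first by rewrite setTD; exact: measurableC.
  exact: bigcupT_measurable.
by move=> x' C mC; rewrite -[_ @^-1` _]setTI; exact: mf.
Qed.

End borel_functions.

Lemma cvgn_cauchy {R : realType} {E : completeNormedModType R} (u : nat -> E) :
  (forall e, 0 < e -> exists N, forall n, (N <= n)%N -> `|u N - u n| < e) -> cvgn u.
Proof.
move=> h; apply/cauchy_cvgP; apply: cauchy_exP => e /h[N hN].
by exists (u N), N => // n /= Nn; rewrite -ball_normE; exact: hN.
Qed.

(** * The Bochner integral by nearest-point approximation *)

Section nearest_point.
Context {R : realType} {E : normedModType R}.
Variable d : nat -> E.
Hypothesis dd : forall y e, 0 < e -> exists k, `|y - d k| < e.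

(* A point of {0, d 0, ..., d (n - 1)} nearest to [x]. *)
Fixpoint nearest (n : nat) (x : E) : E :=
  if n is k.+1 then
    if `|x - d k| < `|x - nearest k x| then d k else nearest k x
  else 0.

(** Holds because [0] is the first candidate; it makes the norm itself the dominating function for
    the approximation error. *)
Lemma nearest_dist n x : `|x - nearest n x| <= `|x|.
Proof.
elim: n => [|n IH] /=; first by rewrite subr0.
by case: ifPn => // h; rewrite (le_trans (ltW h)).
Qed.

Lemma nearest_distS n x : `|x - nearest n.+1 x| = Num.min `|x - d n| `|x - nearest n x|.
Proof. by rewrite /=; case: ltP => // h; rewrite ?(min_idPl (ltW h)) ?(min_idPr h). Qed.

Lemma nearest_dist_mono m n x : (m <= n)%N -> `|x - nearest n x| <= `|x - nearest m x|.
Proof.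
move=> /subnK <-; elim: (n - m)%N => [|k IH]; first by rewrite add0n.
by rewrite addSn nearest_distS ge_min IH orbT.
Qed.

Lemma cvg_nearest x : `|x - nearest n x| @[n --> \oo] --> 0.
Proof.
apply/cvgr0Pnorm_lt => e e0; have [k hk] := dd x e0.
exists k.+1 => // n /= kn; rewrite normr_id (le_lt_trans (nearest_dist_mono _ kn))//.
by rewrite nearest_distS gt_min hk.
Qed.

Lemma nearest_finite n : finite_set (range (nearest n)).
Proof.
elim: n => [|n IH].
  apply: (@sub_finite_set _ _ [set 0]) => [_ [x _ <-]//|]; exact: finite_set1.
apply: (@sub_finite_set _ _ ([set d n] `|` range (nearest n))).
  by move=> _ [x _ <-] /=; case: ifPn => _; [left|right; exists x].
by rewrite finite_setU; split => //; exact: finite_set1.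
Qed.

Lemma nearest_dist_measurable n :
  measurable_fun setT ((fun x => `|x - nearest n x|) : borelType E -> R).
Proof.
elim: n => [|n IH].
  by under eq_fun do rewrite subr0; apply: continuous_borel_measurable; exact: norm_continuous.
under eq_fun do rewrite nearest_distS; apply: measurable_minr => //.
apply: continuous_borel_measurable => x; apply: cvg_norm.
by apply: cvgB; [exact: cvg_id|exact: cvg_cst].
Qed.

Lemma nearest_measurable n y : borel (nearest n @^-1` [set y]).
Proof.
elim: n => [|n IH] /=.
  have [->|y0] := eqVneq y 0.
    rewrite (_ : _ @^-1` _ = setT); first exact: measurableT.
    by rewrite -subTset.
  rewrite (_ : _ @^-1` _ = set0); first exact: measurable0.
  by rewrite -subset0 => x /= /esym/eqP; rewrite (negbTE y0).
pose A : set (borelType E) := [set x | `|x - d n| < `|x - nearest n x|].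
have mA : measurable A.
  rewrite (_ : A = (fun x : borelType E => `|x - nearest n x| - `|x - d n|) @^-1` `]0, +oo[%classic).
    rewrite -[_ @^-1` _]setTI; apply: measurable_funB => //.
      exact: nearest_dist_measurable.
    apply: continuous_borel_measurable => x; apply: cvg_norm.
    by apply: cvgB; [exact: cvg_id|exact: cvg_cst].
  by apply/seteqP; split => x; rewrite /A /= in_itv/= andbT subr_gt0.
rewrite (_ : _ @^-1` _ = (A `&` [set _ | d n = y]) `|` (~` A `&` nearest n @^-1` [set y])).
  apply: measurableU; apply: measurableI => //.
    have [h|h] := pselect (d n = y).
      by rewrite (_ : [set _ | _] = setT)// -subTset.
    by rewrite (_ : [set _ | _] = set0)// -subset0.
  exact: measurableC.
apply/seteqP; split => x; rewrite /A /=; case: ifPn => h.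
- by left.
- by move=> xy; right; split => //; apply/negP.
- by move=> [[]|[]].
- by move=> [[]|[]] //; rewrite (negbTE h).
Qed.

End nearest_point.

Section simple_functions.
Context {R : realType} {d : measure_display} {T : measurableType d}.
Variables (P : probability T R) (E : normedModType R) (s : T -> E).
Hypothesis ss : simple_fun s.

Let rg : seq E := finmap.enum_fset (fset_set (range s)).

Lemma simple_decomp (h : E -> R) w :
  h (s w) = \sum_(x <- rg) h x * \1_(s @^-1` [set x]) w.
Proof.
have sw : s w \in rg.
  apply: (eq_trans (in_fset_set ss.1 (s w))).
  by apply/mem_set; exists w.
rewrite (bigD1_seq (s w))//=; last exact: finmap.fset_uniq.
rewrite indicE mem_set//= mulr1 big1 ?addr0// => x xw.
by rewrite indicE memNset ?mulr0//= => /esym/eqP; rewrite (negbTE xw).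
Qed.

Lemma simple_measurable (h : E -> R) : measurable_fun setT (h \o s).
Proof.
have -> : h \o s = fun w => \sum_(x <- rg) h x * \1_(s @^-1` [set x]) w.
  by apply/funext => w; exact: simple_decomp.
apply: measurable_sum => x; apply: measurable_funM => //.
by apply: measurable_indic; exact: ss.2.
Qed.

Lemma simple_L1 (h : E -> R) : L1 P (h \o s).
Proof.
have -> : h \o s = fun w => \sum_(x <- rg) h x * \1_(s @^-1` [set x]) w.
  by apply/funext => w; exact: simple_decomp.
by apply: L1_sum => x _; apply: L1Z; apply: L1_indic; exact: ss.2.
Qed.

Lemma simple_Ex (h : E -> R) : Ex P (h \o s) =
  \sum_(x <- rg) h x * fine (P (s @^-1` [set x])).
Proof.
have -> : h \o s = fun w => \sum_(x <- rg) h x * \1_(s @^-1` [set x]) w.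
  by apply/funext => w; exact: simple_decomp.
rewrite Ex_sum; last first.
  by move=> x _; apply: L1Z; apply: L1_indic; exact: ss.2.
apply: eq_bigr => x _; rewrite ExZ; last by apply: L1_indic; exact: ss.2.
by rewrite Ex_indic//; exact: ss.2.
Qed.

Lemma dual_simple_integral (x' : topdual E) :
  x' (simple_integral P s) = Ex P (fun w => x' (s w)).
Proof.
rewrite (simple_Ex x') /simple_integral fsbig_finite/=; last exact: ss.1.
by rewrite dual_sum; apply: eq_bigr => x _; rewrite dualZ mulrC.
Qed.

End simple_functions.

Section bochner_integral.
Context {R : realType} {d : measure_display} {T : measurableType d}.
Variables (P : probability T R) (E : completeNormedModType R).
Hypothesis sepE : separable_space E.
Implicit Types (f : T -> E) (u : nat -> T -> E).

Lemma borel_funD f g : borel_fun f -> borel_fun g -> borel_fun (fun w => f w + g w).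
Proof.
move=> bf bg; apply: pettis => // x'; under eq_fun do rewrite dualD.
by apply: measurable_funD; exact: borel_fun_dual.
Qed.

Lemma borel_funZ (h : T -> R) f : measurable_fun setT h -> borel_fun f ->
  borel_fun (fun w => h w *: f w).
Proof.
move=> mh bf; apply: pettis => // x'; under eq_fun do rewrite dualZ.
by apply: measurable_funM => //; exact: borel_fun_dual.
Qed.

Lemma borel_fun_cst (c : E) : borel_fun (fun _ : T => c).
Proof. by apply: measurable_cst. Qed.

Lemma borel_funB f g : borel_fun f -> borel_fun g -> borel_fun (fun w => f w - g w).
Proof.
move=> bf bg; apply: pettis => // x'; under eq_fun do rewrite dualB.
by apply: measurable_funB; exact: borel_fun_dual.
Qed.

Lemma simple_borel_fun (s : T -> E) : simple_fun s -> borel_fun s.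
Proof. by move=> ss; apply: pettis => // x'; exact: simple_measurable. Qed.

Lemma L1_norm_dual f (x' : topdual E) : borel_fun f -> L1 P (fun w => `|f w|) ->
  L1 P (fun w => x' (f w)).
Proof.
move=> bf f1; have [C C0 hC] := dual_bounded x'.
by apply: (L1_le _ _ (L1Z C f1)); [exact: borel_fun_dual|move=> w].
Qed.

Let err f u n := Ex P (fun w => `|f w - u n w|).

Let approx_L1 f u : bochner_approx P f u -> L1 P (fun w => `|f w|) ->
  (forall n, L1 P (fun w => `|f w - u n w|)) /\ err f u n @[n --> \oo] --> 0.
Proof.
move=> [bf su cu] f1.
have L n : L1 P (fun w => `|f w - u n w|).
  apply: (L1_le _ _ (L1D f1 (simple_L1 P (su n) (@Num.norm _ E)))).
    by apply: borel_fun_norm; apply: borel_funB => //; exact: simple_borel_fun.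
  by move=> w; rewrite normr_id ler_normB.
split => //; move: cu; under eq_fun do rewrite -ExE//.
by move=> /fine_cvgP[_].
Qed.

(** A functional that norms the difference turns the estimate into one for real expectations. *)
Let simple_integral_dist f u m n : bochner_approx P f u -> L1 P (fun w => `|f w|) ->
  `|simple_integral P (u m) - simple_integral P (u n)| <= err f u m + err f u n.
Proof.
move=> bu f1; have [L _] := approx_L1 bu f1; have [bf su _] := bu.
have [x' [x'1 <-]] := norming_functional (simple_integral P (u m) - simple_integral P (u n)).
have S k : L1 P (fun w => x' (u k w)) by exact: (simple_L1 P (su k) x').
rewrite dualB !dual_simple_integral// -ExB// -ExD//.
apply: Ex_le; [exact: L1B|exact: L1D|move=> w].
rewrite -dualB (le_trans (ler_norm _))// (le_trans (x'1 _))//.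
have -> : u m w - u n w = - (f w - u m w) + (f w - u n w).
  by rewrite opprB addrA subrK.
by rewrite (le_trans (ler_normD _ _))// normrN.
Qed.

Let simple_integral_cvg f u : bochner_approx P f u -> L1 P (fun w => `|f w|) ->
  cvgn (fun n => simple_integral P (u n)).
Proof.
move=> bu f1; have [L c0] := approx_L1 bu f1; apply: cvgn_cauchy => e e0.
have /cvgr0Pnorm_lt/(_ (e / 2)) := c0; rewrite divr_gt0// => /(_ isT)[N _ hN].
exists N => n Nn; rewrite (le_lt_trans (simple_integral_dist _ _ bu f1))//.
have := hN _ Nn; have /= := hN _ (leqnn N).
have := ler_norm (err f u n); have := ler_norm (err f u N); lra.
Qed.

Let dual_of_approx f u x (x' : topdual E) : bochner_approx P f u -> L1 P (fun w => `|f w|) ->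
  simple_integral P (u n) @[n --> \oo] --> x -> x' x = Ex P (fun w => x' (f w)).
Proof.
move=> bu f1 cx; have [L c0] := approx_L1 bu f1; have [bf su _] := bu.
have [C C0 hC] := dual_bounded x'.
have c1 : x' (simple_integral P (u n)) @[n --> \oo] --> x' x.
  by apply: (@continuous_cvg _ _ _ _ _ _ (x' : E -> R)); [exact: topdual_continuous|].
have S k : L1 P (fun w => x' (u k w)) by exact: (simple_L1 P (su k) x').
have c2 : x' (simple_integral P (u n)) @[n --> \oo] --> Ex P (fun w => x' (f w)).
  apply/cvgrPdist_lt => e e0.
  have : C * err f u n @[n --> \oo] --> C * 0 by apply: cvgM => //; exact: cvg_cst.
  rewrite mulr0 => /cvgr0Pnorm_lt/(_ _ e0); apply: filterS => n.
  apply: le_lt_trans; rewrite dual_simple_integral// -ExB//; last exact: L1_norm_dual.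
  have LB : L1 P (fun w => x' (f w) - x' (u n w)) by apply: L1B => //; exact: L1_norm_dual.
  rewrite (le_trans (Ex_norm LB))// (le_trans _ (ler_norm _))// -ExZ//.
  apply: Ex_le; [exact: L1_norm|exact: L1Z|move=> w].
  by rewrite -dualB.
by rewrite -(cvg_lim _ c1)// -(cvg_lim _ c2).
Qed.

(** The nearest points form simple functions whose error is bounded by [|f|] and tends to [0] by
    density, so dominated convergence applies. *)
Lemma bochner_approx_nearest f : borel_fun f -> L1 P (fun w => `|f w|) ->
  exists u, bochner_approx P f u.
Proof.
move=> bf f1; have [dn dd] := dense_sequence sepE.
have mdist n : measurable_fun setT (fun w => `|f w - nearest dn n (f w)|).
  exact: (measurableT_comp (nearest_dist_measurable dn n) bf).
exists (fun n w => nearest dn n (f w)); split => //.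
  move=> n; split.
    by apply: (sub_finite_set _ (nearest_finite dn n)) => _ [w _ <-]; exists (f w).
  move=> y; rewrite -[_ @^-1` _]setTI.
  have := bf measurableT (nearest dn n @^-1` [set y]).
  by apply; exact: nearest_measurable.
have [_ c] : L1 P (fun=> 0) /\ Ex P (fun w => `|f w - nearest dn n (f w)|) @[n --> \oo] --> Ex P (fun=> 0).
  apply: (@Ex_dct _ _ _ P _ _ (fun w => `|f w|)) => //.
  - by move=> w; exact: cvg_nearest.
  - by move=> n w; rewrite normr_id nearest_dist.
rewrite Ex_cst in c.
have L n : L1 P (fun w => `|f w - nearest dn n (f w)|).
  by apply: (L1_le _ _ f1) => // w; rewrite normr_id nearest_dist.
under eq_fun do rewrite -ExE//; apply: cvg_EFin; [exact: nearW|exact: c].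
Qed.

Lemma bochner_integrableI f : borel_fun f -> L1 P (fun w => `|f w|) -> bochner_integrable P f.
Proof. exact: bochner_approx_nearest. Qed.

(** Whichever approximating sequence [get] selects, its limit takes this value under [x']. From here
    on the integral is handled through functionals. *)
Lemma dual_bochner f (x' : topdual E) : borel_fun f -> L1 P (fun w => `|f w|) ->
  x' (bochner P f) = Ex P (fun w => x' (f w)).
Proof.
move=> bf f1; rewrite /bochner; set S := [set x | _].
have [u bu] := bochner_approx_nearest bf f1.
have [v bv cv] : S (get S).
  apply: getPex; exists (limn (fun n => simple_integral P (u n))), u => //.
  exact: simple_integral_cvg bu f1.
exact: dual_of_approx bv f1 cv.
Qed.

Lemma bochnerP f x : borel_fun f -> L1 P (fun w => `|f w|) ->
  (forall x' : topdual E, x' x = Ex P (fun w => x' (f w))) -> bochner P f = x.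
Proof. by move=> bf f1 h; apply: dual_inj => x'; rewrite h; exact: dual_bochner. Qed.

End bochner_integral.

(** * Level indicators, Fatou's lemma and product expectations *)

Section level_indicators.
Context {R : realType} {d : measure_display} {T : measurableType d}.
Implicit Type h : T -> R.

Lemma measurable_indic_gt h c : measurable_fun setT h ->
  measurable_fun setT (fun x => (c < h x)%R%:R : R).
Proof.
move=> mh; have -> : (fun x => (c < h x)%R%:R : R) = \1_(h @^-1` `]c, +oo[%classic).
  by apply/funext => x; rewrite indicE; congr (_%:R); congr nat_of_bool;
    apply/idP/idP; rewrite inE/= in_itv/= andbT.
by apply: measurable_indic; rewrite -[_ @^-1` _]setTI; exact: mh.
Qed.

Lemma measurable_indic_le h c : measurable_fun setT h ->
  measurable_fun setT (fun x => (h x <= c)%R%:R : R).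
Proof.
move=> mh; have -> : (fun x => (h x <= c)%R%:R : R) = \1_(h @^-1` `]-oo, c]%classic).
  by apply/funext => x; rewrite indicE; congr (_%:R); congr nat_of_bool;
    apply/idP/idP; rewrite inE/= in_itv/=.
by apply: measurable_indic; rewrite -[_ @^-1` _]setTI; exact: mh.
Qed.

Lemma L1_indic_gt (P : probability T R) h c : measurable_fun setT h ->
  L1 P (fun x => (c < h x)%R%:R).
Proof.
move=> mh; apply: (@L1_bounded _ _ _ _ _ 1); first exact: measurable_indic_gt.
by move=> w; case: (_ < _); rewrite ?normr1 ?normr0.
Qed.

Lemma L1_indic_le (P : probability T R) h c : measurable_fun setT h ->
  L1 P (fun x => (h x <= c)%R%:R).
Proof.
move=> mh; apply: (@L1_bounded _ _ _ _ _ 1); first exact: measurable_indic_le.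
by move=> w; case: (h w <= c); rewrite ?normr1 ?normr0.
Qed.

End level_indicators.

Section fatou.
Context {R : realType} {d : measure_display} {T : measurableType d}.
Variable P : probability T R.

Lemma Ex_fatou (f_ : nat -> T -> R) (f : T -> R) C :
  (forall n, L1 P (f_ n)) -> (forall n w, 0 <= f_ n w) -> (forall n, Ex P (f_ n) <= C) ->
  (forall w, f_ n w @[n --> \oo] --> f w) -> L1 P f /\ Ex P f <= C.
Proof.
move=> f1 f0 fC cf.
have mf : measurable_fun setT f.
  by apply: (measurable_fun_cvg (fun n => L1_measurable (f1 n))) => w _; exact: cf.
have fge0 w : 0 <= f w.
  rewrite -(cvg_lim _ (cf w))//; apply: limr_ge; first exact: (cvgP _ (cf w)).
  exact: nearW.
have le : (\int[P]_w (f w)%:E <= C%:E)%E.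
  have -> : (\int[P]_w (f w)%:E = \int[P]_w limn_einf (fun n => (f_ n w)%:E))%E.
    apply: eq_integral => w _.
    have c : (f_ n w)%:E @[n --> \oo] --> (f w)%:E.
      by apply: cvg_EFin; [exact: nearW|exact: cf].
    by rewrite is_cvg_limn_einfE; [apply/esym/cvg_lim|apply: cvgP c].
  apply: (le_trans (fatou P measurableT _ _)).
  - by move=> n; apply/measurable_EFinP; exact: L1_measurable.
  - by move=> n w _; rewrite lee_fin.
  rewrite limn_einf_lim; apply: lime_le; first exact: is_cvg_einfs.
  apply: nearW => n; apply: (@le_trans _ _ (\int[P]_w (f_ n w)%:E)%E).
    by apply: ereal_inf_lbound; exists n => //=.
  by rewrite -ExE// lee_fin.
have L : L1 P f.
  apply/integrableP; split; first exact/measurable_EFinP.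
  have -> : (\int[P]_w `|(f w)%:E| = \int[P]_w (f w)%:E)%E.
    by apply: eq_integral => w _; rewrite gee0_abs// lee_fin.
  by rewrite (le_lt_trans le)// ltry.
by split => //; rewrite -lee_fin ExE.
Qed.

End fatou.

Section product_expectation.
Context {R : realType} {d1 d2 : measure_display}.
Context {T1 : measurableType d1} {T2 : measurableType d2}.
Variables (P1 : probability T1 R) (P2 : probability T2 R).

Lemma ge0_Ex_product (f : T1 -> R) (g : T2 -> R) :
  (forall x, 0 <= f x) -> (forall y, 0 <= g y) -> L1 P1 f -> L1 P2 g ->
  L1 (P1 \x P2)%E (fun w => f w.1 * g w.2) /\
  Ex (P1 \x P2)%E (fun w => f w.1 * g w.2) = Ex P1 f * Ex P2 g.
Proof.
move=> f0 g0 f1 g1.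
have mf := L1_measurable f1; have mg := L1_measurable g1.
have mfg : measurable_fun setT (fun w : T1 * T2 => f w.1 * g w.2).
  by apply: measurable_funM; apply: measurableT_comp.
have E : (\int[P1 \x P2]_w (f w.1 * g w.2)%:E = (Ex P1 f * Ex P2 g)%:E)%E.
  rewrite fubini_tonelli1; last 2 first.
  - exact/measurable_EFinP.
  - by move=> w; rewrite lee_fin mulr_ge0.
  rewrite /fubini_F/=.
  transitivity (\int[P1]_x ((f x)%:E * (Ex P2 g)%:E))%E.
    apply: eq_integral => x _; under eq_integral do rewrite EFinM.
    rewrite ge0_integralZl ?lee_fin// ?ExE//.
    - exact/measurable_EFinP.
    - by move=> y _; rewrite lee_fin.
  rewrite ge0_integralZr ?lee_fin// -?ExE//.
  - exact/measurable_EFinP.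
  - by move=> x _; rewrite lee_fin.
  - exact: Ex_ge0.
have L : L1 (P1 \x P2)%E (fun w => f w.1 * g w.2).
  apply/integrableP; split; first exact/measurable_EFinP.
  have -> : (\int[P1 \x P2]_w `|(f w.1 * g w.2)%:E| =
      \int[P1 \x P2]_w (f w.1 * g w.2)%:E)%E.
    by apply: eq_integral => w _; rewrite gee0_abs// lee_fin mulr_ge0.
  by rewrite E ltry.
split => //; apply/EFin_inj; rewrite ExE//.
Qed.

Lemma real_gaussian_product f g : real_gaussian P1 f -> real_gaussian P2 g ->
  [/\ real_gaussian (P1 \x P2)%E (fun w => f w.1 + g w.2),
      Ex (P1 \x P2)%E (fun w => f w.1 + g w.2) = Ex P1 f + Ex P2 g &
      variance_of (P1 \x P2)%E (fun w => f w.1 + g w.2) =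
        variance_of P1 f + variance_of P2 g].
Proof.
move=> /real_gaussianP[m [s fG]] /real_gaussianP[m' [s' gG]].
have h := gauss_law_product fG gG; split.
- by apply/real_gaussianP; eexists; eexists; exact: h.
- by rewrite (gauss_law_mean h) (gauss_law_mean fG) (gauss_law_mean gG).
rewrite (gauss_law_variance h) (gauss_law_variance fG) (gauss_law_variance gG).
by rewrite sqr_sqrtr ?mulrDl// addr_ge0 ?sqr_ge0.
Qed.

End product_expectation.

(** * Fernique's inequality for finite suprema *)

(** With [u = (3 x - 4 y) / 5] one has [(4 x + 3 y) / 5 = (4 u + 5 y) / 3]. A rotation with rational
    cosine and sine keeps all estimates within linear arithmetic. *)
Lemma rotation_bound1 {R : realType} (x y s : R) :
  - s <= (3 * x - 4 * y) / 5 <= s -> - s <= y <= s ->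
  - (3 * s) <= (4 * x + 3 * y) / 5 <= 3 * s.
Proof. by move=> /andP[? ?] /andP[? ?]; apply/andP; split; lra. Qed.

(** With the same [u], now [(4 x + 3 y) / 5 = (5 x - 3 u) / 4]; the coefficients are rounded up to
    [2] and [1]. *)
Lemma rotation_bound2 {R : realType} (x y z s : R) : 0 <= z ->
  - s <= (3 * x - 4 * y) / 5 <= s -> - z <= x <= z ->
  - (2 * z + s) <= (4 * x + 3 * y) / 5 <= 2 * z + s.
Proof. by move=> ? /andP[? ?] /andP[? ?]; apply/andP; split; lra. Qed.

Section rotation.
Context {R : realType} {d : measure_display} {T : measurableType d}.
Variable P : probability T R.
Variable H : set (T -> R).
Hypothesis H_add : forall f g, H f -> H g -> H (fun w => f w + g w).
Hypothesis H_scale : forall c f, H f -> H (fun w => c * f w).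
Hypothesis H_gauss : forall f, H f -> real_gaussian P f.
Hypothesis H_mean : forall f, H f -> Ex P f = 0.
Variable xi : nat -> T -> R.
Hypothesis Hxi : forall k, H (xi k).

Let G := ((nat -> R) * (nat -> R))%type.
Let U1 (w : T * T) : G := (fun k => xi k w.1, fun k => xi k w.2).
Let U2 (w : T * T) : G := (fun k => (3 * xi k w.1 - 4 * xi k w.2) / 5,
                           fun k => (4 * xi k w.1 + 3 * xi k w.2) / 5).
Let comb (l : seq (nat * R * R)) (g : G) : R :=
  \sum_(q <- l) (q.1.2 * g.1 q.1.1 + q.2 * g.2 q.1.1).
Let D : set (G -> R) := range comb.

(** One pair [f], [g] serves all coefficients [a] and [b], so the original and the rotated family
    are expressed by the same two variables. *)
Let comb_split l : exists f g, [/\ H f, H g & forall a b : R * R, forall w,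
  comb l (fun k => a.1 * xi k w.1 + a.2 * xi k w.2, fun k => b.1 * xi k w.1 + b.2 * xi k w.2) =
  (a.1 * f w.1 + b.1 * g w.1) + (a.2 * f w.2 + b.2 * g w.2)].
Proof.
elim: l => [|[[k u] v] l [f [g [Hf Hg fgE]]]].
  exists (fun w => 0 * xi 0%N w), (fun w => 0 * xi 0%N w); split; try exact: H_scale.
  by move=> a b w; rewrite /comb big_nil !(mul0r, mulr0, addr0).
exists (fun w => u * xi k w + f w), (fun w => v * xi k w + g w); split.
- by apply: H_add => //; exact: H_scale.
- by apply: H_add => //; exact: H_scale.
by move=> a b w; rewrite /comb big_cons -/(comb l _) fgE /=; ring.
Qed.

Let H2 f : H f -> L2 P f. Proof. by move=> Hf; exact/real_gaussian_L2/H_gauss. Qed.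

Let H_var f : H f -> variance_of P f = Ex P (fun w => f w * f w).
Proof.
move=> Hf; rewrite /variance_of (H_mean Hf).
by congr (Ex P); apply/funext => w; rewrite subr0.
Qed.

Let H_var_comb a b f g : H f -> H g -> variance_of P (fun w => a * f w + b * g w) =
  a ^+ 2 * Ex P (fun w => f w * f w) + 2 * a * b * Ex P (fun w => f w * g w) +
  b ^+ 2 * Ex P (fun w => g w * g w).
Proof.
move=> Hf Hg; rewrite H_var; last by apply: H_add; exact: H_scale.
have ff := L2_mul (H2 Hf) (H2 Hf); have fg := L2_mul (H2 Hf) (H2 Hg).
have gg := L2_mul (H2 Hg) (H2 Hg).
transitivity (Ex P (fun w => a ^+ 2 * (f w * f w) +
    (2 * a * b * (f w * g w) + b ^+ 2 * (g w * g w)))).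
  by congr Ex; apply/funext => w; ring.
rewrite (ExD (L1Z _ ff) (L1D (L1Z _ fg) (L1Z _ gg))) (ExD (L1Z _ fg) (L1Z _ gg)).
by rewrite !ExZ// addrA.
Qed.

(** Rotation turns the coefficients [f], [g] of the two copies into [(3 f + 4 g) / 5] and
    [(3 g - 4 f) / 5]. In the sum of their variances the mixed terms cancel and the squares restore
    those of [f] and [g]. *)
Lemma rotation_law S : sigma_of D S -> [/\ measurable (U1 @^-1` S),
  measurable (U2 @^-1` S) & (P \x P)%E (U1 @^-1` S) = (P \x P)%E (U2 @^-1` S)].
Proof.
have E1 l f g : (forall a b : R * R, forall w,
  comb l (fun k => a.1 * xi k w.1 + a.2 * xi k w.2, fun k => b.1 * xi k w.1 + b.2 * xi k w.2) =
  (a.1 * f w.1 + b.1 * g w.1) + (a.2 * f w.2 + b.2 * g w.2)) ->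
  (fun w => comb l (U1 w)) = (fun w => f w.1 + g w.2).
  move=> h; apply/funext => w; have := h (1, 0) (0, 1) w; rewrite /= !mul1r !mul0r addr0 add0r => <-.
  by congr (comb l (_, _)); apply/funext => k; ring.
have E2 l f g : (forall a b : R * R, forall w,
  comb l (fun k => a.1 * xi k w.1 + a.2 * xi k w.2, fun k => b.1 * xi k w.1 + b.2 * xi k w.2) =
  (a.1 * f w.1 + b.1 * g w.1) + (a.2 * f w.2 + b.2 * g w.2)) ->
  (fun w => comb l (U2 w)) = (fun w => (fun x => 3 / 5 * f x + 4 / 5 * g x) w.1 +
    (fun x => - 4 / 5 * f x + 3 / 5 * g x) w.2).
  move=> h; apply/funext => w; have := h (3 / 5, - 4 / 5) (4 / 5, 3 / 5) w => /= <-.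
  by congr (comb l (_, _)); apply/funext => k; field.
have Hc a b f g : H f -> H g -> H (fun x => a * f x + b * g x).
  by move=> Hf Hg; apply: H_add; exact: H_scale.
apply: gaussian_law_unique.
- move=> _ _ [l _ <-] [k _ <-]; exists (l ++ k) => //.
  by apply/funext => g; rewrite /comb big_cat.
- move=> c _ [l _ <-]; exists [seq (q.1.1, c * q.1.2, c * q.2) | q <- l] => //.
  apply/funext => g; rewrite /comb big_map mulr_sumr; apply: eq_bigr => q _ /=.
  by rewrite mulrDr !mulrA.
- move=> _ [l _ <-]; have [f [g [Hf Hg h]]] := comb_split l; rewrite (E1 _ _ _ h).
  by have [] := real_gaussian_product (H_gauss Hf) (H_gauss Hg).
- move=> _ [l _ <-]; have [f [g [Hf Hg h]]] := comb_split l; rewrite (E2 _ _ _ h).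
  by have [] := real_gaussian_product (H_gauss (Hc (3/5) (4/5) _ _ Hf Hg))
    (H_gauss (Hc (- 4/5) (3/5) _ _ Hf Hg)).
- move=> _ [l _ <-]; have [f [g [Hf Hg h]]] := comb_split l; rewrite (E1 _ _ _ h) (E2 _ _ _ h).
  have [_ -> _] := real_gaussian_product (H_gauss Hf) (H_gauss Hg).
  have [_ -> _] := real_gaussian_product (H_gauss (Hc (3/5) (4/5) _ _ Hf Hg))
    (H_gauss (Hc (- 4/5) (3/5) _ _ Hf Hg)).
  by rewrite !H_mean//; exact: Hc.
- move=> _ [l _ <-]; have [f [g [Hf Hg h]]] := comb_split l; rewrite (E1 _ _ _ h) (E2 _ _ _ h).
  have [_ _ ->] := real_gaussian_product (H_gauss Hf) (H_gauss Hg).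
  have [_ _ ->] := real_gaussian_product (H_gauss (Hc (3/5) (4/5) _ _ Hf Hg))
    (H_gauss (Hc (- 4/5) (3/5) _ _ Hf Hg)).
  by rewrite !H_var_comb// !H_var//; field.
Qed.

Fixpoint partial_sup (K : nat) (a : nat -> R) : R :=
  if K is k.+1 then Num.max (partial_sup k a) `|a k| else 0.

Lemma partial_sup_ge0 K a : 0 <= partial_sup K a.
Proof. by elim: K => //= K IH; rewrite le_max IH. Qed.

Lemma partial_supP K a c : 0 <= c ->
  (partial_sup K a <= c) <-> (forall k, (k < K)%N -> `|a k| <= c).
Proof.
move=> c0; elim: K => [|K IH] /=; first by split.
rewrite ge_max; split=> [/andP[/IH h1 h2] k|h].
  by rewrite ltnS leq_eqVlt => /predU1P[->//|/h1].
by apply/andP; split; [apply/IH => k kK; apply: h; exact: ltnW|exact: h].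
Qed.

Lemma partial_sup_le K a k : (k < K)%N -> `|a k| <= partial_sup K a.
Proof. by have [+ _] := partial_supP K a (partial_sup_ge0 K a); apply. Qed.

Let GT := g_sigma_algebraType (\bigcup_(f in D) preimage_set_system setT f (@measurable _ R)).

Let D_meas (f : G -> R) : D f -> measurable_fun setT (f : GT -> R).
Proof. by move=> Df _ B mB; apply: sub_sigma_algebra; exists f => //; exists B. Qed.

Let coord1 k : measurable_fun setT ((fun g => g.1 k) : GT -> R).
Proof.
apply: D_meas; exists [:: (k, 1, 0)] => //; apply/funext => g.
by rewrite /comb big_seq1 /= mul1r mul0r addr0.
Qed.

Let coord2 k : measurable_fun setT ((fun g => g.2 k) : GT -> R).
Proof.
apply: D_meas; exists [:: (k, 0, 1)] => //; apply/funext => g.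
by rewrite /comb big_seq1 /= mul1r mul0r add0r.
Qed.

Lemma measurable_partial_sup d' (S : measurableType d') K (h : nat -> S -> R) :
  (forall k, measurable_fun setT (h k)) ->
  measurable_fun setT (fun x => partial_sup K (fun k => h k x)).
Proof.
move=> mh; elim: K => [|K IH].
  exact: measurable_cst.
by apply: measurable_maxr => //; apply: measurableT_comp.
Qed.

Lemma partial_sup_L2 K : L2 P (fun w => partial_sup K (fun k => xi k w)).
Proof.
elim: K => [|K IH].
  exact: L2_cst.
apply: (L2_le _ _ (L2D IH (L2_norm (H2 (Hxi K))))).
  by apply: measurable_maxr; [exact: IH.1|exact/L2_measurable/L2_norm/H2].
move=> w /=; have h := partial_sup_ge0 K (fun k => xi k w).
rewrite ger0_norm ?le_max ?h// ge_max lerDl normr_ge0.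
by rewrite lerDr h.
Qed.

(* One step of Fernique's argument: a finite supremum already has a second moment,
   so a single rotation bounds it in terms of a quantile. *)
Lemma fernique K (s : R) : 0 <= s ->
  Ex P (fun w => (s < partial_sup K (fun k => xi k w))%R%:R) <= 17^-1 ->
  Ex P (fun w => partial_sup K (fun k => xi k w) ^+ 2) <= 19 * s ^+ 2.
Proof.
move=> s0 Ps; pose M := partial_sup K.
(* Before rotation [phi] is a product of functions of the two copies. After it, a small first and a
   large second coordinate force the supremum of the second copy above [s], and bound the second
   coordinate by [2 m + s], where [m] is the supremum of the first copy: again a product. *)
pose phi (g : G) : R := (M g.1 <= s)%R%:R * (M g.2 ^+ 2 * (3 * s < M g.2)%R%:R).
have mM1 : measurable_fun setT ((fun g => M g.1) : GT -> R) by exact: measurable_partial_sup.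
have mM2 : measurable_fun setT ((fun g => M g.2) : GT -> R) by exact: measurable_partial_sup.
have mphi : measurable_fun setT (phi : GT -> R).
  apply: measurable_funM; first exact: measurable_indic_le.
  by apply: measurable_funM; [exact: measurable_funX|exact: measurable_indic_gt].
have phiS B : measurable B -> sigma_of D (phi @^-1` B).
  by move=> mB; have := mphi measurableT B mB; rewrite setTI.
have mphi1 : measurable_fun setT (phi \o U1).
  by move=> _ B mB; rewrite setTI; have [] := rotation_law (phiS B mB).
have mphi2 : measurable_fun setT (phi \o U2).
  by move=> _ B mB; rewrite setTI; have [] := rotation_law (phiS B mB).
have lawE B : measurable B -> (P \x P)%E ((phi \o U1) @^-1` B) = (P \x P)%E ((phi \o U2) @^-1` B).
  by move=> mB; have [] := rotation_law (phiS B mB).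
have mi : measurable_fun setT (fun x : R => x) by exact: measurable_id.
have EE : Ex (P \x P)%E (phi \o U1) = Ex (P \x P)%E (phi \o U2).
  exact: (@Ex_same_law _ _ _ _ _ _ R (P \x P)%E (P \x P)%E _ _ mphi1 mphi2 lawE _ mi).
pose m w := M (fun k => xi k w).
have m2 : L2 P m := partial_sup_L2 K.
have m0 w : 0 <= m w by exact: partial_sup_ge0.
have b01 (b : bool) : 0 <= (b%:R : R) by case: b.
have b1 (b : bool) : (b%:R : R) <= 1 by case: b.
have Lle : L1 P (fun w => (m w <= s)%R%:R).
  exact: L1_indic_le m2.1.
have Llt : L1 P (fun w => (s < m w)%R%:R).
  exact: L1_indic_gt m2.1.
have LA : L1 P (fun w => m w ^+ 2 * (3 * s < m w)%R%:R).
  apply: (L1_le _ _ m2.2).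
    by apply: measurable_funM; [exact: measurable_funX m2.1|exact: measurable_indic_gt m2.1].
  by move=> w; rewrite ger0_norm ?mulr_ge0 ?sqr_ge0// ler_piMr ?sqr_ge0.
have L2ms : L2 P (fun w => 2 * m w + s) by apply: L2D; [exact: L2Z|exact: L2_cst].
have [L11 E11] := ge0_Ex_product (P1 := P) (P2 := P) (fun w => b01 (m w <= s))
  (fun w => mulr_ge0 (sqr_ge0 (m w)) (b01 (3 * s < m w))) Lle LA.
have [L22 E22] := ge0_Ex_product (P1 := P) (P2 := P) (fun w => sqr_ge0 (2 * m w + s))
  (fun w => b01 (s < m w)) L2ms.2 Llt.
have point w : phi (U2 w) <= (2 * m w.1 + s) ^+ 2 * (s < m w.2)%R%:R.
  rewrite /phi; have [h1|_] := leP (M (U2 w).1) s; last first.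
    by rewrite mul0r mulr_ge0 ?sqr_ge0.
  have [h2|_] := ltP (3 * s) (M (U2 w).2); last first.
    by rewrite !mulr0 mulr_ge0 ?sqr_ge0.
  rewrite !mulr1 mul1r.
  have hm1 := (partial_supP K _ s0).1 h1.
  have -> : s < m w.2.
    rewrite ltNge; apply/negP => h3; have hm2 := (partial_supP K _ s0).1 h3.
    move: h2; rewrite ltNge => /negP; apply.
    apply/partial_supP; first by rewrite mulr_ge0.
    move=> k kK; have := hm1 _ kK; have := hm2 _ kK; rewrite /= !ler_norml.
    by move=> h4 h5; exact: rotation_bound1 h5 h4.
  rewrite mulr1 lerXn2r ?nnegrE ?partial_sup_ge0 ?addr_ge0 ?mulr_ge0 ?m0//.
  apply/partial_supP; first by rewrite addr_ge0// mulr_ge0.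
  move=> k kK; have := hm1 _ kK; have := partial_sup_le (fun k => xi k w.1) kK.
  rewrite -/M -/(m w.1) /= !ler_norml; have := m0 w.1.
  by move=> h4 h5 h6; exact: rotation_bound2 h4 h6 h5.
have L2phi : L1 (P \x P)%E (phi \o U2).
  apply: (L1_le mphi2 _ L22) => w; rewrite ger0_norm ?point//.
  rewrite /phi /comp; apply: mulr_ge0; first exact: ler0n.
  by apply: mulr_ge0; [exact: sqr_ge0|exact: ler0n].
have main : Ex P (fun w => (m w <= s)%R%:R) * Ex P (fun w => m w ^+ 2 * (3 * s < m w)%R%:R)
    <= Ex P (fun w => (2 * m w + s) ^+ 2) * Ex P (fun w => (s < m w)%R%:R).
  rewrite -E11 -E22; apply: (@le_trans _ _ (Ex (P \x P)%E (phi \o U2))).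
    by rewrite -EE.
  exact: Ex_le.
set A := Ex P (fun w => m w ^+ 2 * _) in main.
set p := Ex P (fun w => (s < m w)%R%:R) in main Ps.
have A0 : 0 <= A by apply: Ex_ge0 => w; rewrite mulr_ge0 ?sqr_ge0.
have p0 : 0 <= p by exact: Ex_ge0.
have q : Ex P (fun w => (m w <= s)%R%:R) = 1 - p.
  transitivity (Ex P (fun=> 1) - p); last by rewrite Ex_cst.
  rewrite /p -ExB//; last exact: L1_cst.
  congr (Ex P); apply/funext => w; rewrite ltNge.
  by case: (m w <= s); rewrite /= ?subr0 ?subrr.
have e1 : Ex P (fun w => (2 * m w + s) ^+ 2) <= 8 * Ex P (fun w => m w ^+ 2) + 2 * s ^+ 2.
  have L8 : L1 P (fun w => 8 * m w ^+ 2) by exact: L1Z m2.2.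
  have Lc : L1 P (fun=> 2 * s ^+ 2) by exact: L1_cst.
  apply: (@le_trans _ _ (Ex P (fun w => 8 * m w ^+ 2 + 2 * s ^+ 2))).
    apply: Ex_le; [exact: L2ms.2|exact: L1D|move=> w].
    by have := sqr_ge0 (2 * m w - s); nra.
  by rewrite (ExD L8 Lc) (ExZ 8 m2.2) Ex_cst.
have e2 : Ex P (fun w => m w ^+ 2) <= 9 * s ^+ 2 + A.
  have Lc : L1 P (fun=> 9 * s ^+ 2) by exact: L1_cst.
  apply: (@le_trans _ _ (Ex P (fun w => 9 * s ^+ 2 + m w ^+ 2 * (3 * s < m w)%R%:R))).
    apply: Ex_le; [exact: m2.2|exact: L1D|move=> w].
    have := m0 w; have [h|h] := ltP (3 * s) (m w) => m0w; rewrite ?mulr1 ?mulr0 ?addr0.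
      by rewrite lerDr mulr_ge0 ?sqr_ge0.
    by nra.
  by rewrite (ExD Lc LA) Ex_cst.
rewrite q in main; rewrite -/M -/m.
have main2 : 16 / 17 * A <= (8 * Ex P (fun w => m w ^+ 2) + 2 * s ^+ 2) * 17^-1.
  apply: (@le_trans _ _ ((1 - p) * A)); first by rewrite ler_wpM2r//; lra.
  apply: (le_trans main); apply: ler_pM => //.
  by apply: Ex_ge0 => w; exact: sqr_ge0.
by have := sqr_ge0 s; lra.
Qed.

End rotation.

Section dual_operations.
Context {R : realType} {E F : normedModType R}.

Lemma dual_combination (x' y' : topdual E) (a b : R) :
  exists z' : topdual E, forall x, z' x = a * x' x + b * y' x.
Proof.
have fs : scalar (fun x => a * x' x + b * y' x).
  by move=> c x y; rewrite !dualD !dualZ; ring.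
have fc : continuous (fun x => a * x' x + b * y' x).
  move=> x; apply: cvgD; apply: cvgM; try exact: cvg_cst; exact: topdual_continuous.
by exists (dual_of fs fc).
Qed.

Lemma dual_pair (x' : topdual E) (y' : topdual F) :
  exists z' : topdual (E * F)%type, forall p, z' p = x' p.1 + y' p.2.
Proof.
have fs : scalar (fun p : E * F => x' p.1 + y' p.2).
  by move=> c p q /=; rewrite !dualD !dualZ; ring.
have fc : continuous (fun p : E * F => x' p.1 + y' p.2).
  move=> p; apply: cvgD.
    by apply: (@continuous_comp _ _ _ fst x'); [exact: cvg_fst|exact: topdual_continuous].
  by apply: (@continuous_comp _ _ _ snd y'); [exact: cvg_snd|exact: topdual_continuous].
by exists (dual_of fs fc).
Qed.

Lemma dual_comp (A : {linear F -> E}) (x' : topdual E) : continuous A ->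
  exists y' : topdual F, forall y, y' y = x' (A y).
Proof.
move=> cA; have fs : scalar (fun y => x' (A y)).
  by move=> c x y; rewrite linearP dualD dualZ.
have fc : continuous (fun y => x' (A y)).
  by move=> y; apply: (continuous_comp (cA y)); exact: topdual_continuous.
by exists (dual_of fs fc).
Qed.

End dual_operations.

(** * Square integrability of the norm of a Gaussian vector *)

Section gaussian_second_moment.
Context {R : realType} {d : measure_display} {T : measurableType d}.
Variables (P : probability T R) (E : normedModType R) (X : T -> E).
Hypotheses (sepE : separable_space E) (gX : gaussian_rv P X).

Let bX : borel_fun X. Proof. by case: gX. Qed.
Let gauss (x' : topdual E) : real_gaussian P (fun w => x' (X w)). Proof. exact: gX.2. Qed.

(** The tails of [|X|] tend to [0]; [1 / 17] is the level that [fernique] asks for. *)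
Let quantile : exists2 s : R, 0 <= s & Ex P (fun w => (s < `|X w|)%R%:R) <= 17^-1.
Proof.
have [_ c] : L1 P (fun=> 0) /\
    Ex P (fun w => (n%:R < `|X w|)%R%:R) @[n --> \oo] --> Ex P (fun=> 0).
  apply: (@Ex_dct _ _ _ P _ _ (fun=> 1)); last exact: L1_cst.
  - by move=> n; apply: measurable_indic_gt; exact: borel_fun_norm.
  - move=> w; apply: cvg_near_cst; exists (Num.trunc `|X w|).+1 => // n /= h.
    have -> // : (n%:R < `|X w|) = false.
    apply/negbTE; rewrite -leNgt (le_trans (ltW (truncnS_gt _)))//.
    by rewrite ler_nat.
  - by move=> n w; case: (n%:R < _); rewrite ?normr1 ?normr0.
rewrite Ex_cst in c; have /cvgr0Pnorm_lt/(_ 17^-1) := c.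
rewrite invr_gt0 ltr0n => /(_ isT)[N _ /(_ _ (leqnn N)) /= h].
by exists N%:R => //; rewrite ltW// (le_lt_trans (ler_norm _)).
Qed.

(** A Gaussian variable is at least its mean with probability at least [1 / 2]. A mean above [s]
    would make [|X|] exceed [s] with that probability, which is more than [1 / 17]. *)
Let mean_bound s (x' : topdual E) : 0 <= s -> Ex P (fun w => (s < `|X w|)%R%:R) <= 17^-1 ->
  (forall y, `|x' y| <= `|y|) -> Ex P (fun w => x' (X w)) <= s.
Proof.
move=> s0 hs x'1; rewrite leNgt; apply/negP => lt.
have := real_gaussian_median (gauss x').
set A := [set w | _]; have mA : measurable A.
  rewrite (_ : A = (fun w => x' (X w)) @^-1` `[Ex P (fun w => x' (X w)), +oo[%classic).
    by rewrite -[_ @^-1` _]setTI; exact: borel_fun_dual.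
  by apply/seteqP; split => w; rewrite /A /= in_itv/= andbT.
rewrite -(fineK (fin_num_measure P _ mA)) -Ex_indic// lee_fin => h.
suff : Ex P \1_A <= Ex P (fun w => (s < `|X w|)%R%:R) by lra.
apply: Ex_le; [exact: L1_indic| |].
  exact/L1_indic_gt/borel_fun_norm.
move=> w; rewrite indicE; case: (boolP (w \in A)) => [/set_mem Aw|_]; last by case: (_ < _).
rewrite (lt_le_trans lt)// (le_trans _ (x'1 _))// (le_trans _ (ler_norm _))//.
Qed.

(** No mean of [X] in [E] is available before integrability is known. Each functional of a norming
    sequence is therefore centred by its own mean, and the quantile bounds these means uniformly. *)
Lemma gaussian_rv_L2 : L2 P (fun w => `|X w|).
Proof.
split; first exact: borel_fun_norm.
have [u [u1 u2]] := norming_sequence sepE; have [s s0 hs] := quantile.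
pose m k := Ex P (fun w => u k (X w)).
have ms k : `|m k| <= s.
  rewrite ler_norml (mean_bound s0 hs (u1 k)) andbT lerNl.
  have [v' v'E] := dual_combination (u k) (u k) (-1) 0.
  have -> : - m k = Ex P (fun w => v' (X w)).
    rewrite /m -ExN; last exact/L2_L1/real_gaussian_L2/gauss.
    by congr Ex; apply/funext => w; rewrite v'E mul0r addr0 mulN1r.
  by apply: (mean_bound s0 hs) => y; rewrite v'E mul0r addr0 mulN1r normrN.
pose H := [set f | exists x' : topdual E, f = fun w => x' (X w) - Ex P (fun w => x' (X w))].
have L (x' : topdual E) : L1 P (fun w => x' (X w)) by exact/L2_L1/real_gaussian_L2/gauss.
have H_comb a b (x' y' : topdual E) : H (fun w => a * (x' (X w) - Ex P (fun w => x' (X w))) +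
    b * (y' (X w) - Ex P (fun w => y' (X w)))).
  have [z' zE] := dual_combination x' y' a b; exists z'; apply/funext => w.
  have -> : (fun w => z' (X w)) = (fun w => a * x' (X w) + b * y' (X w)).
    by apply/funext => v; rewrite zE.
  by rewrite ExD ?ExZ ?zE//; [ring|exact: L1Z|exact: L1Z].
have H_add f g : H f -> H g -> H (fun w => f w + g w).
  move=> [x' ->] [y' ->]; have := H_comb 1 1 x' y'; congr H; apply/funext => w.
  by rewrite !mul1r.
have H_scale c f : H f -> H (fun w => c * f w).
  move=> [x' ->]; have := H_comb c 0 x' x'; congr H; apply/funext => w.
  by rewrite mul0r addr0.
have H_gauss f : H f -> real_gaussian P f.
  move=> [x' ->]; have := real_gaussian_affine 1 (- Ex P (fun w => x' (X w))) (gauss x').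
  by congr real_gaussian; apply/funext => w; rewrite mul1r.
have H_mean f : H f -> Ex P f = 0.
  by move=> [x' ->]; rewrite ExB ?Ex_cst ?subrr//; exact: L1_cst.
pose xi k w := u k (X w) - m k.
have Hxi k : H (xi k) by exists (u k).
pose M K w := partial_sup K (fun k => xi k w).
have MX K w : M K w <= `|X w| + s.
  apply/partial_supP; first by rewrite addr_ge0.
  by move=> k _; rewrite (le_trans (ler_normB _ _))// lerD.
(* As [M K] is at most [|X| + s], it exceeds [2 s] only where [|X|] exceeds [s], so the level [2 s]
   inherits the quantile bound. *)
have M2 K : Ex P (fun w => M K w ^+ 2) <= 19 * (2 * s) ^+ 2.
  apply: (fernique H_add H_scale H_gauss H_mean Hxi); first by rewrite mulr_ge0.
  apply: le_trans hs; apply: Ex_le.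
  - exact/L1_indic_gt/(partial_sup_L2 H_gauss Hxi K).1.
  - exact/L1_indic_gt/borel_fun_norm.
  - move=> w; have := MX K w; rewrite /M => h.
    case: ltP => //= h1; have [//|h2] := ltP s `|X w|.
    by exfalso; move: h1; rewrite ltNge => /negP; apply; rewrite (le_trans h)//; lra.
have LM K : L2 P (M K) by exact: (partial_sup_L2 H_gauss Hxi K).
(* These minima converge to [|X|], since [M K + s] eventually passes [|X| - e], and their second
   moments are bounded through those of [M K]; Fatou's lemma concludes. *)
pose N K w := Num.min `|X w| (M K w + s).
have N0 K w : 0 <= N K w.
  by rewrite /N le_min normr_ge0 addr_ge0// partial_sup_ge0.
have NM K w : N K w ^+ 2 <= 2 * M K w ^+ 2 + 2 * s ^+ 2.
  apply: (@le_trans _ _ ((M K w + s) ^+ 2)).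
    by rewrite lerXn2r ?nnegrE ?N0 ?addr_ge0 ?partial_sup_ge0// /N ge_min lexx orbT.
  by have := sqr_ge0 (M K w - s); nra.
have LMs K : L1 P (fun w => 2 * M K w ^+ 2 + 2 * s ^+ 2).
  by apply: L1D; [exact: L1Z (LM K).2|exact: L1_cst].
have [] // := @Ex_fatou _ _ _ P (fun K w => N K w ^+ 2) (fun w => `|X w| ^+ 2)
  (2 * (19 * (2 * s) ^+ 2) + 2 * s ^+ 2).
- move=> K; apply: (L1_le _ _ (LMs K)).
    apply: measurable_funX; apply: measurable_minr; first exact: borel_fun_norm.
    by apply: measurable_funD => //; exact: (LM K).1.
  by move=> w; rewrite ger0_norm ?sqr_ge0.
- by move=> K w; exact: sqr_ge0.
- move=> K; apply: (@le_trans _ _ (Ex P (fun w => 2 * M K w ^+ 2 + 2 * s ^+ 2))).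
    apply: Ex_le => //; apply: (L1_le _ _ (LMs K)).
      apply: measurable_funX; apply: measurable_minr; first exact: borel_fun_norm.
      by apply: measurable_funD => //; exact: (LM K).1.
    by move=> w; rewrite ger0_norm ?sqr_ge0.
  rewrite (ExD (L1Z 2 (LM K).2) (L1_cst P (2 * s ^+ 2))) (ExZ 2 (LM K).2) Ex_cst.
  by rewrite lerD2r ler_wpM2l.
move=> w; apply: (@continuous_cvg _ _ _ _ _ _ (fun x : R => x ^+ 2)).
  exact: exprn_continuous.
apply/cvgrPdist_lt => e e0; have [k hk] := u2 (X w) _ e0.
exists k.+1 => // K /= kK.
have h1 : `|X w| - e < M K w + s.
  apply: (lt_le_trans hk); rewrite -(subrK (m k) (u k (X w))).
  apply: lerD; last by rewrite (le_trans (ler_norm _)).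
  by rewrite (le_trans (ler_norm _))// (partial_sup_le (fun k => xi k w) kK).
have h2 : `|X w| - e < N K w by rewrite /N lt_min h1 andbT ltrBlDr ltrDl.
have h3 : N K w <= `|X w| by rewrite /N ge_min lexx.
by rewrite ger0_norm ?subr_ge0// ltrBlDr addrC -ltrBlDr.
Qed.


End gaussian_second_moment.

Lemma split_difference {V : zmodType} (x y c c' : V) :
  x - y = (c - c') + ((x - c) - (y - c')).
Proof. by rewrite (opprB y) addrACA (addrC c) subrK addKr. Qed.

Lemma sq_sum4 {R : realType} (t a b c f : R) : 0 <= t -> 0 <= a -> 0 <= b -> 0 <= c -> 0 <= f ->
  t <= a + b + c + f -> t ^+ 2 <= 4 * (a ^+ 2 + (b ^+ 2 + (c ^+ 2 + f ^+ 2))).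
Proof.
move=> t0 a0 b0 c0 f0 h; apply: (@le_trans _ _ ((a + b + c + f) ^+ 2)).
  by rewrite lerXn2r ?nnegrE// !addr_ge0.
have := sqr_ge0 (a - b); have := sqr_ge0 (a - c); have := sqr_ge0 (a - f).
have := sqr_ge0 (b - c); have := sqr_ge0 (b - f); have := sqr_ge0 (c - f); lra.
Qed.

(** * First passage indicators and sets of convergence *)

Section exceedance.
Context {R : realType} {E : normedModType R}.
Implicit Types (a b : nat -> E) (t : R).

(* The indicator of [exists j < n, t < `|a j|]. *)
Fixpoint exceedance t (n : nat) a : R :=
  if n is k.+1 then exceedance t k a + (1 - exceedance t k a) * (t < `|a k|)%R%:R else 0.

Definition first_exceedance t n a : R := (1 - exceedance t n a) * (t < `|a n|)%R%:R.

Lemma exceedanceP t n a : (exceedance t n a = 1 /\ exists2 j, (j < n)%N & t < `|a j|) \/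
  (exceedance t n a = 0 /\ forall j, (j < n)%N -> `|a j| <= t).
Proof.
elim: n => [|n [[e [j jn tj]]|[e h]]] /=; first by right.
  by left; rewrite e subrr mul0r addr0; split => //; exists j => //; exact: ltnW.
rewrite e add0r subr0 mul1r; have [h1|h1] := ltP t `|a n|; first by left; split => //; exists n.
by right; split => // j; rewrite ltnS leq_eqVlt => /predU1P[->//|/h].
Qed.

Lemma exceedance_01 t n a : 0 <= exceedance t n a <= 1.
Proof. by have [[-> _]|[-> _]] := exceedanceP t n a; rewrite !lexx ?ler01. Qed.

Lemma first_exceedance_01 t n a : 0 <= first_exceedance t n a <= 1.
Proof.
have /andP[h1 h2] := exceedance_01 t n a; rewrite /first_exceedance.
by case: ltP => _ /=; rewrite ?mulr1 ?mulr0 ?lexx ?ler01//; apply/andP; split; lra.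
Qed.

Lemma exceedance_eq t n a b : (forall j, (j < n)%N -> a j = b j) ->
  exceedance t n a = exceedance t n b.
Proof.
by elim: n => //= n IH h; rewrite IH ?h// => j jn; apply: h; exact: ltnW.
Qed.

Lemma first_exceedance_eq t n a b : (forall j, (j <= n)%N -> a j = b j) ->
  first_exceedance t n a = first_exceedance t n b.
Proof.
by move=> h; rewrite /first_exceedance h// (@exceedance_eq _ _ a b)// => j /ltnW/h.
Qed.

(** [2 a n] is the sum of [a n + v] and [a n - v], so one of these exceeds [t] in norm whenever
    [a n] does: the deterministic half of Levy's reflection. *)
Lemma first_exceedance_split t n a v :
  first_exceedance t n a <= first_exceedance t n a * (t < `|a n + v|)%R%:R +
                            first_exceedance t n a * (t < `|a n - v|)%R%:R.
Proof.
have /andP[c0 _] := first_exceedance_01 t n a.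
have [h|h] := ltP t `|a n|; last by rewrite /first_exceedance ltNge h/= !mulr0 !mul0r addr0.
rewrite -mulrDr ler_peMr//.
have [h1|h1] := ltP t `|a n + v|; first by rewrite lerDl; case: (t < _).
have [h2|h2] := ltP t `|a n - v|; first by rewrite add0r.
exfalso; have : `|(a n + v) + (a n - v)| <= `|a n + v| + `|a n - v| by exact: ler_normD.
rewrite addrACA subrr addr0 -mulr2n -scaler_nat normrZ ger0_norm//; lra.
Qed.

Context {d : measure_display} {T : measurableType d}.

Lemma measurable_exceedance t n (h : nat -> T -> E) : (forall j, borel_fun (h j)) ->
  measurable_fun setT (fun x => exceedance t n (fun j => h j x)).
Proof.
move=> bh; elim: n => [|n IH]; first exact: measurable_cst.
rewrite /=; apply: measurable_funD => //; apply: measurable_funM.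
  exact: measurable_funB.
exact/measurable_indic_gt/borel_fun_norm.
Qed.

Lemma measurable_first_exceedance t n (h : nat -> T -> E) : (forall j, borel_fun (h j)) ->
  measurable_fun setT (fun x => first_exceedance t n (fun j => h j x)).
Proof.
move=> bh; apply: measurable_funM; last exact/measurable_indic_gt/borel_fun_norm.
by apply: measurable_funB => //; exact: measurable_exceedance.
Qed.

End exceedance.

Section convergence_set.
Context {R : realType} {d : measure_display} {T : measurableType d}.
Variables (E : completeNormedModType R) (f : nat -> T -> E).
Hypotheses (sepE : separable_space E) (bf : forall n, borel_fun (f n)).

Let close k m := [set x | forall n, `|f (m + n)%N x - f m x| <= k.+1%:R^-1].

(** Cauchy's criterion with every term compared to the one at index [m], the form that a maximal
    inequality started at [m] controls. *)
Lemma cvg_setE : [set x | cvgn (fun n => f n x)] = \bigcap_k \bigcup_m close k m.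
Proof.
apply/seteqP; split => x.
  move=> /cvg_cauchy/cauchyP h k _; have [|y] := h (k.+1%:R^-1 / 2).
    by rewrite divr_gt0// invr_gt0.
  move=> [m _ hm]; exists m => // n.
  have := hm m (leqnn m); have := hm (m + n)%N (leq_addr n m).
  rewrite -ball_normE /= => h1 h2; rewrite distrC.
  have : `|f m x - f (m + n)%N x| <= `|y - f (m + n)%N x| + `|y - f m x|.
    have -> : f m x - f (m + n)%N x = (y - f (m + n)%N x) - (y - f m x).
      by rewrite opprB [RHS]addrC addrA subrK.
    exact: ler_normB.
  move=> /le_trans; apply; rewrite (le_trans (ltW (ltrD h1 h2)))//.
  by rewrite -splitr.
move=> h /=; apply: cvgn_cauchy => e e0.
have [k _ hk] : exists2 k : nat, True & k.+1%:R^-1 < e.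
  have /cvgr0Pnorm_lt/(_ _ e0)[N _ /(_ _ (leqnn N))/= hN] := @cvg_harmonic R.
  by exists N => //; rewrite (le_lt_trans (ler_norm _)).
have [m _ hm] := h k I; exists m => n mn.
by rewrite distrC -(subnKC mn) (le_lt_trans (hm _)).
Qed.

Lemma measurable_close k m : measurable (close k m).
Proof.
have -> : close k m = \bigcap_n [set x | `|f (m + n)%N x - f m x| <= k.+1%:R^-1].
  by apply/seteqP; split => x h n; [move=> _; exact: h|exact: (h n I)].
apply: bigcapT_measurable => n.
rewrite (_ : [set x | _] = (fun x => `|f (m + n)%N x - f m x|) @^-1` `]-oo, k.+1%:R^-1]%classic).
  rewrite -[_ @^-1` _]setTI; apply: borel_fun_norm => //.
  exact: (borel_funB sepE).
by apply/seteqP; split => x; rewrite /= in_itv.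
Qed.

Lemma measurable_cvg_set : measurable [set x | cvgn (fun n => f n x)].
Proof.
rewrite cvg_setE; apply: bigcapT_measurable => k; apply: bigcupT_measurable => m.
exact: measurable_close.
Qed.

(** For each [k] the union over [m] of the [close k m] has probability one, and countably many null
    complements have a null union. *)
Lemma cvg_set_probability (P : probability T R) :
  (forall k e, 0 < e -> exists m, ((1 - e)%:E <= P (close k m))%E) ->
  P [set x | cvgn (fun n => f n x)] = 1%E.
Proof.
move=> h; have mC := measurable_cvg_set.
suff : P (~` [set x | cvgn (fun n => f n x)]) = 0%E.
  move=> h0; have := probability_setC P (measurableC mC).
  by rewrite setCK h0 sube0.
apply: measure_negligible; first exact: measurableC.
rewrite cvg_setE setC_bigcap.
apply: negligible_bigcup => k.
have mB : measurable (\bigcup_m close k m).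
  by apply: bigcupT_measurable => m; exact: measurable_close.
have PB : P (\bigcup_m close k m) = 1%E.
  apply/eqP; rewrite eq_le probability_le1//=; apply/lee_addgt0Pr => e e0.
  have [m hm] := h k _ e0; rewrite -leeBlDr// -EFinB (le_trans hm)//.
  apply: le_measure; rewrite ?inE//; first exact: measurable_close.
  exact: bigcup_sup.
apply/negligibleP; first exact: measurableC.
by have := probability_setC P mB; rewrite PB subee.
Qed.

End convergence_set.

(** * Almost sure modifications and mean-square limits *)

Section almost_sure.
Context {R : realType} {d : measure_display} {T : measurableType d}.
Variable P : probability T R.

Lemma real_gaussian_ae A (f g : T -> R) : measurable A -> P A = 1%E ->
  real_gaussian P f -> measurable_fun setT g -> (forall w, A w -> f w = g w) ->
  real_gaussian P g.
Proof.
move=> mA PA [mf [m [s fE]]] mg fg; split => //; exists m, s => B mB; rewrite -fE//.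
have mfB : measurable (f @^-1` B) by rewrite -[_ @^-1` _]setTI; exact: mf.
have mgB : measurable (g @^-1` B) by rewrite -[_ @^-1` _]setTI; exact: mg.
rewrite -(fineK (fin_num_measure P _ mfB)) -(fineK (fin_num_measure P _ mgB)).
congr EFin; rewrite -!Ex_indic//; apply: (Ex_ae mA PA); try exact: measurable_indic.
by move=> w Aw; rewrite !indicE; congr (nat_of_bool _)%:R; apply/idP/idP;
  rewrite !inE /= fg.
Qed.

(** From [2 f g <= eta f ^ 2 + g ^ 2 / eta] with [eta = e / (V + 1)], each of the two terms
    contributes at most [e / 2]. *)
Lemma Ex_mul_cvg0 (f : T -> R) (g : nat -> T -> R) : L2 P f -> (forall n, L2 P (g n)) ->
  Ex P (fun w => g n w ^+ 2) @[n --> \oo] --> 0 ->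
  Ex P (fun w => f w * g n w) @[n --> \oo] --> 0.
Proof.
move=> f2 g2 c; apply/cvgr0Pnorm_lt => e e0.
pose V := Ex P (fun w => f w ^+ 2); have V0 : 0 <= V by apply: Ex_ge0 => w; exact: sqr_ge0.
pose eta := e / (V + 1); have eta0 : 0 < eta by rewrite divr_gt0// ltr_wpDl.
have /cvgr0Pnorm_lt/(_ (eta * e)) := c; rewrite mulr_gt0// => /(_ isT).
apply: filterS => n; rewrite ger0_norm; last by apply: Ex_ge0 => w; exact: sqr_ge0.
move=> hn; have fg := L2_mul f2 (g2 n); rewrite (le_lt_trans (Ex_norm fg))//.
have LL : L1 P (fun w => 2^-1 * (eta * f w ^+ 2 + eta^-1 * g n w ^+ 2)).
  by apply: L1Z; apply: L1D; apply: L1Z; [exact: f2.2|exact: (g2 n).2].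
apply: (@le_lt_trans _ _ (Ex P (fun w => 2^-1 * (eta * f w ^+ 2 + eta^-1 * g n w ^+ 2)))).
  apply: Ex_le => //; first exact: L1_norm.
  move=> w; rewrite ler_norml.
  have h1 := sqr_ge0 (eta * f w + g n w); have h2 := sqr_ge0 (eta * f w - g n w).
  have h3 : 2^-1 * (eta * f w ^+ 2 + eta^-1 * g n w ^+ 2) - f w * g n w =
     2^-1 * eta^-1 * (eta * f w - g n w) ^+ 2 by field; rewrite gt_eqF.
  have h4 : 2^-1 * (eta * f w ^+ 2 + eta^-1 * g n w ^+ 2) + f w * g n w =
     2^-1 * eta^-1 * (eta * f w + g n w) ^+ 2 by field; rewrite gt_eqF.
  have h5 : 0 <= 2^-1 * eta^-1 by rewrite mulr_ge0// invr_ge0 ltW.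
  by have := mulr_ge0 h5 h1; have := mulr_ge0 h5 h2; rewrite -h3 -h4 => ? ?;
    apply/andP; split; lra.
rewrite (ExZ 2^-1 (L1D (L1Z eta f2.2) (L1Z eta^-1 (g2 n).2))).
rewrite (ExD (L1Z eta f2.2) (L1Z eta^-1 (g2 n).2)) (ExZ eta f2.2) (ExZ eta^-1 (g2 n).2) -/V.
have h6 : eta * V <= e.
  by rewrite /eta mulrAC ler_pdivrMr ?ltr_wpDl// ler_pM2l// lerDl.
have h7 : eta^-1 * Ex P (fun w => g n w ^+ 2) < e by rewrite mulrC ltr_pdivrMr// mulrC.
lra.
Qed.

Lemma Ex_cauchy_schwarz (f g : T -> R) : L2 P f -> L2 P g ->
  Ex P (fun w => f w * g w) ^+ 2 <= Ex P (fun w => f w ^+ 2) * Ex P (fun w => g w ^+ 2).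
Proof.
move=> f2 g2; have fg := L2_mul f2 g2.
set A := Ex P (fun w => f w ^+ 2); set B := Ex P (fun w => g w ^+ 2); set C := Ex P _.
have q (x y : R) : 0 <= x ^+ 2 * A + (2 * x * y * C + y ^+ 2 * B).
  rewrite -(ExZ (x ^+ 2) f2.2) -(ExZ (2 * x * y) fg) -(ExZ (y ^+ 2) g2.2).
  rewrite -(ExD (L1Z (2 * x * y) fg) (L1Z (y ^+ 2) g2.2)).
  rewrite -(ExD (L1Z _ f2.2) (L1D (L1Z (2 * x * y) fg) (L1Z (y ^+ 2) g2.2))).
  apply: Ex_ge0 => w; rewrite (_ : _ + _ = (x * f w + y * g w) ^+ 2) ?sqr_ge0//; ring.
have A0 : 0 <= A by apply: Ex_ge0 => w; exact: sqr_ge0.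
have B0 : 0 <= B by apply: Ex_ge0 => w; exact: sqr_ge0.
have [A_0|A_0] := eqVneq A 0.
  have [C0|C0] := eqVneq C 0; first by rewrite C0 expr0n A_0 mul0r.
  (* When [A = 0] the quadratic form is affine in its first argument, and this value would make it
     equal to [-1]. *)
  have := q (- (B + 1) / (2 * C)) 1; rewrite A_0.
  have -> : 2 * (- (B + 1) / (2 * C)) * 1 * C = - (B + 1) by field.
  by move=> h; exfalso; lra.
have A1 : 0 < A by rewrite lt0r A_0.
have := q (- C / A) 1.
have -> : (- C / A) ^+ 2 * A + (2 * (- C / A) * 1 * C + 1 ^+ 2 * B) = B - C ^+ 2 / A by field.
by rewrite subr_ge0 ler_pdivrMr// mulrC.
Qed.

Lemma Ex_sq_cvg (f : T -> R) (f_ : nat -> T -> R) : L2 P f -> (forall n, L2 P (f_ n)) ->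
  Ex P (fun w => (f_ n w - f w) ^+ 2) @[n --> \oo] --> 0 ->
  Ex P (fun w => f_ n w ^+ 2) @[n --> \oo] --> Ex P (fun w => f w ^+ 2).
Proof.
move=> f2 fn2 c; have g2 n : L2 P (fun w => f_ n w - f w) by exact: L2B.
have c2 := Ex_mul_cvg0 f2 g2 c.
have -> : (fun n => Ex P (fun w => f_ n w ^+ 2)) = (fun n => Ex P (fun w => f w ^+ 2) +
    (2 * Ex P (fun w => f w * (f_ n w - f w)) + Ex P (fun w => (f_ n w - f w) ^+ 2))).
  apply/funext => n; have fg := L2_mul f2 (g2 n).
  rewrite -(ExZ 2 fg) -(ExD (L1Z 2 fg) (g2 n).2) -(ExD f2.2 (L1D (L1Z 2 fg) (g2 n).2)).
  by congr (Ex P); apply/funext => w; ring.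
rewrite -[X in _ --> X]addr0; apply: cvgD; first exact: cvg_cst.
rewrite -[X in _ --> X](addr0 0) -[X in _ --> X + _](mulr0 2).
by apply: cvgD => //; apply: cvgM => //; exact: cvg_cst.
Qed.

End almost_sure.

(** * Regression on an increasing family of functionals, and its Cauchy property *)

Section regression_sequence.
Context {R : realType} {d : measure_display} {T : measurableType d}.
Variables (P : probability T R) (E F : completeNormedModType R).
Hypothesis sepE : separable_space E.
Variables (X0 : T -> E) (Y0 : T -> F).
Hypotheses (bX : borel_fun X0) (bY : borel_fun Y0).
Hypothesis gaussXY : forall (x' : topdual E) (y' : topdual F),
  real_gaussian P (fun w => x' (X0 w) + y' (Y0 w)).
Hypothesis meanXY : forall (x' : topdual E) (y' : topdual F),
  Ex P (fun w => x' (X0 w) + y' (Y0 w)) = 0.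
Hypothesis X2 : L2 P (fun w => `|X0 w|).
Variables (Lf : nat -> set (F -> R)) (Phi : nat -> F -> E).
Hypothesis Lf_dual : forall n l, Lf n l -> exists y' : topdual F, l = y'.
Hypothesis Lf_comb : forall n a b l k, Lf n l -> Lf n k -> Lf n (fun y => a * l y + b * k y).
Hypothesis Lf_mono : forall n l, Lf n l -> Lf n.+1 l.
Hypothesis Phi_dual : forall n (x' : topdual E), Lf n (fun y => x' (Phi n y)).
Hypothesis Phi_orth : forall n (x' : topdual E) l, Lf n l ->
  Ex P (fun w => (x' (X0 w) - x' (Phi n (Y0 w))) * l (Y0 w)) = 0.

Definition regr (n : nat) (w : T) : E := Phi n (Y0 w).
Notation Z := regr.

(** A linear space of centred Gaussian variables, so families inside it are compared by second
    moments alone. *)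
Definition gauss_space : set (T -> R) :=
  [set f | exists (x' : topdual E) (y' : topdual F), f = fun w => x' (X0 w) + y' (Y0 w)].
Notation H := gauss_space.

Lemma gauss_space_comb a b f g : H f -> H g -> H (fun w => a * f w + b * g w).
Proof.
move=> [x1 [y1 ->]] [x2 [y2 ->]].
have [x' xE] := dual_combination x1 x2 a b; have [y' yE] := dual_combination y1 y2 a b.
by exists x', y'; apply/funext => w; rewrite xE yE; ring.
Qed.

Lemma gauss_space_gauss f : H f -> real_gaussian P f.
Proof. by move=> [x' [y' ->]]; exact: gaussXY. Qed.

Lemma gauss_space_mean f : H f -> Ex P f = 0.
Proof. by move=> [x' [y' ->]]; exact: meanXY. Qed.

Lemma gauss_space_L2 f : H f -> L2 P f.
Proof. by move=> /gauss_space_gauss/real_gaussian_L2. Qed.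

Lemma gauss_space_X (x' : topdual E) : H (fun w => x' (X0 w)).
Proof.
have fs : scalar (fun _ : F => 0 : R) by move=> a x y; rewrite mulr0 addr0.
have fc : continuous (fun _ : F => 0 : R) by move=> x; exact: cvg_cst.
by exists x', (dual_of fs fc); apply/funext => w; rewrite addr0.
Qed.

Lemma gauss_space_Y (y' : topdual F) : H (fun w => y' (Y0 w)).
Proof.
have fs : scalar (fun _ : E => 0 : R) by move=> a x y; rewrite mulr0 addr0.
have fc : continuous (fun _ : E => 0 : R) by move=> x; exact: cvg_cst.
by exists (dual_of fs fc), y'; apply/funext => w; rewrite add0r.
Qed.

Lemma gauss_space_Lf n l : Lf n l -> H (fun w => l (Y0 w)).
Proof. by move=> /Lf_dual[y' ->]; exact: gauss_space_Y. Qed.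

Lemma Lf_le m n l : (m <= n)%N -> Lf m l -> Lf n l.
Proof.
move=> /subnK <-; elim: (n - m)%N => [//|k IH] h.
by rewrite addSn; apply: Lf_mono; exact: IH.
Qed.

Lemma gauss_space_regr n (x' : topdual E) : H (fun w => x' (Z n w)).
Proof. exact: gauss_space_Lf (Phi_dual n x'). Qed.

Lemma gauss_space_var f : H f -> variance_of P f = Ex P (fun w => f w * f w).
Proof.
move=> Hf; rewrite /variance_of (gauss_space_mean Hf).
by congr (Ex P); apply/funext => w; rewrite subr0.
Qed.

Let ip f g := Ex P (fun w => f w * g w).

Let ip_combl a b f g h : L2 P f -> L2 P g -> L2 P h ->
  ip (fun w => a * f w + b * g w) h = a * ip f h + b * ip g h.
Proof.
move=> f2 g2 h2; have fh := L2_mul f2 h2; have gh := L2_mul g2 h2.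
rewrite /ip -(ExZ a fh) -(ExZ b gh) -(ExD (L1Z a fh) (L1Z b gh)).
by congr (Ex P); apply/funext => w; ring.
Qed.

Let ipC f g : ip f g = ip g f.
Proof. by congr (Ex P); apply/funext => w; rewrite mulrC. Qed.

Let ip_combr a b f g h : L2 P f -> L2 P g -> L2 P h ->
  ip h (fun w => a * f w + b * g w) = a * ip h f + b * ip h g.
Proof. by move=> f2 g2 h2; rewrite ipC ip_combl// (ipC f) (ipC g). Qed.

Let ip_sq c f h : L2 P f -> L2 P h ->
  ip (fun w => 1 * f w + c * h w) (fun w => 1 * f w + c * h w) =
  ip f f + 2 * c * ip f h + c ^+ 2 * ip h h.
Proof.
move=> f2 h2; have v2 : L2 P (fun w => 1 * f w + c * h w) by apply: L2D; exact: L2Z.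
by rewrite ip_combr// !ip_combl// (ipC h f); ring.
Qed.

Let ip_ge0 f : 0 <= ip f f.
Proof. by apply: Ex_ge0 => w; rewrite -expr2 sqr_ge0. Qed.

Lemma borel_regr n : borel_fun (Z n).
Proof. by apply: pettis => // x'; exact: (gauss_space_gauss (gauss_space_regr n x')).1. Qed.

Lemma regr_L2 n : L2 P (fun w => `|Z n w|).
Proof.
apply: gaussian_rv_L2 => //; split; first exact: borel_regr.
by move=> x'; exact: gauss_space_gauss (gauss_space_regr n x').
Qed.

Section one_functional.
Variable x' : topdual E.
Let g w := x' (X0 w).
Let z n w := x' (Z n w).
Let g2 : L2 P g := gauss_space_L2 (gauss_space_X x').
Let z2 n : L2 P (z n) := gauss_space_L2 (gauss_space_regr n x').

Lemma regr_orth n l : Lf n l -> ip g (fun w => l (Y0 w)) = ip (z n) (fun w => l (Y0 w)).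
Proof.
move=> hl; have l2 := gauss_space_L2 (gauss_space_Lf hl).
have := Phi_orth x' hl.
have -> : (fun w => (x' (X0 w) - x' (Phi n (Y0 w))) * l (Y0 w)) =
    (fun w => g w * l (Y0 w) - z n w * l (Y0 w)).
  by apply/funext => w; rewrite mulrBl.
by rewrite (ExB (L2_mul g2 l2) (L2_mul (z2 n) l2)) => /eqP; rewrite subr_eq0 => /eqP.
Qed.

Lemma regr_orth_le m n l : (m <= n)%N -> Lf m l ->
  ip (z m) (fun w => l (Y0 w)) = ip (z n) (fun w => l (Y0 w)).
Proof. by move=> mn hl; rewrite -(regr_orth hl) (regr_orth (Lf_le mn hl)). Qed.

Lemma regr_increment_orth m n l : (m <= n)%N -> Lf m l ->
  ip (fun w => x' (Z n w - Z m w)) (fun w => l (Y0 w)) = 0.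
Proof.
move=> mn hl; have l2 := gauss_space_L2 (gauss_space_Lf hl).
have := ip_combl 1 (-1) (z2 n) (z2 m) l2.
rewrite (regr_orth_le mn hl) mul1r mulN1r subrr => h.
by rewrite -[RHS]h; congr (Ex P); apply/funext => w; rewrite dualB mul1r mulN1r.
Qed.

(** Pythagoras' identity: the increment is orthogonal to everything observed at stage [m], in
    particular to [z m]. *)
Lemma regr_increment_sq m n : (m <= n)%N ->
  ip (fun w => x' (Z n w - Z m w)) (fun w => x' (Z n w - Z m w)) =
  ip (z n) (z n) - ip (z m) (z m).
Proof.
move=> mn; have e : (fun w => x' (Z n w - Z m w)) = (fun w => 1 * z n w + (-1) * z m w).
  by apply/funext => w; rewrite dualB mul1r mulN1r.
have := regr_increment_orth mn (Phi_dual m x'); rewrite -/(regr m) -/(z m) e => h.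
have d2 : L2 P (fun w => 1 * z n w + (-1) * z m w) by apply: L2D; exact: L2Z.
rewrite ip_combr// h mulr0 addr0 mul1r ip_combl// mul1r mulN1r; congr (_ - _).
by rewrite ipC -(regr_orth_le mn (Phi_dual m x')).
Qed.

Lemma regr_sq_le n : ip (z n) (z n) <= ip g g.
Proof.
have e : ip (z n) g = ip (z n) (z n) by rewrite ipC (regr_orth (Phi_dual n x')).
have d2 : L2 P (fun w => 1 * g w + (-1) * z n w) by apply: L2D; exact: L2Z.
have := ip_ge0 (fun w => 1 * g w + (-1) * z n w).
rewrite ip_combr// !ip_combl// e (ipC g) e; lra.
Qed.

(** The second moments of [z n] increase by Pythagoras and are bounded by Bessel's inequality
    [regr_sq_le]; those of the increments are their differences. *)
Lemma regr_cauchy_dual e : 0 < e -> exists n0, forall m n, (n0 <= m)%N -> (m <= n)%N ->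
  Ex P (fun w => x' (Z n w - Z m w) ^+ 2) < e.
Proof.
move=> e0; pose a n := ip (z n) (z n).
have nd : nondecreasing_seq a.
  move=> m n mn; rewrite -subr_ge0 /a -regr_increment_sq//; exact: ip_ge0.
have ca : cvgn a.
  by apply: nondecreasing_is_cvgn => //; exists (ip g g) => _ [n _ <-]; exact: regr_sq_le.
have := ca => /cvgrPdist_lt/(_ _ e0)[n0 _ h].
exists n0 => m n n0m mn; have -> : Ex P (fun w => x' (Z n w - Z m w) ^+ 2) = a n - a m.
  by rewrite /a -regr_increment_sq.
have := h _ n0m; rewrite /= ltr_norml => /andP[_ hm].
have := nondecreasing_cvgn_le nd ca n; lra.
Qed.

End one_functional.

(** With [d = x' (Z n - Z m)], orthogonality gives the same value for the expectation of [x' (X0) d]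
    and of [d ^ 2]. Hence [x' (X0) - 2 d] has the variance of [x' (X0)], for every [x']. *)
Lemma regr_reflection m n : (m <= n)%N ->
  borel_fun (fun w => X0 w - 2 *: (Z n w - Z m w)) /\ forall B, borel B ->
  P (X0 @^-1` B) = P ((fun w => X0 w - 2 *: (Z n w - Z m w)) @^-1` B).
Proof.
move=> mn; set V := fun w => _.
have VE (x' : topdual E) : (fun w => x' (V w)) = fun w => 1 * x' (X0 w) +
   (-2) * (1 * x' (Z n w) + (-1) * x' (Z m w)).
  by apply/funext => w; rewrite /V dualB dualZ dualB; ring.
have HD (x' : topdual E) : H (fun w => 1 * x' (Z n w) + (-1) * x' (Z m w)).
  by apply: gauss_space_comb; exact: gauss_space_regr.
have HV (x' : topdual E) : H (fun w => x' (V w)).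
  by rewrite VE; apply: gauss_space_comb; [exact: gauss_space_X|exact: HD].
split.
  by apply: pettis => // x'; exact: (gauss_space_gauss (HV x')).1.
have varE (x' : topdual E) :
    variance_of P (fun w => x' (V w)) = variance_of P (fun w => x' (X0 w)).
  rewrite (gauss_space_var (HV x')) (gauss_space_var (gauss_space_X x')).
  rewrite -[LHS]/(ip (fun w => x' (V w)) (fun w => x' (V w))).
  rewrite -[RHS]/(ip (fun w => x' (X0 w)) (fun w => x' (X0 w))) VE.
  have x2 := gauss_space_L2 (gauss_space_X x').
  have zn2 := gauss_space_L2 (gauss_space_regr n x').
  have zm2 := gauss_space_L2 (gauss_space_regr m x').
  have d2 := gauss_space_L2 (HD x').
  have v2 : L2 P (fun w => 1 * x' (X0 w) + -2 * (1 * x' (Z n w) + -1 * x' (Z m w))).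
    by apply: L2D; exact: L2Z.
  have dE : (fun w => x' (Z n w - Z m w)) = (fun w => 1 * x' (Z n w) + -1 * x' (Z m w)).
    by apply/funext => w; rewrite dualB mul1r mulN1r.
  have := regr_increment_sq x' mn; have := regr_orth x' (Phi_dual n x').
  have := regr_orth x' (Phi_dual m x').
  rewrite dE -/(regr m) -/(regr n) => e1 e2 e3.
  by rewrite ip_sq// e3 ip_combr// e1 e2; ring.
pose D : set (E -> R) := [set f | exists x' : topdual E, f = fun x => x' x].
have key S : sigma_of D S -> P (X0 @^-1` S) = P (V @^-1` S).
  move=> sS; have [_ _ ->//] : [/\ measurable (X0 @^-1` S), measurable (V @^-1` S) &
    P (X0 @^-1` S) = P (V @^-1` S)].
  refine (@gaussian_law_unique R _ _ _ _ P P E D X0 V _ _ _ _ _ _ S sS) => {S sS}.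
  - move=> _ _ [x1 ->] [x2 ->]; have [x' xE] := dual_combination x1 x2 1 1.
    by exists x'; apply/funext => x; rewrite xE !mul1r.
  - move=> c _ [x1 ->]; have [x' xE] := dual_combination x1 x1 c 0.
    by exists x'; apply/funext => x; rewrite xE mul0r addr0.
  - by move=> _ [x' ->]; exact: gauss_space_gauss (gauss_space_X x').
  - by move=> _ [x' ->]; exact: gauss_space_gauss (HV x').
  - by move=> _ [x' ->]; rewrite (gauss_space_mean (HV x')) (gauss_space_mean (gauss_space_X x')).
  - by move=> _ [x' ->]; exact/esym/varE.
move=> B bB; apply: key.
apply: (borel_sigma_algebra sepE (f := id) (smallest_sigma_algebra _ _)) bB.
by move=> x' C mC; apply: sub_sigma_algebra; exists (fun x => x' x); [exists x'|exists C; rewrite ?setTI].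
Qed.

Let finite_norming (u : nat -> topdual E) (A : set E) e : 0 < e ->
  (forall y e, 0 < e -> exists k, `|y| - e < u k y) -> finite_set A ->
  exists K, forall c, A c -> exists2 k, (k < K)%N & `|c| - e < u k c.
Proof.
move=> e0 hu /finite_seqP[s ->]; elim: s => [|x s [K hK]]; first by exists 0%N.
have [k hk] := hu x _ e0; exists (maxn k.+1 K) => c /=; rewrite in_cons => /orP[/eqP ->|cs].
  by exists k => //; rewrite leq_max ltnSn.
by have [j jK hj] := hK _ cs; exists j => //; rewrite leq_max jK orbT.
Qed.

(* [Z n - Z m] is half the difference of [X0] and its reflection, which both lie close to a
   finite set: there finitely many functionals control the norm. *)
Lemma regr_cauchy e : 0 < e -> exists n0, forall m n, (n0 <= m)%N -> (m <= n)%N ->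
  Ex P (fun w => `|Z n w - Z m w| ^+ 2) <= e.
Proof.
move=> e0; have [dn dd] := dense_sequence sepE; have [u [u1 u2]] := norming_sequence sepE.
pose rho M x := `|x - nearest dn M x|.
have mrho M : measurable_fun setT (rho M : borelType E -> R) by exact: nearest_dist_measurable.
have rho_le M x : rho M x <= `|x| by exact: nearest_dist.
have rho0 M x : 0 <= rho M x by exact: normr_ge0.
(* The budget: [4] times the sum of [e / 12] for [dl ^ 2], [e / 12] for the functionals and twice
   [e / 24] for the distances to the finite set. *)
have [M hM] : exists M, Ex P (fun w => rho M (X0 w) ^+ 2) < e / 24.
  have [_ c] : L1 P (fun=> 0) /\ Ex P (fun w => rho M (X0 w) ^+ 2) @[M --> \oo] --> Ex P (fun=> 0).
    apply: (@Ex_dct _ _ _ P _ _ (fun w => `|X0 w| ^+ 2)); last exact: X2.2.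
    - by move=> M; apply: measurable_funX; exact: (measurableT_comp (mrho M) bX).
    - move=> w; have -> : (0 : R) = 0 ^+ 2 by rewrite expr0n.
      apply: (@continuous_cvg _ _ _ _ _ _ (fun x : R => x ^+ 2)); first exact: exprn_continuous.
      exact: cvg_nearest.
    - by move=> M w; rewrite ger0_norm ?sqr_ge0// lerXn2r ?nnegrE.
  rewrite Ex_cst in c; have /cvgr0Pnorm_lt/(_ (e / 24)) := c; rewrite divr_gt0//.
  move=> /(_ isT)[N _ /(_ _ (leqnn N))/= h]; exists N.
  by rewrite (le_lt_trans (ler_norm _)).
pose dl := Num.min 1 (e / 12).
have dl0 : 0 < dl by rewrite lt_min ltr01 divr_gt0.
have dl2 : dl ^+ 2 <= e / 12.
  have h1 : dl <= 1 by rewrite /dl ge_min lexx.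
  have h2 : dl <= e / 12 by rewrite /dl ge_min lexx orbT.
  by apply: le_trans h2; rewrite expr2 ler_piMr// ltW.
(* Half-differences of nearest points: a finite set, independent of [m] and [n], near which
   [Z n - Z m] lies. *)
pose A := [set 2^-1 *: (p.1 - p.2) | p in range (nearest dn M) `*` range (nearest dn M)].
have fA : finite_set A.
  by apply: finite_image; apply: finite_setX; exact: nearest_finite.
have [K hK] := finite_norming dl0 u2 fA.
(* The induction runs over the number of functionals while the [K] of the bound stays fixed; [K.+1]
   keeps the denominator positive when [K] is [0]. *)
have [n0 hn0] : exists n0, forall k m n, (k < K)%N -> (n0 <= m)%N -> (m <= n)%N ->
    Ex P (fun w => u k (Z n w - Z m w) ^+ 2) <= e / (12 * K.+1%:R).
  have eK : 0 < e / (12 * K.+1%:R) by rewrite divr_gt0// mulr_gt0.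
  elim: {1}K => [|k [n1 h1]]; first by exists 0%N.
  have [n2 h2] := regr_cauchy_dual (u k) eK.
  exists (maxn n1 n2) => j m n; rewrite ltnS leq_eqVlt geq_max => /predU1P[->|jk] /andP[? ?] mn.
    by apply/ltW; exact: h2.
  exact: h1.
exists n0 => m n n0m mn; have [bV lawV] := regr_reflection mn.
pose V w := X0 w - 2 *: (Z n w - Z m w).
have mu k : L2 P (fun w => u k (Z n w - Z m w)).
  have := L2D (gauss_space_L2 (gauss_space_regr n (u k)))
     (L2N (gauss_space_L2 (gauss_space_regr m (u k)))).
  by congr L2; apply/funext => w; rewrite dualB.
have point w : `|Z n w - Z m w| ^+ 2 <= 4 * (dl ^+ 2 + (\sum_(k < K) u k (Z n w - Z m w) ^+ 2
    + (rho M (X0 w) ^+ 2 + rho M (V w) ^+ 2))).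
  set D := Z n w - Z m w; pose c := nearest dn M (X0 w); pose c' := nearest dn M (V w).
  have Ac : A (2^-1 *: (c - c')).
    by exists (c, c').
  have [k kK hk] := hK _ Ac.
  have DE : D = 2^-1 *: (c - c') + 2^-1 *: ((X0 w - c) - (V w - c')).
    rewrite -scalerDr -split_difference /V -/D subKr.
    by rewrite scalerA mulVf ?scale1r// pnatr_eq0.
  have nhalf : `|2^-1 *: ((X0 w - c) - (V w - c'))| <= 2^-1 * (rho M (X0 w) + rho M (V w)).
    by rewrite normrZ ger0_norm ?invr_ge0// ler_wpM2l ?invr_ge0// ler_normB.
  have h1 : `|D| <= `|2^-1 *: (c - c')| + 2^-1 * (rho M (X0 w) + rho M (V w)).
    by rewrite DE (le_trans (ler_normD _ _))// lerD2l.
  have h2 : u k (2^-1 *: (c - c')) <= `|u k D| + 2^-1 * (rho M (X0 w) + rho M (V w)).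
    have -> : 2^-1 *: (c - c') = D - 2^-1 *: ((X0 w - c) - (V w - c')).
      by rewrite {1}DE addrK.
    rewrite dualB (le_trans (ler_norm _))// (le_trans (ler_normB _ _))// lerD2l.
    by rewrite (le_trans (u1 _ _)).
  have h3 : u k D ^+ 2 <= \sum_(k < K) u k D ^+ 2.
    by rewrite (bigD1 (Ordinal kK))//= lerDl sumr_ge0// => i _; exact: sqr_ge0.
  have h4 : `|D| <= dl + `|u k D| + rho M (X0 w) + rho M (V w) by lra.
  apply: (@le_trans _ _ (4 * (dl ^+ 2 + (u k D ^+ 2 + (rho M (X0 w) ^+ 2 + rho M (V w) ^+ 2))))).
    rewrite -(real_normK (num_real (u k D))); by apply: sq_sum4 => //; exact: ltW.
  by rewrite ler_wpM2l// lerD2l lerD2r.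
have mV : measurable_fun setT (fun w => rho M (V w)) by exact: (measurableT_comp (mrho M) bV).
have mX : measurable_fun setT (fun w => rho M (X0 w)) by exact: (measurableT_comp (mrho M) bX).
(* Equality of laws makes the reflected variable as close to the finite set as [X0], uniformly in
   [m] and [n]. *)
have lawr B : measurable B -> P ((fun w => rho M (V w)) @^-1` B) = P ((fun w => rho M (X0 w)) @^-1` B).
  move=> mB; apply/esym/(lawV (rho M @^-1` B)).
  by have := mrho M measurableT B mB; rewrite setTI.
have LX : L1 P (fun w => rho M (X0 w) ^+ 2).
  apply: (L1_le _ _ X2.2); first exact: measurable_funX.
  by move=> w; rewrite ger0_norm ?sqr_ge0// lerXn2r ?nnegrE.
have msq : measurable_fun setT (fun x : R => x ^+ 2) by exact: exprn_measurable.
have LV : L1 P (fun w => rho M (V w) ^+ 2).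
  exact: (L1_same_law mV mX lawr msq LX).
have EV : Ex P (fun w => rho M (V w) ^+ 2) = Ex P (fun w => rho M (X0 w) ^+ 2).
  exact: (Ex_same_law mV mX lawr msq).
have Ls : L1 P (fun w => \sum_(k < K) u k (Z n w - Z m w) ^+ 2).
  by apply: L1_sum => k _; exact: (mu k).2.
have Lc := L1_cst P (dl ^+ 2).
have Lall := L1Z 4 (L1D Lc (L1D Ls (L1D LX LV))).
apply: (@le_trans _ _ _ _ _ (Ex_le _ Lall point)).
  apply: (L1_le _ _ Lall); last by move=> w; rewrite ger0_norm ?sqr_ge0.
  by apply: measurable_funX; apply: borel_fun_norm; apply: borel_funB => //; exact: borel_regr.
rewrite (ExZ 4 (L1D Lc (L1D Ls (L1D LX LV)))) (ExD Lc (L1D Ls (L1D LX LV))).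
rewrite (ExD Ls (L1D LX LV)) (ExD LX LV) Ex_cst EV Ex_sum; last by move=> k _; exact: (mu k).2.
have : \sum_(k < K) Ex P (fun w => u k (Z n w - Z m w) ^+ 2) <= e / 12.
  apply: (@le_trans _ _ (\sum_(k < K) e / (12 * K.+1%:R))).
    by apply: ler_sum => k _; apply: hn0.
  have K1 : (0 : R) < K.+1%:R by rewrite ltr0n.
  rewrite sumr_const card_ord -[leLHS]mulr_natr.
  have -> : e / (12 * K.+1%:R) * K%:R = e / 12 * (K%:R / K.+1%:R) by field; rewrite gt_eqF.
  by rewrite ler_piMr ?divr_ge0 ?ltW// ltr_pdivrMr// mul1r ltr_nat.
lra.
Qed.

(** * Levy's maximal inequality and almost sure convergence *)

Section maximal_inequality.
Variables (m : nat) (t : R).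
Hypothesis t0 : 0 < t.
Let W (w : T) (j : nat) : E := Z (m + j) w - Z m w.

Let borel_W j : borel_fun (fun w => W w j).
Proof. by apply: borel_funB => //; exact: borel_regr. Qed.

Let G := ((nat -> E) * E)%type.
Let comb (l : seq (nat * topdual E)) (x' : topdual E) (g : G) : R :=
  \sum_(q <- l) q.2 (g.1 q.1) + x' g.2.
Let D : set (G -> R) := [set f | exists l x', f = comb l x'].
(** The path stopped at time [n], with a signed later increment. Stopping by [minn] keeps [nat] as
    index set while only the past up to [n] enters. *)
Let U (c : R) n N (w : T) : G := (fun j => W w (minn j n), c *: (Z (m + N) w - Z (m + n) w)).

Let D_comb a b f g : D f -> D g -> D (fun x => a * f x + b * g x).
Proof.
move=> [l [x1 ->]] [k [x2 ->]].
have ex c (x' : topdual E) : exists y' : topdual E, forall x, y' x = c * x' x.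
  by have [y' yE] := dual_combination x' x' c 0; exists y' => x; rewrite yE mul0r addr0.
pose sc c (x' : topdual E) := projT1 (cid (ex c x')).
have scE c x' x : sc c x' x = c * x' x by rewrite /sc; case: cid.
have [x' xE] := dual_combination x1 x2 a b.
exists ([seq (q.1, sc a q.2) | q <- l] ++ [seq (q.1, sc b q.2) | q <- k]), x'.
apply/funext => g'; rewrite /comb big_cat !big_map/= xE !mulrDr !mulr_sumr addrACA.
by congr (_ + _ + _); apply: eq_bigr => q _; rewrite scE.
Qed.

(** A combination of the stopped path is observed at stage [m + n], hence orthogonal to the later
    increment. *)
Let comb_U n l : exists2 h, Lf (m + n) h &
  forall w, \sum_(q <- l) (q : nat * topdual E).2 (W w (minn q.1 n)) = h (Y0 w).
Proof.
have inc (x' : topdual E) j : (j <= n)%N ->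
    Lf (m + n) (fun y => 1 * x' (Phi (m + j) y) + (-1) * x' (Phi m y)).
  move=> jn; apply: Lf_comb.
    by apply: (@Lf_le (m + j)); [rewrite leq_add2l|exact: Phi_dual].
  by apply: (@Lf_le m); [exact: leq_addr|exact: Phi_dual].
have ex0 : exists x' : topdual E, True.
  by have [x' _] := norming_functional (0 : E); exists x'.
elim: l => [|[j x'] l [h hL hE]].
  have [x' _] := ex0; exists (fun y => 0 * x' (Phi (m + n) y) + 0 * x' (Phi (m + n) y)).
    by apply: Lf_comb; exact: Phi_dual.
  by move=> w; rewrite big_nil !mul0r addr0.
exists (fun y => 1 * (1 * x' (Phi (m + minn j n) y) + (-1) * x' (Phi m y)) + 1 * h y).
  by apply: Lf_comb => //; apply: inc; exact: geq_minr.
by move=> w; rewrite big_cons hE /= /W dualB !mul1r mulN1r.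
Qed.

(** Past and increment are uncorrelated, so reversing the increment changes no variance. This
    symmetry is the form of independence that Levy's argument uses. *)
Lemma increment_law n N S : (n <= N)%N -> sigma_of D S ->
  [/\ measurable (U 1 n N @^-1` S), measurable (U (-1) n N @^-1` S) &
      P (U 1 n N @^-1` S) = P (U (-1) n N @^-1` S)].
Proof.
move=> nN sS.
have UE l (x' : topdual E) : exists2 h, Lf (m + n) h & forall c,
    (fun w => comb l x' (U c n N w)) =
    (fun w => 1 * h (Y0 w) + c * x' (Z (m + N) w - Z (m + n) w)).
  have [h hL hE] := comb_U n l; exists h => // c; apply/funext => w.
  by rewrite /comb/= hE dualZ mul1r.
have HD (x' : topdual E) : H (fun w => x' (Z (m + N) w - Z (m + n) w)).
  have := gauss_space_comb 1 (-1) (gauss_space_regr (m + N) x') (gauss_space_regr (m + n) x').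
  by congr H; apply/funext => w; rewrite dualB mul1r mulN1r.
have HU c l x' : H (fun w => comb l x' (U c n N w)).
  have [h hL ->] := UE l x'; apply: gauss_space_comb => //; exact: gauss_space_Lf hL.
have varE l x' : variance_of P (fun w => comb l x' (U 1 n N w)) =
    variance_of P (fun w => comb l x' (U (-1) n N w)).
  rewrite !gauss_space_var//; have [h hL e] := UE l x'.
  rewrite -[LHS]/(ip (fun w => comb l x' (U 1 n N w)) (fun w => comb l x' (U 1 n N w))).
  rewrite -[RHS]/(ip (fun w => comb l x' (U (-1) n N w)) (fun w => comb l x' (U (-1) n N w))).
  have h2 := gauss_space_L2 (gauss_space_Lf hL); have d2 := gauss_space_L2 (HD x').
  have := @regr_increment_orth x' (m + n) (m + N) h; rewrite leq_add2l => /(_ nN hL) o.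
  by rewrite !e !ip_sq// ipC o; ring.
apply: (@gaussian_law_unique R _ _ _ _ P P G D (U 1 n N) (U (-1) n N)) sS.
- by move=> f g Df Dg; have := D_comb 1 1 Df Dg; congr D; apply/funext => w; rewrite !mul1r.
- by move=> c f Df; have := D_comb c 0 Df Df; congr D; apply/funext => w; rewrite mul0r addr0.
- by move=> _ [l [x' ->]]; exact/gauss_space_gauss/HU.
- by move=> _ [l [x' ->]]; exact/gauss_space_gauss/HU.
- by move=> _ [l [x' ->]]; rewrite !gauss_space_mean.
- by move=> _ [l [x' ->]]; exact: varE.
Qed.

Let GT := g_sigma_algebraType (\bigcup_(f in D) preimage_set_system setT f (@measurable _ R)).

Let D_meas (f : G -> R) : D f -> measurable_fun setT (f : GT -> R).
Proof. by move=> Df _ B mB; apply: sub_sigma_algebra; exists f => //; exists B. Qed.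

Let borel1 j : borel_fun ((fun g => g.1 j) : GT -> E).
Proof.
apply: pettis => // x'; have := D_comb 1 (-1) (f := comb [:: (j, x')] x') (g := comb [::] x').
move=> /(_ _ _)/D_meas h.
have -> : (fun g : GT => x' (g.1 j)) =
    (fun g => 1 * comb [:: (j, x')] x' g + (-1) * comb [::] x' g).
  by apply/funext => g; rewrite /comb big_seq1 big_nil /=; ring.
by apply: h; [exists [:: (j, x')], x'|exists [::], x'].
Qed.

Let borel2 : borel_fun ((fun g => g.2) : GT -> E).
Proof.
apply: pettis => // x'; have -> : (fun g : GT => x' g.2) = comb [::] x'.
  by apply/funext => g; rewrite /comb big_nil add0r.
by apply: D_meas; exists [::], x'.
Qed.

Let fe n w := first_exceedance t n (W w).

Let fe_L1 n : L1 P (fe n).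
Proof.
apply: (@L1_bounded _ _ _ _ _ 1); first exact: measurable_first_exceedance.
by move=> w; have /andP[h1 h2] := first_exceedance_01 t n (W w); rewrite ger0_norm.
Qed.

Let mul_ind_L1 (f : T -> R) (h : T -> E) : measurable_fun setT f -> (forall w, 0 <= f w <= 1) ->
  borel_fun h -> L1 P (fun w => f w * (t < `|h w|)%R%:R).
Proof.
move=> mf f01 bh; apply: (@L1_bounded _ _ _ _ _ 1).
  by apply: measurable_funM => //; exact/measurable_indic_gt/borel_fun_norm.
move=> w; have /andP[f0 f1] := f01 w.
by case: (t < _); rewrite ?mulr1 ?mulr0 ?normr0// ger0_norm.
Qed.

(* Levy's reflection: the increment after the first passage time is symmetric. *)
Lemma first_exceedance_le n N : (n <= N)%N ->
  Ex P (fe n) <= 2 * Ex P (fun w => fe n w * (t < `|W w N|)%R%:R).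
Proof.
move=> nN; pose psi (g : G) := first_exceedance t n g.1 * (t < `|g.1 n + g.2|)%R%:R.
have mpsi : measurable_fun setT (psi : GT -> R).
  apply: measurable_funM; first exact: (measurable_first_exceedance t n borel1).
  apply: measurable_indic_gt; apply: borel_fun_norm.
  exact: (borel_funD sepE (borel1 n) borel2).
have psiS B : measurable B -> sigma_of D (psi @^-1` B).
  by move=> mB; have := mpsi measurableT B mB; rewrite setTI.
have m1 : measurable_fun setT (psi \o U 1 n N).
  by move=> _ B mB; rewrite setTI; have [] := increment_law nN (psiS B mB).
have m2 : measurable_fun setT (psi \o U (-1) n N).
  by move=> _ B mB; rewrite setTI; have [] := increment_law nN (psiS B mB).
have law B : measurable B -> P ((psi \o U 1 n N) @^-1` B) = P ((psi \o U (-1) n N) @^-1` B).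
  by move=> mB; have [] := increment_law nN (psiS B mB).
have mi : measurable_fun setT (fun x : R => x) by exact: measurable_id.
have EE : Ex P (psi \o U 1 n N) = Ex P (psi \o U (-1) n N).
  exact: (@Ex_same_law _ _ _ _ _ _ R P P _ _ m1 m2 law _ mi).
have psiE c w : psi (U c n N w) = fe n w * (t < `|W w n + c *: (Z (m + N) w - Z (m + n) w)|)%R%:R.
  rewrite /psi /= minnn; congr (_ * _).
  by apply: first_exceedance_eq => j jn; rewrite (minn_idPl jn).
have WN w : W w n + 1 *: (Z (m + N) w - Z (m + n) w) = W w N.
  by rewrite scale1r /W [LHS]addrC addrA subrK.
have L c : L1 P (psi \o U c n N).
  rewrite /comp; under eq_fun do rewrite psiE; apply: mul_ind_L1.
  - exact: measurable_first_exceedance.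
  - by move=> w; exact: first_exceedance_01.
  - apply: borel_funD => //; apply: borel_funZ => //.
    by apply: borel_funB => //; exact: borel_regr.
have -> : Ex P (fun w => fe n w * (t < `|W w N|)%R%:R) = Ex P (psi \o U 1 n N).
  by congr (Ex P); apply/funext => w; rewrite /comp psiE WN.
rewrite mulr_natl mulr2n {2}EE -ExD//; apply: Ex_le => //; first exact: L1D.
move=> w; rewrite /comp !psiE scale1r scaleN1r; exact: first_exceedance_split.
Qed.

(** Summing [first_exceedance_le] over the passage times bounds the probability of an excess before
    [N] by twice that of [t < |W w N|] joined to it; Chebyshev's inequality does the rest. *)
Lemma maximal_inequality N :
  Ex P (fun w => exceedance t N (W w)) <= 2 / t ^+ 2 * Ex P (fun w => `|W w N| ^+ 2).
Proof.
have Le n : L1 P (fun w => exceedance t n (W w)).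
  apply: (@L1_bounded _ _ _ _ _ 1); first exact: measurable_exceedance.
  by move=> w; have /andP[h1 h2] := exceedance_01 t n (W w); rewrite ger0_norm.
have Lei n : L1 P (fun w => exceedance t n (W w) * (t < `|W w N|)%R%:R).
  apply: mul_ind_L1 => //; first exact: measurable_exceedance.
  by move=> w; exact: exceedance_01.
have Lfi n : L1 P (fun w => fe n w * (t < `|W w N|)%R%:R).
  apply: mul_ind_L1 => //; first exact: measurable_first_exceedance.
  by move=> w; exact: first_exceedance_01.
have step n : (n <= N)%N -> Ex P (fun w => exceedance t n (W w)) <=
    2 * Ex P (fun w => exceedance t n (W w) * (t < `|W w N|)%R%:R).
  elim: n => [_|n IH nN].
    rewrite /= Ex_cst; apply: mulr_ge0 => //.
    by apply: Ex_ge0 => w; rewrite mul0r.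
  have -> : Ex P (fun w => exceedance t n.+1 (W w)) =
      Ex P (fun w => exceedance t n (W w)) + Ex P (fe n) by rewrite -ExD.
  have -> : Ex P (fun w => exceedance t n.+1 (W w) * (t < `|W w N|)%R%:R) =
      Ex P (fun w => exceedance t n (W w) * (t < `|W w N|)%R%:R) +
      Ex P (fun w => fe n w * (t < `|W w N|)%R%:R).
    by rewrite -ExD//; congr (Ex P); apply/funext => w; rewrite /= mulrDl.
  by rewrite mulrDr; apply: lerD; [apply: IH; exact: ltnW|apply: first_exceedance_le; exact: ltnW].
have LW : L1 P (fun w => `|W w N| ^+ 2).
  have := L2D (regr_L2 (m + N)) (regr_L2 m); move=> h.
  apply: (L2_le _ _ h).2; first exact: borel_fun_norm.
  by move=> w; rewrite normr_id; exact: ler_normB.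
apply: (le_trans (step N (leqnn N))); rewrite -mulrA ler_wpM2l// -ExZ//.
apply: Ex_le => //; first exact: L1Z.
move=> w; have /andP[h1 h2] := exceedance_01 t N (W w).
have [h|h] := ltP t `|W w N|; last by rewrite mulr0 mulr_ge0 ?invr_ge0 ?sqr_ge0.
rewrite mulr1 (le_trans h2)// mulrC ler_pdivlMr ?exprn_gt0// mul1r.
by rewrite lerXn2r ?nnegrE// ltW.
Qed.

(** The indicators of an excess before [N] tend to the indicator of the complement as [N] grows, so
    the maximal inequality survives the limit. *)
Lemma regr_close_probability e :
  (forall N, Ex P (fun w => `|W w N| ^+ 2) <= e) ->
  ((1 - 2 / t ^+ 2 * e)%:E <= P [set w | forall n, `|W w n| <= t]%R)%E.
Proof.
move=> he; set A := [set w | _].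
have AE : A = \bigcap_n [set w | `|W w n| <= t].
  by apply/seteqP; split => w h n; [move=> _; exact: h|exact: (h n I)].
have mA : measurable A.
  rewrite AE; apply: bigcapT_measurable => n.
  rewrite (_ : [set w | _] = (fun w => `|W w n|) @^-1` `]-oo, t]%classic).
    by rewrite -[_ @^-1` _]setTI; apply: borel_fun_norm.
  by apply/seteqP; split => x; rewrite /= in_itv.
have [_ c] : L1 P (fun w => 1 - \1_A w) /\
    Ex P (fun w => exceedance t N (W w)) @[N --> \oo] --> Ex P (fun w => 1 - \1_A w).
  apply: (@Ex_dct _ _ _ P _ _ (fun=> 1)); last exact: L1_cst.
  - by move=> n; exact: measurable_exceedance.
  - move=> w; rewrite indicE; case: (boolP (w \in A)) => [/set_mem Aw|/negP wA].
      rewrite subrr; apply: cvg_near_cst; apply: nearW => n.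
      by have [[_ [j _]]|[]//] := exceedanceP t n (W w); rewrite ltNge Aw.
    have [j hj] : exists j, t < `|W w j|.
      apply: contrapT => h; apply: wA; apply/mem_set => n; rewrite leNgt.
      by apply/negP => ?; apply: h; exists n.
    rewrite subr0; apply: cvg_near_cst; exists j.+1 => // n /= jn.
    have [[-> //]|[_ h]] := exceedanceP t n (W w).
    by move: hj; rewrite ltNge h.
  - by move=> n w; have /andP[h1 h2] := exceedance_01 t n (W w); rewrite ger0_norm.
have : Ex P (fun w => 1 - \1_A w) <= 2 / t ^+ 2 * e.
  rewrite -(cvg_lim _ c)//; apply: limr_le; first exact: cvgP c.
  apply: nearW => N; rewrite (le_trans (maximal_inequality N))// ler_wpM2l//.
  by rewrite divr_ge0 ?sqr_ge0.
rewrite ExB ?Ex_cst ?Ex_indic//; [|exact: L1_cst|exact: L1_indic].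
by move=> hle; rewrite -(fineK (fin_num_measure P _ mA)) lee_fin; lra.
Qed.

End maximal_inequality.

Lemma regr_cvg_probability : P [set w | cvgn (fun n => Z n w)] = 1%E.
Proof.
apply: (cvg_set_probability sepE borel_regr) => k e e0.
have t0 : 0 < k.+1%:R^-1 :> R by rewrite invr_gt0.
(* Chosen so that the factor [2 / t ^ 2] of the maximal inequality returns exactly [e]. *)
have e'0 : 0 < e * (k.+1%:R^-1) ^+ 2 / 2 by rewrite divr_gt0// mulr_gt0// exprn_gt0.
have [n0 h] := regr_cauchy e'0; exists n0.
have := regr_close_probability t0 (fun N => h n0 (n0 + N)%N (leqnn n0) (leq_addr N n0)).
suff -> : 2 / k.+1%:R^-1 ^+ 2 * (e * (k.+1%:R^-1) ^+ 2 / 2) = e by [].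
by move: t0; move: (k.+1%:R^-1) => s s0; field; rewrite gt_eqF.
Qed.

(** * The limit of the regressions and the residual *)

Definition cvg_event : set T := [set w | cvgn (fun n => Z n w)].
(** The indicator sets the sequence to [0] off the event, so it converges at every point and its
    limit is Borel; the conditional mean has the same shape. *)
Definition regr_lim (w : T) : E := limn (fun n => \1_cvg_event w *: Z n w).
Definition residual (w : T) : E := X0 w - regr_lim w.

Let Z' n w := \1_cvg_event w *: Z n w.

Let m_cvg : measurable cvg_event.
Proof. exact: measurable_cvg_set sepE borel_regr. Qed.

Let Z'E n w : cvg_event w -> Z' n w = Z n w.
Proof. by move=> h; rewrite /Z' indicE mem_set// scale1r. Qed.

Let Z'_cvg w : Z' n w @[n --> \oo] --> regr_lim w.
Proof.
rewrite /regr_lim /Z' indicE; case: (boolP (w \in cvg_event)) => [/set_mem|_].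
  by under eq_fun do rewrite scale1r.
by under eq_fun do rewrite scale0r; apply: is_cvg_cst.
Qed.

Let borel_Z' n : borel_fun (Z' n).
Proof. by apply: borel_funZ => //; exact: borel_regr. Qed.

Let dual_Z'_cvg (x' : topdual E) w : x' (Z' n w) @[n --> \oo] --> x' (regr_lim w).
Proof.
apply: (@continuous_cvg _ _ _ _ _ _ (x' : E -> R)); first exact: topdual_continuous.
exact: Z'_cvg.
Qed.

Lemma borel_regr_lim : borel_fun regr_lim.
Proof.
apply: pettis => // x'.
by apply: (measurable_fun_cvg (fun n => borel_fun_dual x' (borel_Z' n))) => w _; exact: dual_Z'_cvg.
Qed.

Let Z'_L2 n : L2 P (fun w => `|Z' n w|).
Proof.
apply: (L2_le _ _ (regr_L2 n)); first exact: borel_fun_norm.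
move=> w; rewrite normr_id normrZ indicE.
by case: (w \in _); rewrite ?normr1 ?mul1r ?normr0 ?mul0r.
Qed.

(** Fatou's lemma, applied to [Z' (n + k) - Z' n] as [k] grows, transfers the Cauchy estimate to the
    limit. *)
Let lim_dist e : 0 < e -> exists n0, forall n, (n0 <= n)%N ->
  L2 P (fun w => `|regr_lim w - Z' n w|) /\ Ex P (fun w => `|regr_lim w - Z' n w| ^+ 2) <= e.
Proof.
move=> e0; have [n0 h] := regr_cauchy e0; exists n0 => n n0n.
have bd k : borel_fun (fun w => Z' k w - Z' n w) by exact: borel_funB.
have LZ k : L2 P (fun w => `|Z' k w - Z' n w|).
  apply: (L2_le _ _ (L2D (Z'_L2 k) (Z'_L2 n))); first exact: borel_fun_norm.
  by move=> w; rewrite normr_id; exact: ler_normB.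
have LZ0 k : L1 P (fun w => `|Z k w - Z n w| ^+ 2).
  apply: (L2_le _ _ (L2D (regr_L2 k) (regr_L2 n))).2.
    by apply/borel_fun_norm/borel_funB => //; exact: borel_regr.
  by move=> w; rewrite normr_id; exact: ler_normB.
have le k w : `|Z' (n + k) w - Z' n w| ^+ 2 <= `|Z (n + k) w - Z n w| ^+ 2.
  rewrite /Z' -scalerBr normrZ indicE.
  by case: (w \in _); rewrite ?normr1 ?mul1r// normr0 mul0r expr0n sqr_ge0.
have [] // := @Ex_fatou _ _ _ P (fun k w => `|Z' (n + k) w - Z' n w| ^+ 2)
   (fun w => `|regr_lim w - Z' n w| ^+ 2) e.
- by move=> k; exact: (LZ (n + k)%N).2.
- move=> k; apply: (le_trans (Ex_le (LZ (n + k)%N).2 (LZ0 (n + k)%N) (le k))).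
  by apply: h => //; exact: leq_addr.
- move=> w; apply: (@continuous_cvg _ _ _ _ _ _ (fun x : R => x ^+ 2)).
    exact: exprn_continuous.
  apply: cvg_norm; apply: cvgB; last exact: cvg_cst.
  have c : [sequence Z' (k + n)%N w]_k @ \oo --> regr_lim w.
    by rewrite (cvg_shiftn n (fun k => Z' k w)); exact: Z'_cvg.
  have -> : (fun k => Z' (n + k)%N w) = (fun k => Z' (k + n)%N w).
    by apply/funext => k; rewrite addnC.
  exact: c.
by move=> L1l le1; split => //; split => //; apply/borel_fun_norm/borel_funB => //; exact: borel_regr_lim.
Qed.

Lemma regr_lim_L2 : L2 P (fun w => `|regr_lim w|).
Proof.
have [n0 /(_ _ (leqnn n0))[h _]] := lim_dist ltr01.
apply: (L2_le _ _ (L2D h (Z'_L2 n0))); first exact/borel_fun_norm/borel_regr_lim.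
by move=> w; rewrite normr_id -{1}(subrK (Z' n0 w) (regr_lim w)) ler_normD.
Qed.

Lemma borel_residual : borel_fun residual.
Proof. by apply: borel_funB => //; exact: borel_regr_lim. Qed.

Let dist_L2 n : L2 P (fun w => `|regr_lim w - Z' n w|).
Proof.
apply: (L2_le _ _ (L2D regr_lim_L2 (Z'_L2 n))).
  by apply/borel_fun_norm/borel_funB => //; exact: borel_regr_lim.
by move=> w; rewrite normr_id ler_normB.
Qed.

Let dist_cvg : Ex P (fun w => `|regr_lim w - Z' n w| ^+ 2) @[n --> \oo] --> 0.
Proof.
apply/cvgr0Pnorm_lt => e e0; have [|n0 h] := lim_dist (e := e / 2); first by rewrite divr_gt0.
exists n0 => // n /= /h[_ hn]; rewrite ger0_norm; last by apply: Ex_ge0 => w; exact: sqr_ge0.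
by rewrite (le_lt_trans hn)// ltr_pdivrMr// ltr_pMr// ltr1n.
Qed.

Let dual_dist_L2 (x' : topdual E) n : L2 P (fun w => x' (regr_lim w - Z' n w)).
Proof.
have [C C0 hC] := dual_bounded x'; apply: (L2_le _ _ (L2Z C (dist_L2 n))) => //.
by apply: borel_fun_dual; apply: borel_funB => //; exact: borel_regr_lim.
Qed.

Let dual_dist_cvg (x' : topdual E) :
  Ex P (fun w => x' (regr_lim w - Z' n w) ^+ 2) @[n --> \oo] --> 0.
Proof.
have [C C0 hC] := dual_bounded x'.
apply: (@squeeze_cvgr _ _ _ _ (fun=> 0) (fun n => C ^+ 2 * Ex P (fun w => `|regr_lim w - Z' n w| ^+ 2))).
- apply: nearW => n; rewrite Ex_ge0/=; last by move=> w; exact: sqr_ge0.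
  rewrite -(ExZ (C ^+ 2) (dist_L2 n).2).
  apply: Ex_le; [exact: (dual_dist_L2 x' n).2|exact: L1Z (dist_L2 n).2|move=> w].
  by rewrite -exprMn -(real_normK (num_real (x' _))) lerXn2r ?nnegrE// mulr_ge0.
- exact: cvg_cst.
- by rewrite -(mulr0 (C ^+ 2)); apply: cvgM => //; exact: cvg_cst.
Qed.

Lemma residual_L2 : L2 P (fun w => `|residual w|).
Proof.
apply: (L2_le _ _ (L2D X2 regr_lim_L2)); first exact/borel_fun_norm/borel_residual.
by move=> w; rewrite normr_id ler_normB.
Qed.

(** With [Z' n] in place of the limit, the variable agrees almost surely with a member of
    [gauss_space]. Means and second moments converge, so the limit is Gaussian. *)
Lemma residual_gauss (x' : topdual E) (y' : topdual F) :
  gauss_law P (fun w => x' (residual w) + y' (Y0 w)) 0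
    (Num.sqrt (Ex P (fun w => (x' (residual w) + y' (Y0 w)) ^+ 2) / std_var)).
Proof.
pose f_ n w := x' (X0 w - Z' n w) + y' (Y0 w).
have mf n : measurable_fun setT (f_ n).
  by apply: measurable_funD; apply: borel_fun_dual => //; exact: borel_funB.
have HZ n : H (fun w => x' (X0 w - Z n w) + y' (Y0 w)).
  have := gauss_space_comb 1 1 (gauss_space_comb 1 (-1) (gauss_space_X x') (gauss_space_regr n x'))
    (gauss_space_Y y').
  by congr H; apply/funext => w; rewrite dualB; ring.
have fE n w : cvg_event w -> x' (X0 w - Z n w) + y' (Y0 w) = f_ n w.
  by move=> Aw; rewrite /f_ Z'E.
have PC := regr_cvg_probability; have mC := m_cvg.
have mHZ n : measurable_fun setT (fun w => x' (X0 w - Z n w) + y' (Y0 w)).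
  exact: (gauss_space_gauss (HZ n)).1.
have fG n : real_gaussian P (f_ n).
  exact: (real_gaussian_ae mC PC (gauss_space_gauss (HZ n)) (mf n) (fE n)).
have fM n : Ex P (f_ n) = 0.
  by rewrite -(gauss_space_mean (HZ n)); apply/esym/(Ex_ae mC PC) => //; exact: fE.
have f2 n : L2 P (f_ n) by exact: real_gaussian_L2.
pose f w := x' (residual w) + y' (Y0 w).
have Lf2 : L2 P f.
  apply: L2D; last exact: gauss_space_L2 (gauss_space_Y y').
  have [C C0 hC] := dual_bounded x'; apply: (L2_le _ _ (L2Z C residual_L2)) => //.
  exact/borel_fun_dual/borel_residual.
have cf w : f_ n w @[n --> \oo] --> f w.
  rewrite /f_ /f /residual; apply: cvgD; last exact: cvg_cst.
  rewrite dualB; under eq_fun do rewrite dualB.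
  by apply: cvgB; [exact: cvg_cst|exact: dual_Z'_cvg].
apply: (real_gaussian_limit fG cf).
  by under eq_fun do rewrite fM; exact: cvg_cst.
have -> : (fun n => variance_of P (f_ n)) = (fun n => Ex P (fun w => f_ n w ^+ 2)).
  apply/funext => n; rewrite /variance_of fM.
  by congr (Ex P); apply/funext => w; rewrite subr0.
apply: (Ex_sq_cvg Lf2 f2).
have -> // : (fun n => Ex P (fun w => (f_ n w - f w) ^+ 2)) =
    (fun n => Ex P (fun w => x' (regr_lim w - Z' n w) ^+ 2)).
apply/funext => n; congr (Ex P); apply/funext => w; congr (_ ^+ 2).
by rewrite /f_ /f /residual !dualB; ring.
Qed.

(** For [n >= m] this expectation is minus that of [l (Y0 w)] times [x' (regr_lim w - Z' n w)],
    which tends to [0]; since it does not depend on [n], it vanishes. *)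
Lemma residual_orth m (x' : topdual E) l : Lf m l ->
  Ex P (fun w => x' (residual w) * l (Y0 w)) = 0.
Proof.
move=> hl; have l2 := gauss_space_L2 (gauss_space_Lf hl).
have PC := regr_cvg_probability; have mC := m_cvg.
have r2 : L2 P (fun w => x' (residual w)).
  have [C C0 hC] := dual_bounded x'; apply: (L2_le _ _ (L2Z C residual_L2)) => //.
  exact/borel_fun_dual/borel_residual.
have c := Ex_mul_cvg0 l2 (dual_dist_L2 x') (dual_dist_cvg x').
have resE n : (m <= n)%N -> Ex P (fun w => x' (residual w) * l (Y0 w)) =
    - Ex P (fun w => l (Y0 w) * x' (regr_lim w - Z' n w)).
  move=> mn; have ld := L2_mul l2 (dual_dist_L2 x' n); have rl := L2_mul r2 l2.
  apply/eqP; rewrite -addr_eq0 -ExD//; apply/eqP.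
  rewrite -(Phi_orth x' (Lf_le mn hl)); apply: (Ex_ae mC PC).
  - exact: L1_measurable (L1D rl ld).
  - have g2 := gauss_space_L2 (gauss_space_comb 1 (-1) (gauss_space_X x') (gauss_space_regr n x')).
    have := L1_measurable (L2_mul g2 l2); congr measurable_fun; apply/funext => w.
    by rewrite mul1r mulN1r.
  - by move=> w Aw; rewrite Z'E// /residual !dualB /regr; ring.
pose g n := Ex P (fun w => l (Y0 w) * x' (regr_lim w - Z' n w)).
have c' : [sequence g (k + m)%N]_k @ \oo --> (0 : R) by rewrite (cvg_shiftn m g); exact: c.
have gE : (fun k => g (k + m)%N) = (fun=> - Ex P (fun w => x' (residual w) * l (Y0 w))).
  by apply/funext => k; rewrite (resE (k + m)%N) ?leq_addl// opprK.
move: c'; rewrite gE => c'; apply: oppr_inj; rewrite oppr0 -(cvg_lim _ c')//.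
by apply/esym/cvg_lim => //; exact: cvg_cst.
Qed.

(** The residual is orthogonal to each [z' (Z n)], an observed functional, hence to their
    mean-square limit. *)
Lemma residual_orth_lim (x' z' : topdual E) :
  Ex P (fun w => x' (residual w) * z' (regr_lim w)) = 0.
Proof.
have PC := regr_cvg_probability; have mC := m_cvg.
have r2 : L2 P (fun w => x' (residual w)).
  have [C C0 hC] := dual_bounded x'; apply: (L2_le _ _ (L2Z C residual_L2)) => //.
  exact/borel_fun_dual/borel_residual.
have l2 : L2 P (fun w => z' (regr_lim w)).
  have [C C0 hC] := dual_bounded z'; apply: (L2_le _ _ (L2Z C regr_lim_L2)) => //.
  exact/borel_fun_dual/borel_regr_lim.
have c := Ex_mul_cvg0 r2 (dual_dist_L2 z') (dual_dist_cvg z').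
have resE n : Ex P (fun w => x' (residual w) * z' (regr_lim w - Z' n w)) =
    Ex P (fun w => x' (residual w) * z' (regr_lim w)).
  have zn2 := gauss_space_L2 (gauss_space_regr n z').
  have rz := L2_mul r2 zn2; have rl := L2_mul r2 l2.
  rewrite -[RHS]subr0 -(residual_orth x' (Phi_dual n z')) -ExB//; apply: (Ex_ae mC PC).
  - exact: L1_measurable (L2_mul r2 (dual_dist_L2 z' n)).
  - exact: L1_measurable (L1B rl rz).
  - by move=> w Aw; rewrite Z'E// /residual !dualB /regr; ring.
move: c; under eq_fun do rewrite resE; move=> c.
by rewrite -[RHS](cvg_lim _ c)//; apply/esym/cvg_lim => //; exact: cvg_cst.
Qed.

(** The hypothesis makes [v] the cross covariance of [Y0] and [x' (X0)]. Then [z' (Phi n v)] is the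
    expectation of [x' (X0) z' (Z n)], and Cauchy-Schwarz, used with a norming [z'], turns the
    mean-square Cauchy property of [Z n] into that of [Phi n v]. *)
Lemma Phi_cvg_covariance (x' : topdual E) (v : F) :
  (forall y' : topdual F, y' v = Ex P (fun w => x' (X0 w) * y' (Y0 w))) ->
  cvgn (fun n => Phi n v).
Proof.
move=> hv; apply: cvgn_cauchy => e e0.
pose V := Ex P (fun w => x' (X0 w) ^+ 2); have V0 : 0 <= V by apply: Ex_ge0 => w; exact: sqr_ge0.
have eV : 0 < e ^+ 2 / (V + 1) by rewrite divr_gt0 ?exprn_gt0// ltr_wpDl.
have [|n0 h] := regr_cauchy (e := e ^+ 2 / (V + 1) / 2); first by rewrite divr_gt0.
exists n0 => n n0n; have [z' [z1 zE]] := norming_functional (Phi n v - Phi n0 v).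
have PhiE k : z' (Phi k v) = Ex P (fun w => x' (X0 w) * z' (Z k w)).
  have [y' yE] := Lf_dual (Phi_dual k z').
  transitivity (y' v); first by rewrite -yE.
  by rewrite hv -yE.
have x2 := gauss_space_L2 (gauss_space_X x').
have zk2 k := gauss_space_L2 (gauss_space_regr k z').
have LZ : L2 P (fun w => `|Z n w - Z n0 w|).
  apply: (L2_le _ _ (L2D (regr_L2 n) (regr_L2 n0))).
    by apply/borel_fun_norm/borel_funB => //; exact: borel_regr.
  by move=> w; rewrite normr_id ler_normB.
rewrite distrC -zE dualB !PhiE -(ExB (L2_mul x2 (zk2 n)) (L2_mul x2 (zk2 n0))).
have d2 := L2B (zk2 n) (zk2 n0).
have -> : (fun w => x' (X0 w) * z' (Z n w) - x' (X0 w) * z' (Z n0 w)) =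
    (fun w => x' (X0 w) * (z' (Z n w) - z' (Z n0 w))).
  by apply/funext => w; rewrite mulrBr.
set D := Ex P _; have De : D ^+ 2 < e ^+ 2.
  have hE : Ex P (fun w => (z' (Z n w) - z' (Z n0 w)) ^+ 2) <= e ^+ 2 / (V + 1) / 2.
    apply: le_trans (h _ _ (leqnn n0) n0n); apply: Ex_le; [exact: d2.2|exact: LZ.2|move=> w].
    by rewrite -dualB -(real_normK (num_real (z' _))) lerXn2r ?nnegrE.
  have cs := Ex_cauchy_schwarz x2 d2.
  apply: (le_lt_trans cs); apply: (@le_lt_trans _ _ (V * (e ^+ 2 / (V + 1) / 2))).
    by rewrite ler_wpM2l.
  have -> : V * (e ^+ 2 / (V + 1) / 2) = e ^+ 2 * (V / (V + 1) / 2).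
    by field; rewrite gt_eqF// ltr_wpDl.
  rewrite gtr_pMr ?exprn_gt0// ltr_pdivrMr// mul1r ltr_pdivrMr ?ltr_wpDl//; lra.
rewrite ltNge; apply/negP => eD; move: De; rewrite ltNge => /negP; apply.
by rewrite lerXn2r// nnegrE ltW// (lt_le_trans e0).
Qed.

(** * Independence of the residual and the observation *)

Section independence.
Hypothesis Lf_borel : forall B : set F, borel B -> sigma_of (\bigcup_n Lf n) B.

Let G := (F * E)%type.
(** Functionals of the first component are restricted to observed ones, for which orthogonality to
    the residual is known; by [Lf_borel] they generate the Borel sets of [F]. *)
Let D : set (G -> R) := [set f | exists n l (x' : topdual E),
  Lf n l /\ f = fun p => l p.1 + x' p.2].

Let D_comb a b f g : D f -> D g -> D (fun p => a * f p + b * g p).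
Proof.
move=> [n [l [x1 [hl ->]]]] [m [k [x2 [hk ->]]]].
have [x' xE] := dual_combination x1 x2 a b.
exists (maxn n m), (fun y => a * l y + b * k y), x'; split.
  by apply: Lf_comb; [exact: Lf_le (leq_maxl _ _) hl|exact: Lf_le (leq_maxr _ _) hk].
by apply/funext => p; rewrite xE; ring.
Qed.

Let D_add f g : D f -> D g -> D (fun p => f p + g p).
Proof. by move=> Df Dg; have := D_comb 1 1 Df Dg; congr D; apply/funext => w; rewrite !mul1r. Qed.

Let D_scale c f : D f -> D (fun p => c * f p).
Proof. by move=> Df; have := D_comb c 0 Df Df; congr D; apply/funext => w; rewrite mul0r addr0. Qed.

(** The factor [c] is [1] for independence and [-1] for symmetry. Variances add because the mixed
    term vanishes by orthogonality. *)
Let res_gauss c n l (x' : topdual E) : Lf n l -> c ^+ 2 = 1 ->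
  [/\ real_gaussian P (fun w => l (Y0 w) + x' (c *: residual w)),
      Ex P (fun w => l (Y0 w) + x' (c *: residual w)) = 0 &
      variance_of P (fun w => l (Y0 w) + x' (c *: residual w)) =
      Ex P (fun w => l (Y0 w) ^+ 2) + Ex P (fun w => x' (residual w) ^+ 2)].
Proof.
move=> hl c1; have [y' lE] := Lf_dual hl.
have [z' zE] := dual_combination x' x' c 0.
have fE : (fun w => l (Y0 w) + x' (c *: residual w)) = (fun w => z' (residual w) + y' (Y0 w)).
  by apply/funext => w; rewrite zE mul0r addr0 dualZ lE addrC.
have fG := residual_gauss z' y'.
have l2 := gauss_space_L2 (gauss_space_Lf hl).
have r2 : L2 P (fun w => x' (residual w)).
  have [C C0 hC] := dual_bounded x'; apply: (L2_le _ _ (L2Z C residual_L2)) => //.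
  exact/borel_fun_dual/borel_residual.
have M0 : Ex P (fun w => l (Y0 w) + x' (c *: residual w)) = 0 by rewrite fE (gauss_law_mean fG).
split => //.
  by rewrite fE; apply/real_gaussianP; eexists; eexists; exact: fG.
rewrite /variance_of M0; have rl := L2_mul r2 l2.
transitivity (Ex P (fun w => l (Y0 w) ^+ 2 + (2 * c * (x' (residual w) * l (Y0 w)) +
    x' (residual w) ^+ 2))).
  congr (Ex P); apply/funext => w; rewrite subr0 dualZ.
  rewrite (_ : x' (residual w) ^+ 2 = c ^+ 2 * x' (residual w) ^+ 2); first by ring.
  by rewrite c1 mul1r.
rewrite (ExD l2.2 (L1D (L1Z (2 * c) rl) r2.2)) (ExD (L1Z (2 * c) rl) r2.2) (ExZ (2 * c) rl).
by rewrite (residual_orth x' hl) mulr0 add0r.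
Qed.

Let U1 w : G := (Y0 w, residual w).
Let Um w : G := (Y0 w, - residual w).
Let U2 (w : T * T) : G := (Y0 w.1, residual w.2).

(** [U2] draws its components from two independent copies of the space. Uncorrelated components give
    every functional in [D] the same mean and variance on both sides. *)
Lemma residual_independent S : sigma_of D S -> [/\ measurable (U1 @^-1` S),
  measurable (U2 @^-1` S) & P (U1 @^-1` S) = (P \x P)%E (U2 @^-1` S)].
Proof.
have one : (1 : R) ^+ 2 = 1 by rewrite expr1n.
have e (l : F -> R) (x' : topdual E) :
    (fun w => l (Y0 w) + x' (residual w)) = (fun w => l (Y0 w) + x' (1 *: residual w)).
  by apply/funext => w; rewrite scale1r.
have rg n l (x' : topdual E) : Lf n l -> [/\ real_gaussian P (fun w => l (Y0 w)),
    real_gaussian P (fun w => x' (residual w)), Ex P (fun w => x' (residual w)) = 0 &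
    variance_of P (fun w => x' (residual w)) = Ex P (fun w => x' (residual w) ^+ 2)].
  move=> hl; have l0 : Lf n (fun y => 0 * l y + 0 * l y) by exact: Lf_comb.
  have [g1 g2 _] := res_gauss x' l0 one.
  have e0 : (fun w => 0 * l (Y0 w) + 0 * l (Y0 w) + x' (1 *: residual w)) =
      (fun w => x' (residual w)).
    by apply/funext => w; rewrite !mul0r !add0r scale1r.
  rewrite e0 in g1 g2; split => //; first exact: gauss_space_gauss (gauss_space_Lf hl).
  by rewrite /variance_of g2; congr (Ex P); apply/funext => w; rewrite subr0.
apply: (@gaussian_law_unique R _ _ _ _ P (P \x P)%E G D U1 U2 D_add D_scale).
- move=> _ [n [l [x' [hl ->]]]] /=; rewrite e.
  by have [] := res_gauss x' hl one.
- move=> _ [n [l [x' [hl ->]]]] /=; have [g1 g2 _ _] := rg n l x' hl.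
  by have [] := real_gaussian_product g1 g2.
- move=> _ [n [l [x' [hl ->]]]] /=; rewrite e; have [g1 g2 g3 _] := rg n l x' hl.
  have [_ -> _] := res_gauss x' hl one; have [_ -> _] := real_gaussian_product g1 g2.
  by rewrite g3 (gauss_space_mean (gauss_space_Lf hl)) addr0.
- move=> _ [n [l [x' [hl ->]]]] /=; rewrite e; have [g1 g2 _ g4] := rg n l x' hl.
  have [_ _ ->] := res_gauss x' hl one; have [_ _ ->] := real_gaussian_product g1 g2.
  by rewrite g4 (gauss_space_var (gauss_space_Lf hl)).
Qed.

Lemma residual_symmetric S : sigma_of D S -> [/\ measurable (U1 @^-1` S),
  measurable (Um @^-1` S) & P (U1 @^-1` S) = P (Um @^-1` S)].
Proof.
have one : (1 : R) ^+ 2 = 1 by rewrite expr1n.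
have mone : (-1 : R) ^+ 2 = 1 by rewrite sqrrN expr1n.
have e (l : F -> R) (x' : topdual E) :
    (fun w => l (Y0 w) + x' (residual w)) = (fun w => l (Y0 w) + x' (1 *: residual w)).
  by apply/funext => w; rewrite scale1r.
have em (l : F -> R) (x' : topdual E) :
    (fun w => l (Y0 w) + x' (- residual w)) = (fun w => l (Y0 w) + x' ((-1) *: residual w)).
  by apply/funext => w; rewrite scaleN1r.
apply: (@gaussian_law_unique R _ _ _ _ P P G D U1 Um D_add D_scale).
- by move=> _ [n [l [x' [hl ->]]]] /=; rewrite e; have [] := res_gauss x' hl one.
- by move=> _ [n [l [x' [hl ->]]]] /=; rewrite em; have [] := res_gauss x' hl mone.
- move=> _ [n [l [x' [hl ->]]]] /=; rewrite e em.
  by have [_ -> _] := res_gauss x' hl one; have [_ -> _] := res_gauss x' hl mone.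
- move=> _ [n [l [x' [hl ->]]]] /=; rewrite e em.
  by have [_ _ ->] := res_gauss x' hl one; have [_ _ ->] := res_gauss x' hl mone.
Qed.

Let GT := g_sigma_algebraType (\bigcup_(f in D) preimage_set_system setT f (@measurable _ R)).

Let D_meas (f : G -> R) : D f -> measurable_fun setT (f : GT -> R).
Proof. by move=> Df _ B mB; apply: sub_sigma_algebra; exists f => //; exists B. Qed.

Let fst_borel B : borel B -> measurable [set p : GT | B p.1].
Proof.
move=> /Lf_borel; suff : sigma_of (\bigcup_n Lf n) `<=`
  image_set_system setT fst (@measurable _ GT).
  by move=> h /h; rewrite /image_set_system/= setTI.
apply: smallest_sub.
  apply: sigma_algebra_image; exact: sigma_algebra_measurable.
move=> _ [l [n _ hl] [C mC <-]]; rewrite /image_set_system/= !setTI.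
have x0 : exists x' : topdual E, True by have [x' _] := norming_functional (0 : E); exists x'.
have [x' _] := x0; have [x0' x0E] := dual_combination x' x' 0 0.
have : measurable_fun setT ((fun p => l p.1 + x0' p.2) : GT -> R).
  by apply: D_meas; exists n, l, x0'.
move=> /(_ measurableT C mC); rewrite setTI; congr measurable.
by apply/funext => p; rewrite /= x0E !mul0r !addr0.
Qed.

Let fst_measurable (f : F -> R) : measurable_fun setT (f : borelType F -> R) ->
  measurable_fun setT ((fun p => f p.1) : GT -> R).
Proof.
by move=> mf _ B mB; rewrite setTI; apply: (fst_borel (B := f @^-1` B));
  have := mf measurableT B mB; rewrite setTI.
Qed.

Let snd_borel : borel_fun ((fun p => p.2) : GT -> E).
Proof.
apply: pettis => // x'.
have [y' _] : exists x' : topdual E, True by have [z' _] := norming_functional (0 : E); exists z'.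
have l0 : Lf 0 (fun y => 0 * y' (Phi 0 y) + 0 * y' (Phi 0 y)).
  by apply: Lf_comb; exact: Phi_dual.
have := @D_meas (fun p => 0 * y' (Phi 0 p.1) + 0 * y' (Phi 0 p.1) + x' p.2).
have -> : (fun p : G => 0 * y' (Phi 0 p.1) + 0 * y' (Phi 0 p.1) + x' p.2) = (fun p => x' p.2).
  by apply/funext => p; rewrite !mul0r !add0r.
apply; exists 0%N, (fun y => 0 * y' (Phi 0 y) + 0 * y' (Phi 0 y)), x'; split => //.
by apply/funext => p; rewrite !mul0r !add0r.
Qed.

(** The pairs [(Y0, residual)] and [(Y0, - residual)] have the same law, so the expectation is its
    own opposite. *)
Lemma residual_cond (C : set F) (x' : topdual E) : borel C ->
  Ex P (fun w => \1_C (Y0 w) * x' (residual w)) = 0.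
Proof.
move=> bC; pose psi (p : G) : R := \1_C p.1 * x' p.2.
have mpsi : measurable_fun setT (psi : GT -> R).
  apply: measurable_funM; last exact: borel_fun_dual snd_borel.
  by apply: fst_measurable; exact: measurable_indic.
have psiS B : measurable B -> sigma_of D (psi @^-1` B).
  by move=> mB; have := mpsi measurableT B mB; rewrite setTI.
have m1 : measurable_fun setT (psi \o U1).
  by move=> _ B mB; rewrite setTI; have [] := residual_symmetric (psiS B mB).
have m2 : measurable_fun setT (psi \o Um).
  by move=> _ B mB; rewrite setTI; have [] := residual_symmetric (psiS B mB).
have law B : measurable B -> P ((psi \o U1) @^-1` B) = P ((psi \o Um) @^-1` B).
  by move=> mB; have [] := residual_symmetric (psiS B mB).
have mi : measurable_fun setT (fun x : R => x) by exact: measurable_id.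
have := @Ex_same_law _ _ _ _ _ _ R P P _ _ m1 m2 law _ mi.
have -> : (fun w => (psi \o U1) w) = (fun w => \1_C (Y0 w) * x' (residual w)) by [].
have -> : (fun w => (psi \o Um) w) = (fun w => - (\1_C (Y0 w) * x' (residual w))).
  by apply/funext => w; rewrite /psi /Um /= dualN mulrN.
rewrite ExN; first by lra.
have r2 : L2 P (fun w => x' (residual w)).
  have [K K0 hK] := dual_bounded x'; apply: (L2_le _ _ (L2Z K residual_L2)) => //.
  exact/borel_fun_dual/borel_residual.
by apply: L1_le m1 _ (L1_norm (L2_L1 r2)) => w; rewrite /psi /U1 /= normrM indicE;
  case: (_ \in _); rewrite ?normr1 ?mul1r// normr0 mul0r.
Qed.

(** Independence turns the joint law into a product, and a product measure is an integral of
    sections; the section at [w] is an event about the residual translated by [f (Y0 w)]. *)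
Lemma residual_disintegration (A : set F) (f : F -> E) (B : set E) :
  borel A -> borel_fun (f : borelType F -> E) -> borel B ->
  P [set w | A (Y0 w) /\ B (residual w + f (Y0 w))] =
  (\int[P]_w ((\1_A (Y0 w))%:E * P [set v | B (residual v + f (Y0 w))%R]))%E.
Proof.
move=> bA bf bB; pose S : set G := [set p | A p.1 /\ B (p.2 + f p.1)].
have sS : sigma_of D S.
  have -> : S = [set p | A p.1] `&` (fun p => p.2 + f p.1) @^-1` B by [].
  suff : @measurable _ GT ([set p | A p.1] `&` (fun p => p.2 + f p.1) @^-1` B) by [].
  apply: measurableI; first exact: fst_borel.
  have bsum : borel_fun ((fun p => p.2 + f p.1) : GT -> E).
    apply: borel_funD => //; apply: pettis => // x'.
    by apply: (fst_measurable (f := fun y => x' (f y))); exact: borel_fun_dual.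
  by have := bsum measurableT B bB; rewrite setTI.
have [_ mU2 SE] := residual_independent sS.
transitivity (P (U1 @^-1` S)) => //; rewrite SE.
apply: eq_integral => w _ /=; rewrite indicE.
case: (boolP (Y0 w \in A)) => [/set_mem Aw|/negP nA].
  rewrite mul1e; congr (P _); apply/seteqP; split => v; rewrite /xsection/= inE.
    by case.
  by split.
rewrite mul0e (_ : xsection _ _ = set0) ?measure0//.
rewrite -subset0 => v; rewrite /xsection/= inE => -[/= Aw _].
by apply: nA; exact/mem_set.
Qed.

End independence.

End regression_sequence.

(** * Pseudo-inverses and linear algebra of row vectors *)

Section moore_penrose.
Context {R : realType}.

Lemma mx_mul_tr_eq0 n (v : 'rV[R]_n) : v *m v^T = 0 -> v = 0.
Proof.
move=> /matrixP/(_ 0 0); rewrite !mxE => h; apply/rowP => j; rewrite mxE.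
have : \sum_j v 0 j ^+ 2 = 0.
  by rewrite -[RHS]h; apply: eq_bigr => i _; rewrite mxE expr2.
move=> /eqP; rewrite psumr_eq0; last by move=> i _; exact: sqr_ge0.
by move=> /allP/(_ j (mem_index_enum j)); rewrite /= sqrf_eq0 => /eqP.
Qed.

Lemma gram_unit r n (M : 'M[R]_(r, n)) : row_free M -> M *m M^T \in unitmx.
Proof.
move=> fM; rewrite -row_free_unit; apply: inj_row_free => v vM.
have : (v *m M) *m (v *m M)^T = 0.
  by rewrite trmx_mul mulmxA -(mulmxA v) vM mul0mx.
move=> /mx_mul_tr_eq0 h; apply: (row_free_inj fM); by rewrite h mul0mx.
Qed.

Lemma is_mp_inverse_mul m r n (C : 'M[R]_(m, r)) (B : 'M[R]_(r, n)) :
  row_free C^T -> row_free B ->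
  is_mp_inverse (C *m B) (B^T *m invmx (B *m B^T) *m invmx (C^T *m C) *m C^T).
Proof.
move=> fC fB; have uK := gram_unit fB; have uG := gram_unit fC; rewrite trmxK in uG.
set K := B *m B^T in uK *; set G := C^T *m C in uG *.
have trK : K^T = K by rewrite /K trmx_mul trmxK.
have trG : G^T = G by rewrite /G trmx_mul trmxK.
have AQ : C *m B *m (B^T *m invmx K *m invmx G *m C^T) = C *m invmx G *m C^T.
  by rewrite !mulmxA -(mulmxA C) -/K -(mulmxA C) mulmxV// mulmx1.
have QA : B^T *m invmx K *m invmx G *m C^T *m (C *m B) = B^T *m invmx K *m B.
  by rewrite !mulmxA -(mulmxA _ C^T) -/G mulmxKV.
split.
- by rewrite AQ !mulmxA -(mulmxA _ C^T) -/G mulmxKV.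
- by rewrite QA !mulmxA -(mulmxA _ B) -/K mulmxKV.
- by rewrite AQ !trmx_mul trmxK trmx_inv trG mulmxA.
- by rewrite QA !trmx_mul trmxK trmx_inv trK mulmxA.
Qed.

(** Existence comes from the full-rank factorization of [A] into column and row bases, whose Gram
    matrices are invertible over the reals. *)
Lemma mp_inverse_spec m n (A : 'M[R]_(m, n)) : is_mp_inverse A (mp_inverse A).
Proof.
have fC : row_free (col_base A)^T by rewrite /row_free mxrank_tr; exact: col_base_full.
have := is_mp_inverse_mul fC (row_base_free A); rewrite mulmx_base => h.
exact: xgetPex (ex_intro _ _ h).
Qed.

(* For a symmetric [C], a vector annihilated by the kernel of [C] lies in its range, where
   [C *m mp_inverse C] acts as the identity. *)
Lemma mp_inverse_fix n (C : 'M[R]_n) (c : 'cV[R]_n) : C^T = C ->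
  (forall u : 'rV[R]_n, u *m C = 0 -> u *m c = 0) -> C *m mp_inverse C *m c = c.
Proof.
move=> trC h; have [h1 _ h3 _] := mp_inverse_spec C; set M := mp_inverse C in h1 h3 *.
pose u := (c - C *m M *m c)^T.
have CM : C *m (C *m M) = C by rewrite -{1}trC -h3 -trmx_mul h1.
have uC : u *m C = 0.
  rewrite /u -{2}trC -trmx_mul mulmxBr mulmxA CM subrr.
  by rewrite trmx0.
have uc := h _ uC.
have : u *m u^T = 0 by rewrite {2}/u trmxK mulmxBr uc !mulmxA uC !mul0mx subrr.
by move=> /mx_mul_tr_eq0/(congr1 trmx); rewrite /u trmxK trmx0 => /eqP; rewrite subr_eq0 => /eqP.
Qed.

End moore_penrose.

(** Makes row vectors a complete normed module, as the Bochner and covariance lemmas require of [E]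
    and [F]. *)
HB.instance Definition _ (R : realType) (n : nat) := Complete.on 'rV[R]_n.+1.

Section row_vectors.
Context {R : realType} {n : nat}.

Lemma row_separable : separable_space 'rV[R]_n.+1.
Proof.
exists (range (fun v : 'rV[rat]_n.+1 => map_mx ratr v : 'rV[R]_n.+1)).
  exact: sub_countable (card_image_le _ _) (countableP _).
move=> O [x Ox] oO; have /nbhs_ballP[e /= e0 he] := open_nbhs_nbhs (conj oO Ox).
have h j : {q : rat | x 0 j < ratr q < x 0 j + e}.
  have lt : x 0 j < x 0 j + e by rewrite ltrDl.
  by have /cid[q] := rat_in_itvoo lt; rewrite in_itv /=; exists q.
exists (map_mx ratr (\row_j sval (h j))); split; last by exists (\row_j sval (h j)).
apply: he; split=> // i j; rewrite !mxE ord1; case: (h j) => q /= /andP[q1 q2].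
by rewrite /ball /= ltr_distlC; apply/andP; split; lra.
Qed.

Lemma dual_row (z' : topdual 'rV[R]_n) : exists q : 'rV[R]_n, forall v, z' v = rdot q v.
Proof.
exists (\row_j z' (delta_mx 0 j)) => v; rewrite {1}(row_sum_delta v) dual_sum.
by apply: eq_bigr => j _; rewrite dualZ mxE.
Qed.

End row_vectors.

Section linear_factorization.
Context {R : realType} {F : lmodType R}.

(** If some [v0] is killed by the first [n] functionals but not by [a n], subtracting the multiple
    [f v0 / a n v0] of [a n] from [f] reduces to [n] functionals; otherwise [a n] already vanishes
    wherever they do. *)
Lemma scalar_span n (a : nat -> F -> R) (f : F -> R) : (forall i, scalar (a i)) -> scalar f ->
  (forall v, (forall i, (i < n)%N -> a i v = 0) -> f v = 0) ->
  exists q : nat -> R, forall v, f v = \sum_(i < n) q i * a i v.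
Proof.
elim: n f => [|n IH] f sa sf hf.
  by exists (fun=> 0) => v; rewrite big_ord0; exact: hf.
have [[v0 [v00 v0n]]|nv] := pselect (exists v0, (forall i, (i < n)%N -> a i v0 = 0) /\ a n v0 != 0).
  pose c := f v0 / a n v0.
  have sf' : scalar (fun v => f v - c * a n v).
    by move=> k v w; rewrite sf sa; ring.
  have [|q qE] := IH _ sa sf'.
    move=> v hv; have : f ((- (a n v / a n v0)) *: v0 + v) = 0.
      apply: hf => i; rewrite ltnS leq_eqVlt => /orP[/eqP ->|ilt].
        by rewrite sa; field.
      by rewrite sa (v00 i)// (hv i)// mulr0 addr0.
    by rewrite sf => <-; rewrite /c; field.
  exists (fun i => if (i < n)%N then q i else c) => v.
  rewrite big_ord_recr /= ltnn; rewrite (eq_bigr (fun i : 'I_n => q i * a i v)).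
    by rewrite -qE subrK.
  by move=> i _; rewrite ltn_ord.
have [|q qE] := IH f sa sf.
  move=> v hv; apply: hf => i; rewrite ltnS leq_eqVlt => /orP[/eqP ->|]; last exact: hv.
  by apply/eqP/negP => /negP an; apply: nv; exists v.
exists (fun i => if (i < n)%N then q i else 0) => v.
rewrite big_ord_recr /= ltnn mul0r addr0 qE.
by apply: eq_bigr => i _; rewrite ltn_ord.
Qed.

Lemma row_factor n (A : {linear F -> 'rV[R]_n}) (f : F -> R) : scalar f ->
  (forall v, A v = 0 -> f v = 0) -> exists q, forall v, f v = rdot q (A v).
Proof.
move=> sf hf; pose a i v := if insub i is Some j then A v 0 j else 0.
have aE (j : 'I_n) v : a j v = A v 0 j by rewrite /a valK.
have sa i : scalar (a i).
  move=> c v w; rewrite /a; case: insubP => [j _ _|_].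
    by rewrite linearP !mxE.
  by rewrite mulr0 addr0.
have [|q qE] := @scalar_span n a f sa sf.
  move=> v hv; apply: hf; apply/rowP => j; rewrite mxE -aE; exact: hv.
exists (\row_j q j) => v; rewrite qE; apply: eq_bigr => j _.
by rewrite aE mxE mulrC.
Qed.

End linear_factorization.

(** * Covariance operators seen through functionals *)

Section covariance_operator.
Context {R : realType} {d : measure_display} {T : measurableType d}.
Variables (P : probability T R) (E F : completeNormedModType R).
Variables (sepE : separable_space E) (sepF : separable_space F).
Variables (X : T -> E) (Y : T -> F).
Hypotheses (bX : borel_fun X) (bY : borel_fun Y).
Hypotheses (X2 : L2 P (fun w => `|X w|)) (Y2 : L2 P (fun w => `|Y w|)).

Lemma L2_dual (y' : topdual F) : L2 P (fun w => y' (Y w)).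
Proof.
have [C C0 hC] := dual_bounded y'.
by apply: (L2_le _ _ (L2Z C Y2)) => //; exact: borel_fun_dual.
Qed.

Lemma L2_center (c : F) : L2 P (fun w => `|Y w - c|).
Proof.
apply: (L2_le _ _ (L2D Y2 (L2_cst P `|c|))).
  by apply/borel_fun_norm/borel_funB => //; exact: borel_fun_cst.
by move=> w; rewrite normr_id ler_normB.
Qed.

End covariance_operator.

Lemma dual_cov_op {R : realType} {d : measure_display} {T : measurableType d}
    (P : probability T R) (E F : completeNormedModType R) (X : T -> E) (Y : T -> F)
    (x' : topdual E) (y' : topdual F) : separable_space E -> separable_space F ->
  borel_fun X -> borel_fun Y -> L2 P (fun w => `|X w|) -> L2 P (fun w => `|Y w|) ->
  x' (cov_op P X Y y') = Ex P (fun w => y' (Y w - bochner P Y) * x' (X w - bochner P X)).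
Proof.
move=> sepE sepF bX bY X2 Y2.
have bXc : borel_fun (fun w => X w - bochner P X).
  by apply: borel_funB => //; exact: borel_fun_cst.
have bYc : borel_fun (fun w => Y w - bochner P Y).
  by apply: borel_funB => //; exact: borel_fun_cst.
have mY : measurable_fun setT (fun w => y' (Y w - bochner P Y)) by exact: borel_fun_dual.
rewrite /cov_op dual_bochner//.
- by congr Ex; apply/funext => w; rewrite dualZ.
- exact: borel_funZ.
- under eq_fun do rewrite normrZ.
  apply: L2_mul; last exact: L2_center.
  apply: L2_norm; apply: L2_dual => //; exact: L2_center.
Qed.

(** * Observed functionals of a filtering sequence *)

Section filtering.
Context {R : realType} {F : normedModType R}.
Variable A : forall n, {linear F -> 'rV[R]_n.+1}.
Hypothesis hA : filtering_sequence A.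

Definition observed (n : nat) : set (F -> R) :=
  [set l | exists q : 'rV[R]_n.+1, l = fun v => rdot q (A n v)].

Let cA n : continuous (A n). Proof. by case: hA => h _ _; exact: h. Qed.

Lemma observed_dual n l : observed n l -> exists y' : topdual F, l = y'.
Proof.
move=> [q ->]; have [y' yE] := dual_comp (riesz q) (@cA n).
by exists y'; apply/funext => v; rewrite yE.
Qed.

Lemma observed_comb n a b l k :
  observed n l -> observed n k -> observed n (fun v => a * l v + b * k v).
Proof.
move=> [q ->] [r ->]; exists (a *: q + b *: r); apply/funext => v.
rewrite /rdot !mulr_sumr -big_split /=; apply: eq_bigr => j _; rewrite !mxE; ring.
Qed.

(** The kernel of [A n] is the preimage under [A n.+1] of a Borel set, which must contain [0]; hence
    it contains the kernel of [A n.+1]. A functional of [A n] then vanishes on that kernel and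
    factors through [A n.+1]. *)
Lemma observed_mono n l : observed n l -> observed n.+1 l.
Proof.
move=> Ol; have [y' yE] := observed_dual Ol; case: Ol => q lE.
have [_ hm _] := hA.
have sl : scalar l by rewrite yE; exact: dualP.
have [|r rE] := @row_factor _ _ _ (A n.+1) l sl; last by exists r; apply/funext.
move=> v Av0.
have c0 : @borel R 'rV[R]_n.+1 [set 0].
  rewrite -[X in borel X]setCK; apply: measurableC; apply: sub_sigma_algebra.
  exact/closed_openC/accessible_closed_set1/hausdorff_accessible/norm_hausdorff.
have [B mB BE] : sigma_fun (A n.+1) (A n @^-1` [set 0]).
  by apply: hm; exists [set 0] => //; rewrite setTI.
have B0 : B 0.
  have : (setT `&` A n.+1 @^-1` B) 0 by rewrite BE /= linear0.
  by rewrite setTI /= linear0.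
have : (A n @^-1` [set 0]) v by rewrite -BE setTI /= Av0.
by rewrite /= lE => ->; have := linear0 (rdot q).
Qed.

Lemma observed_borel (sepF : separable_space F) (B : set F) :
  borel B -> sigma_of (\bigcup_n observed n) B.
Proof.
have [_ _ hs] := hA; rewrite (borel_sigma_dual sepF) hs.
apply: smallest_sub; first exact: smallest_sigma_algebra.
move=> _ [n _ [C mC <-]]; rewrite setTI.
apply: (borel_sigma_algebra row_separable) mC; first exact: smallest_sigma_algebra.
move=> z' D mD; have [q qE] := dual_row z'.
apply: sub_sigma_algebra; exists (fun v => rdot q (A n v)).
  by exists n => //; exists q.
by exists D => //; rewrite setTI; apply/seteqP; split => v /=; rewrite qE.
Qed.

End filtering.

(** * Least-squares regression on finitely many variables *)

Section finite_regression.
Context {R : realType} {d : measure_display} {T : measurableType d}.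
Variables (P : probability T R) (n : nat) (W : T -> 'rV[R]_n) (g : T -> R).
Hypotheses (W2 : forall j, L2 P (fun w => W w 0 j)) (g2 : L2 P g).

Definition gram : 'M[R]_n := \matrix_(i, j) Ex P (fun w => W w 0 i * W w 0 j).
Definition cross (h : T -> R) : 'cV[R]_n := \col_j Ex P (fun w => W w 0 j * h w).

Lemma rdot_L2 q : L2 P (fun w => rdot q (W w)).
Proof.
apply: L2_sum => j; under eq_fun do rewrite mulrC.
exact: L2Z.
Qed.

Lemma Ex_rdot q h : L2 P h -> Ex P (fun w => rdot q (W w) * h w) = (q *m cross h) 0 0.
Proof.
move=> h2; under [in LHS]eq_fun do rewrite mulr_suml.
rewrite Ex_sum; last first.
  move=> j _; have := L1Z (q 0 j) (L2_mul (W2 j) h2).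
  by congr (L1 _ _); apply/funext => w; ring.
rewrite mxE; apply: eq_bigr => j _; rewrite mxE -ExZ; last exact: L2_mul.
by congr Ex; apply/funext => w; ring.
Qed.

Lemma cross_rdot q : cross (fun w => rdot q (W w)) = gram *m q^T.
Proof.
apply/colP => i; rewrite mxE; under eq_fun do rewrite mulrC.
rewrite Ex_rdot// !mxE; apply: eq_bigr => j _.
rewrite !mxE mulrC; congr (_ * _).
by congr Ex; apply/funext => w; rewrite mulrC.
Qed.

Lemma tr_gram : gram^T = gram.
Proof. by apply/matrixP => i j; rewrite !mxE; congr Ex; apply/funext => w; rewrite mulrC. Qed.

(** A [u] in the kernel of the Gram matrix yields a variable of zero second moment, orthogonal to
    [g] by Cauchy-Schwarz. This makes the normal equations solvable for a singular Gram matrix. *)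
Lemma ker_gram_cross (u : 'rV[R]_n) : u *m gram = 0 -> u *m cross g = 0.
Proof.
move=> uC; apply/rowP => k; rewrite ord1 -Ex_rdot// [RHS]mxE.
have u2 := rdot_L2 u.
have s0 : Ex P (fun w => rdot u (W w) ^+ 2) = 0.
  under eq_fun do rewrite expr2.
  by rewrite Ex_rdot// cross_rdot mulmxA uC mul0mx mxE.
have := Ex_cauchy_schwarz u2 g2; rewrite s0 mul0r => h.
by apply/eqP; rewrite -sqrf_eq0 eq_le h sqr_ge0.
Qed.

(** These are the normal equations: by [mp_inverse_fix], applying the Gram matrix to the
    coefficients of the regression returns [cross P W g]. *)
Lemma regression_orth q : Ex P (fun w =>
  (g w - rdot (mp_inverse gram *m cross g)^T (W w)) * rdot q (W w)) = 0.
Proof.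
have q2 := rdot_L2 q; set p := (_ *m _)^T; have p2 := rdot_L2 p.
under eq_fun do rewrite mulrBl.
rewrite ExB; [|exact: L2_mul..].
have -> : Ex P (fun w => g w * rdot q (W w)) = (q *m cross g) 0 0.
  by rewrite -Ex_rdot//; congr Ex; apply/funext => w; rewrite mulrC.
have -> : Ex P (fun w => rdot p (W w) * rdot q (W w)) = (q *m cross g) 0 0.
  transitivity (Ex P (fun w => rdot q (W w) * rdot p (W w))).
    by congr Ex; apply/funext => w; rewrite mulrC.
  rewrite Ex_rdot// cross_rdot /p trmxK (mulmxA gram).
  rewrite mp_inverse_fix//; [exact: tr_gram|exact: ker_gram_cross].
by rewrite subrr.
Qed.

End finite_regression.

(** * Normal laws on a separable Banach space *)

Section normal_laws.
Context {R : realType} {E : completeNormedModType R}.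
Hypothesis sepE : separable_space E.

(** Mean and variance of each functional are read off from [m] and [K], and the functionals generate
    the Borel sets. *)
Lemma is_normal_unique (m : E) (K : topdual E -> E) (Q1 Q2 : probability (borelType E) R) :
  is_normal m K Q1 -> is_normal m K Q2 -> forall B, borel B -> Q1 B = Q2 B.
Proof.
have key (Q : probability (borelType E) R) (x' : topdual E) : is_normal m K Q ->
    Ex Q x' = x' m /\ variance_of Q x' = x' (K x').
  move=> [gid bid cid]; have id2 := gaussian_rv_L2 sepE gid.
  have idb : borel_fun (id : borelType E -> E) by case: gid.
  have meanE : x' m = Ex Q x' by rewrite -bid; apply: dual_bochner => //; exact: L2_L1.
  split; rewrite // -cid (dual_cov_op _ _ sepE sepE idb idb id2 id2) /variance_of -meanE.
  by congr Ex; apply/funext => x; rewrite bid -dualB expr2.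
move=> n1 n2 B bB; pose D : set (E -> R) := [set f : E -> R | exists x' : topdual E, f = x'].
have sB : sigma_of D B.
  apply: (borel_sigma_algebra sepE (f := id)) bB; first exact: smallest_sigma_algebra.
  move=> x' S mS; apply: sub_sigma_algebra; exists (x' : E -> R); first by exists x'.
  by exists S => //; rewrite setTI.
have [] := @gaussian_law_unique R _ _ _ _ Q1 Q2 E D id id _ _ _ _ _ _ B sB => //.
- move=> _ _ [x' ->] [y' ->]; have [z zE] := dual_combination x' y' 1 1.
  by exists z; apply/funext => x; rewrite zE !mul1r.
- move=> c _ [x' ->]; have [z zE] := dual_combination x' x' c 0.
  by exists z; apply/funext => x; rewrite zE mul0r addr0.
- by move=> _ [x' ->]; case: n1 => -[_ h] _ _; exact: h.
- by move=> _ [x' ->]; case: n2 => -[_ h] _ _; exact: h.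
- by move=> _ [x' ->]; rewrite (key _ x' n1).1 (key _ x' n2).1.
- by move=> _ [x' ->]; rewrite (key _ x' n1).2 (key _ x' n2).2.
Qed.

Lemma normal_lawP (m : E) (K : topdual E -> E) (Q : probability (borelType E) R) :
  is_normal m K Q ->
  is_normal m K (normal_law m K) /\ forall B, borel B -> normal_law m K B = Q B.
Proof.
move=> nQ; have h : is_normal m K (normal_law m K) by apply: xgetPex; exists Q.
by split=> // B; exact: is_normal_unique h nQ B.
Qed.

Context {d : measure_display} {T : measurableType d}.
Variables (P : probability T R) (U : T -> E).
Hypothesis gU : gaussian_rv P U.

(** The witness is the law of [U]; its mean and covariance are identified functional by functional
    through a change of variables. *)
Lemma gaussian_rv_normal (K : topdual E -> E) :
  (forall x' z' : topdual E, z' (K x') =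
     Ex P (fun w => x' (U w - bochner P U) * z' (U w - bochner P U))) ->
  exists Q, is_normal (bochner P U) K Q /\ forall B, borel B -> Q B = P (U @^-1` B).
Proof.
move=> KE; have bU : borel_fun U by case: gU.
pose Q : probability (borelType E) R := distribution P (mfun_Sub (mem_set bU)).
have QE B : Q B = P (U @^-1` B) by [].
have bid : borel_fun (id : borelType E -> E) by exact: measurable_id.
have gid : gaussian_rv Q (id : borelType E -> E).
  split=> // x'; split; first exact: dual_measurable.
  have [_ [m [s h]]] := gU.2 x'; exists m, s => B mB; rewrite -h// QE.
have id2 := gaussian_rv_L2 sepE gid; have U2 := gaussian_rv_L2 sepE gU.
have ExQ (h : E -> R) : measurable_fun setT (h : borelType E -> R) ->
    Ex Q h = Ex P (fun w => h (U w)).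
  move=> mh; apply: (@Ex_same_law _ _ _ _ _ _ R Q P id U bid bU _ h mh).
  by move=> B _; rewrite QE.
have meanE : bochner Q id = bochner P U.
  apply: bochnerP => //; first exact: L2_L1.
  move=> x'; rewrite ExQ; last exact: dual_measurable.
  by apply: dual_bochner => //; exact: L2_L1.
exists Q; split=> //; split=> // x'; apply: dual_inj => z'.
rewrite (dual_cov_op _ _ sepE sepE bid bid id2 id2) KE meanE ExQ//.
apply: measurable_funM.
  under eq_fun do rewrite dualB.
  by apply: measurable_funB => //; exact: dual_measurable.
under eq_fun do rewrite dualB.
by apply: measurable_funB => //; exact: dual_measurable.
Qed.

End normal_laws.

Lemma indic_iff {R : realType} (U V : Type) (S : set U) (S' : set V) u v :
  (S u <-> S' v) -> \1_S u = \1_S' v :> R.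
Proof.
move=> h; rewrite !indicE; suff -> : (u \in S) = (v \in S') by [].
by apply/idP/idP => /set_mem/h/mem_set.
Qed.

(** * Conditional mean and conditional law of jointly Gaussian vectors *)

Section gaussian_conditioning.
Context {R : realType} {d : measure_display} {T : measurableType d}.
Variables (P : probability T R) (E F : completeNormedModType R).
Variables (sepE : separable_space E) (sepF : separable_space F).
Variables (X : T -> E) (Y : T -> F) (XY : jointly_gaussian P X Y).
(* The means, and later the operators, the limit and the residual, are kept abstract: otherwise
   unification unfolds the [get] in [bochner]. *)
Variables (mX : E) (mY : F) (bmX : bochner P X = mX) (bmY : bochner P Y = mY).
Variable A : forall n, {linear F -> 'rV[R]_n.+1}.
Hypothesis hA : filtering_sequence A.

Let zero_dual (V : normedModType R) : exists z : topdual V, forall x, z x = 0.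
Proof.
have [z _] := norming_functional (0 : V); have [z' zE] := dual_combination z z 0 0.
by exists z' => x; rewrite zE !mul0r addr0.
Qed.

Let joint (x' : topdual E) (y' : topdual F) :
  real_gaussian P (fun w => x' (X w) + y' (Y w)).
Proof.
have [z' zE] := dual_pair x' y'; have := XY.2 z'.
by congr real_gaussian; apply/funext => w; rewrite zE.
Qed.

Let gX : gaussian_rv P X.
Proof.
split.
  move=> _ B mB; have c : continuous (fst : E * F -> E) by move=> p; exact: cvg_fst.
  exact: (XY.1 measurableT _ (continuous_borel_fun c mB)).
move=> x'; have [z zE] := zero_dual F; have := joint x' z.
by congr real_gaussian; apply/funext => w; rewrite zE addr0.
Qed.

Let gY : gaussian_rv P Y.
Proof.
split.
  move=> _ B mB; have c : continuous (snd : E * F -> F) by move=> p; exact: cvg_snd.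
  exact: (XY.1 measurableT _ (continuous_borel_fun c mB)).
move=> y'; have [z zE] := zero_dual E; have := joint z y'.
by congr real_gaussian; apply/funext => w; rewrite zE add0r.
Qed.

Let bX : borel_fun X := gX.1.
Let bY : borel_fun Y := gY.1.
Let X2 : L2 P (fun w => `|X w|) := gaussian_rv_L2 sepE gX.
Let Y2 : L2 P (fun w => `|Y w|) := gaussian_rv_L2 sepF gY.
Let X0 w : E := X w - mX.
Let Y0 w : F := Y w - mY.

Let bX0 : borel_fun X0. Proof. by apply: borel_funB => //; exact: borel_fun_cst. Qed.
Let bY0 : borel_fun Y0. Proof. by apply: borel_funB => //; exact: borel_fun_cst. Qed.
Let X02 : L2 P (fun w => `|X0 w|). Proof. exact: L2_center. Qed.
Let Y02 : L2 P (fun w => `|Y0 w|). Proof. exact: L2_center. Qed.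

Let Ex_X (x' : topdual E) : x' mX = Ex P (fun w => x' (X w)).
Proof. by rewrite -bmX; apply: dual_bochner => //; exact: L2_L1. Qed.

Let Ex_Y (y' : topdual F) : y' mY = Ex P (fun w => y' (Y w)).
Proof. by rewrite -bmY; apply: dual_bochner => //; exact: L2_L1. Qed.

Let Ex_X0 (x' : topdual E) : Ex P (fun w => x' (X0 w)) = 0.
Proof.
under eq_fun do rewrite dualB.
by rewrite ExB ?Ex_cst -?Ex_X ?subrr//; [exact/L2_L1/L2_dual|exact: L1_cst].
Qed.

Let Ex_Y0 (y' : topdual F) : Ex P (fun w => y' (Y0 w)) = 0.
Proof.
under eq_fun do rewrite dualB.
by rewrite ExB ?Ex_cst -?Ex_Y ?subrr//; [exact/L2_L1/L2_dual|exact: L1_cst].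
Qed.

Let gaussXY0 (x' : topdual E) (y' : topdual F) :
  real_gaussian P (fun w => x' (X0 w) + y' (Y0 w)).
Proof.
have := real_gaussian_affine 1 (- (x' mX + y' mY)) (joint x' y').
by congr real_gaussian; apply/funext => w; rewrite !dualB; ring.
Qed.

Let meanXY0 (x' : topdual E) (y' : topdual F) : Ex P (fun w => x' (X0 w) + y' (Y0 w)) = 0.
Proof.
by rewrite ExD ?Ex_X0 ?Ex_Y0 ?addr0//; exact/L2_L1/L2_dual.
Qed.

Let cA n : continuous (A n). Proof. by case: hA => h _ _; exact: h. Qed.
Let Yn n w : 'rV[R]_n.+1 := A n (Y w).

Let gYn n : gaussian_rv P (Yn n).
Proof.
split.
  by move=> _ B mB; exact: (bY measurableT (continuous_borel_fun (@cA n) mB)).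
move=> z'; have [y' yE] := dual_comp z' (@cA n); have := gY.2 y'.
by congr real_gaussian; apply/funext => w; rewrite yE.
Qed.

Let Yn2 n : L2 P (fun w => `|Yn n w|) := gaussian_rv_L2 row_separable (@gYn n).

Let bochner_Yn n : bochner P (Yn n) = A n mY.
Proof.
apply: bochnerP; [exact: row_separable|exact: (gYn n).1|exact: L2_L1 (Yn2 n)|move=> z'].
have [y' yE] := dual_comp z' (@cA n); rewrite -yE Ex_Y.
by congr Ex; apply/funext => w; rewrite yE.
Qed.

Let Yn_center n w : Yn n w - bochner P (Yn n) = A n (Y0 w).
Proof. by rewrite bochner_Yn /Yn -linearB. Qed.

(** Takes the centred observation [y - mY], so that it is linear and the translated set of
    convergence becomes a subspace. *)
Definition regression_operator n (v : F) : E :=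
  cov_op P X (Yn n) (Defs.pinv (cov_op P (Yn n) (Yn n)) (A n v)).

Let cond_mean_approxE n y : cond_mean_approx P X Y A n y = regression_operator n (y - mY).
Proof. by rewrite /regression_operator linearB -bochner_Yn. Qed.

Let W n w : 'rV[R]_n.+1 := A n (Y0 w).

Let W2 n j : L2 P (fun w => W n w 0 j).
Proof.
have [|y' yE] := @observed_dual _ _ _ hA n (fun v => A n v 0 j).
  exists (delta_mx 0 j); apply/funext => v; rewrite /rdot (bigD1 j)//= mxE !eqxx mulr1.
  by rewrite big1 ?addr0// => i ij; rewrite mxE (negbTE ij) andbF mulr0.
have := L2_dual bY0 Y02 y'; congr (L2 _ _).
by apply/funext => w; rewrite -yE.
Qed.

Let riesz_coord n (j : 'I_n) (v : 'rV[R]_n) : riesz (delta_mx 0 j) v = v 0 j.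
Proof.
rewrite /= /rdot (bigD1 j)//= mxE !eqxx mulr1.
by rewrite big1 ?addr0// => i ij; rewrite mxE (negbTE ij) andbF mulr0.
Qed.

Let gramE n : riesz_mx (cov_op P (Yn n) (Yn n)) = gram P (W n).
Proof.
apply/matrixP => i j; rewrite !mxE -riesz_coord.
rewrite (dual_cov_op _ _ row_separable row_separable (gYn n).1 (gYn n).1 (Yn2 n) (Yn2 n)).
by congr Ex; apply/funext => w; rewrite Yn_center !riesz_coord.
Qed.

(** Seen through [x'], the operator is the least-squares regression of [x' (X0)] on the coordinates
    of [W n], to which [regression_orth] applies. *)
Let dual_regression_operator n (x' : topdual E) v :
  x' (regression_operator n v) =
  rdot (mp_inverse (gram P (W n)) *m cross P (W n) (fun w => x' (X0 w)))^T (A n v).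
Proof.
rewrite (dual_cov_op _ _ sepE row_separable bX (gYn n).1 X2 (Yn2 n)) bmX.
rewrite /Defs.pinv gramE /=.
transitivity ((A n v *m (mp_inverse (gram P (W n)) *m cross P (W n) (fun w => x' (X0 w)))) 0 0).
  rewrite mulmxA -Ex_rdot//; last exact: L2_dual.
  by congr Ex; apply/funext => w; rewrite Yn_center.
by rewrite mxE; apply: eq_bigr => j _; rewrite !mxE.
Qed.

Let regression_dual n (x' : topdual E) : observed A n (fun v => x' (regression_operator n v)).
Proof. by eexists; apply/funext => v; rewrite dual_regression_operator. Qed.

Let regression_orthogonal n (x' : topdual E) l : observed A n l ->
  Ex P (fun w => (x' (X0 w) - x' (regression_operator n (Y0 w))) * l (Y0 w)) = 0.
Proof.
move=> [q ->]; under eq_fun do rewrite dual_regression_operator.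
by apply: regression_orth => //; exact: L2_dual.
Qed.

(** * The four conclusions for an abstract regression operator *)

Section abstract_operator.
Variable Phi : nat -> F -> E.
Hypothesis Phi_dual : forall n (x' : topdual E), observed A n (fun v => x' (Phi n v)).
Hypothesis Phi_orth : forall n (x' : topdual E) l, observed A n l ->
  Ex P (fun w => (x' (X0 w) - x' (Phi n (Y0 w))) * l (Y0 w)) = 0.
Variables (Z res : T -> E) (Fc : set F) (cm : F -> E).
Hypotheses (ZE : Z = regr_lim Y0 Phi) (resE : res = residual X0 Y0 Phi).
Hypothesis FcE : forall y, Fc y = cvgn (fun n => Phi n (y - mY)).
Hypothesis cmE : forall y, cm y = mX + limn (fun n => \1_Fc y *: Phi n (y - mY)).

Let Lf_dual := observed_dual hA.
Let Lf_comb := @observed_comb _ _ A.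
Let Lf_mono := observed_mono hA.
Let Lf_borel := observed_borel hA sepF.

Let bZ : borel_fun Z.
Proof. by rewrite ZE; exact: (borel_regr_lim sepE gaussXY0 Lf_dual Phi_dual). Qed.
Let bres : borel_fun res.
Proof. by rewrite resE; exact: (borel_residual sepE bX0 gaussXY0 Lf_dual Phi_dual). Qed.
Let Z2 : L2 P (fun w => `|Z w|).
Proof.
rewrite ZE.
exact: (regr_lim_L2 sepE bX0 gaussXY0 meanXY0 X02 Lf_dual Lf_mono Phi_dual Phi_orth).
Qed.
Let res2 : L2 P (fun w => `|res w|).
Proof.
rewrite resE.
exact: (residual_L2 sepE bX0 gaussXY0 meanXY0 X02 Lf_dual Lf_mono Phi_dual Phi_orth).
Qed.

Let Phi_topdual n (x' : topdual E) : exists y' : topdual F, forall v, x' (Phi n v) = y' v.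
Proof.
have [y' yE] := Lf_dual (Phi_dual n x').
by exists y' => v; exact: (congr1 (fun l : F -> R => l v) yE).
Qed.

Let borel_approx n : borel_fun ((fun y => Phi n (y - mY)) : borelType F -> E).
Proof.
apply: pettis => // x'; have [y' yE] := Phi_topdual n x'.
have -> : (fun y => x' (Phi n (y - mY))) = fun y => y' y - y' mY.
  by apply/funext => y; rewrite yE dualB.
by apply: measurable_funB => //; exact: dual_measurable.
Qed.

Let borel_Fc : borel Fc.
Proof.
have -> : Fc = [set y | cvgn (fun n => Phi n (y - mY))].
  by apply/funext => y; exact: FcE.
exact: (measurable_cvg_set (T := borelType F) sepE borel_approx).
Qed.

Let Fc_event w : Fc (Y w) = cvg_event Y0 Phi w.
Proof. exact: FcE. Qed.

Let Fc_probability : P (Y @^-1` Fc) = 1%E.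
Proof.
have -> : Y @^-1` Fc = [set w | cvgn (fun n => regr Y0 Phi n w)].
  by apply/funext => w; exact: FcE.
exact: (regr_cvg_probability sepE bX0 gaussXY0 meanXY0 X02 Lf_dual Lf_comb Lf_mono Phi_dual Phi_orth).
Qed.

Let borel_shift (V : normedModType R) (c : V) (B : set V) :
  borel B -> borel [set v | B (v + c)].
Proof.
move=> bB; apply: (continuous_borel_fun (f := fun v => v + c)) bB => v.
by apply: cvgD; [exact: cvg_id|exact: cvg_cst].
Qed.

Let S := [set - mY + y | y in Fc].

Let SE : S = [set v | Fc (v + mY)].
Proof.
apply/seteqP; split => [_ [y Fy <-]|v Fv] /=; first by rewrite addrC addrA subrr add0r.
by exists (v + mY) => //; rewrite addrC addrK.
Qed.

Let SP v : S v = cvgn (fun n => Phi n v).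
Proof. by rewrite SE /= FcE addrK. Qed.

(** [Phi n] is linear because all its compositions with functionals are, by [dual_inj]; convergence
    is then stable under linear combinations. *)
Let S_subspace : is_subspace S.
Proof.
split=> [|a u v]; rewrite !SP.
  have -> : (fun n => Phi n 0) = fun=> 0; last exact: is_cvg_cst.
  apply/funext => n; apply: dual_inj => x'; have [y' yE] := Phi_topdual n x'.
  by rewrite yE !dual0.
move=> cu cv.
have -> : (fun n => Phi n (a *: u + v)) = (fun n => a *: Phi n u + Phi n v).
  apply/funext => n; apply: dual_inj => x'; have [y' yE] := Phi_topdual n x'.
  by rewrite dualD dualZ !yE dualD dualZ.
by apply: is_cvgD => //; exact: is_cvgZr.
Qed.

Let S_covariance : range (cov_op P Y X) `<=` S.
Proof.
move=> _ [x' _ <-]; rewrite SP.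
apply: (Phi_cvg_covariance sepE bX0 gaussXY0 meanXY0 X02 Lf_dual Lf_mono Phi_dual Phi_orth
  (x' := x')) => y'.
by rewrite (dual_cov_op _ _ sepF sepE bY bX Y2 X2) bmX bmY.
Qed.

Let cm_cvg y : \1_Fc y *: Phi n (y - mY) @[n --> \oo] --> cm y - mX.
Proof.
rewrite cmE [mX + _]addrC addrK indicE; case: (boolP (y \in Fc)) => [/set_mem|_].
  move=> Fy; under eq_fun do rewrite scale1r.
  have : cvgn (fun n => Phi n (y - mY)) by rewrite -FcE.
  exact: id.
by under eq_fun do rewrite scale0r; apply: is_cvg_cst.
Qed.

Let borel_cm : borel_fun (cm : borelType F -> E).
Proof.
have bl : borel_fun ((fun y => cm y - mX) : borelType F -> E).
  apply: pettis => // x'.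
  have mu n : measurable_fun setT ((fun y => x' (\1_Fc y *: Phi n (y - mY))) : borelType F -> R).
    by apply: borel_fun_dual; apply: borel_funZ.
  apply: (measurable_fun_cvg mu).
  move=> y _; apply: (@continuous_cvg _ _ _ _ _ _ (x' : E -> R)); first exact: topdual_continuous.
  exact: cm_cvg.
have -> : cm = fun y => (cm y - mX) + mX by apply/funext => y; rewrite subrK.
by apply: borel_funD => //; exact: borel_fun_cst.
Qed.

(** An identity at every point: [Y w] lies in [Fc] exactly when [w] lies in the convergence event,
    so both limits carry the same indicator. *)
Let cm_regr w : cm (Y w) = mX + Z w.
Proof.
rewrite cmE ZE /regr_lim (_ : \1_Fc (Y w) = \1_(cvg_event Y0 Phi) w)//.
by apply: indic_iff; rewrite Fc_event.
Qed.

Let X_decomposition w : X w = res w + cm (Y w).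
Proof. by rewrite cm_regr resE /residual -ZE addrCA subrK addrC subrK. Qed.

Let borel_cmY : borel_fun (fun w => cm (Y w)).
Proof.
under eq_fun do rewrite cm_regr.
by apply: borel_funD => //; exact: borel_fun_cst.
Qed.

Let cmY2 : L2 P (fun w => `|cm (Y w)|).
Proof.
apply: (L2_le _ _ (L2D (L2_cst P `|mX|) Z2)); first exact: borel_fun_norm.
by move=> w; rewrite normr_id cm_regr ler_normD.
Qed.

(** Through [x'], the two integrals differ by the expectation of the residual over an event of [Y],
    which [residual_cond] annihilates once [C] is shifted by the mean of [Y]. *)
Let cm_expectation : is_cond_expectation P X Y (cm \o Y).
Proof.
split.
- move=> _ [B bB <-]; exists (cm @^-1` B) => //.
  by have := borel_cm measurableT bB; rewrite setTI.
- by apply: bochner_integrableI => //; exact: L2_L1.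
- move=> _ [C bC <-]; rewrite setTI; apply: dual_inj => x'.
  have mC : measurable (Y @^-1` C) by have := bY measurableT bC; rewrite setTI.
  have bI (V : T -> E) : borel_fun V -> borel_fun (fun w => \1_(Y @^-1` C) w *: V w).
    by move=> bV; apply: borel_funZ.
  have iI (V : T -> E) : borel_fun V -> L2 P (fun w => `|V w|) ->
      L1 P (fun w => `|\1_(Y @^-1` C) w *: V w|).
    move=> bV V2; apply: L1_le (L2_L1 V2); first exact/borel_fun_norm/bI.
    move=> w; rewrite normr_id normrZ indicE.
    by case: (w \in _); rewrite ?normr1 ?mul1r ?normr0 ?mul0r.
  have e1 := dual_bochner sepE x' (bI _ borel_cmY) (iI _ borel_cmY cmY2).
  have e2 := dual_bochner sepE x' (bI _ bX) (iI _ bX X2).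
  apply: (etrans e1); apply: (etrans _ (esym e2)).
  have dI (V : T -> E) : borel_fun V -> L2 P (fun w => `|V w|) ->
      L1 P (fun w => x' (\1_(Y @^-1` C) w *: V w)).
    by move=> bV V2; apply: L1_norm_dual; [exact: bI|exact: iI].
  apply/esym/eqP; rewrite -subr_eq0 -ExB; [|exact: dI|exact: dI].
  have := residual_cond sepE bX0 bY0 gaussXY0 meanXY0 X02 Lf_dual Lf_comb Lf_mono Phi_dual
    Phi_orth Lf_borel x' (borel_shift mY bC).
  rewrite -resE => <-.
  apply/eqP; congr Ex; apply/funext => w; rewrite !dualZ -mulrBr -dualB /= {1}X_decomposition addrK.
  by congr (_ * _); apply: indic_iff; rewrite /= /Y0 subrK.
Qed.

Let gauss_res (x' : topdual E) :
  real_gaussian P (fun w => x' (res w)) /\ Ex P (fun w => x' (res w)) = 0.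
Proof.
have [z zE] := zero_dual F.
have := residual_gauss sepE bX0 bY0 gaussXY0 meanXY0 X02 Lf_dual Lf_comb Lf_mono Phi_dual
  Phi_orth x' z.
rewrite -resE (_ : (fun w => x' (res w) + z (Y0 w)) = fun w => x' (res w)).
  by move=> h; split; [apply/real_gaussianP; do 2 eexists; exact: h|exact: gauss_law_mean h].
by apply/funext => w; rewrite zE addr0.
Qed.

Let bochner_cmY : bochner P (fun w => cm (Y w)) = mX.
Proof.
apply: bochnerP => //; first exact: L2_L1.
move=> x'; have -> : (fun w => x' (cm (Y w))) = (fun w => x' (X w) - x' (res w)).
  by apply/funext => w; rewrite -dualB X_decomposition addrC addKr.
rewrite ExB; [|exact/L2_L1/L2_dual|exact/L2_L1/L2_dual].
by rewrite (gauss_res x').2 subr0 Ex_X.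
Qed.

Let K (x' : topdual E) : E := cov_op P X X x' - cov_op P (fun w => cm (Y w)) (fun w => cm (Y w)) x'.

(** [X - mX] is the sum of [res] and [Z], which are uncorrelated; removing the covariance of [Z]
    leaves that of [res]. *)
Let dual_K (x' z' : topdual E) :
  z' (K x') = Ex P (fun w => x' (res w) * z' (res w)).
Proof.
have KX := dual_cov_op z' x' sepE sepE bX bX X2 X2; rewrite bmX in KX.
have KZ := dual_cov_op z' x' sepE sepE borel_cmY borel_cmY cmY2 cmY2; rewrite bochner_cmY in KZ.
transitivity (Ex P (fun w => x' (X w - mX) * z' (X w - mX)) -
    Ex P (fun w => x' (cm (Y w) - mX) * z' (cm (Y w) - mX))).
  by rewrite -KX -KZ; exact: dualB.
have xr := L2_dual bres res2 x'; have zr := L2_dual bres res2 z'.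
have xZ := L2_dual bZ Z2 x'; have zZ := L2_dual bZ Z2 z'.
have orth := residual_orth_lim sepE bX0 gaussXY0 meanXY0 X02 Lf_dual Lf_comb Lf_mono Phi_dual
  Phi_orth.
rewrite -ZE -resE in orth.
have -> : (fun w => x' (X w - mX) * z' (X w - mX)) = fun w =>
    x' (res w) * z' (res w) + (x' (res w) * z' (Z w) + (z' (res w) * x' (Z w) + x' (Z w) * z' (Z w))).
  apply/funext => w; have -> : X w - mX = res w + Z w by rewrite resE ZE /residual subrK.
  by rewrite !dualD; ring.
have -> : (fun w => x' (cm (Y w) - mX) * z' (cm (Y w) - mX)) = (fun w => x' (Z w) * z' (Z w)).
  by apply/funext => w; rewrite cm_regr [mX + _]addrC addrK.
have rr := L2_mul xr zr; have rZ := L2_mul xr zZ; have Zr := L2_mul zr xZ; have ZZ := L2_mul xZ zZ.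
rewrite (ExD rr (L1D rZ (L1D Zr ZZ))) (ExD rZ (L1D Zr ZZ)) (ExD Zr ZZ) !orth.
by rewrite !add0r addrK.
Qed.

(** The law of [res + cm y] is Gaussian with mean [cm y] and, by [dual_K], covariance [K]. So
    [normal_law] does not fall back on its default value and is this law. *)
Let kernelP y : is_normal (cm y) K (normal_law (cm y) K) /\
  forall B, borel B -> normal_law (cm y) K B = P [set w | B (res w + cm y)].
Proof.
have bU : borel_fun (fun w => res w + cm y).
  by apply: borel_funD => //; exact: borel_fun_cst.
have gU : gaussian_rv P (fun w => res w + cm y).
  split=> // x'; have := real_gaussian_affine 1 (x' (cm y)) (gauss_res x').1.
  by congr real_gaussian; apply/funext => w; rewrite mul1r dualD.
have U2 := gaussian_rv_L2 sepE gU.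
have bE : bochner P (fun w => res w + cm y) = cm y.
  apply: bochnerP => //; first exact: L2_L1.
  move=> x'; under eq_fun do rewrite dualD.
  rewrite ExD; [|exact/L2_L1/L2_dual|exact: L1_cst].
  by rewrite (gauss_res x').2 Ex_cst add0r.
have [|Q [nQ QE]] := gaussian_rv_normal sepE gU (K := K).
  by move=> x' z'; rewrite bE dual_K; congr Ex; apply/funext => w; rewrite addrK.
rewrite bE in nQ; have [h hB] := normal_lawP sepE nQ.
by split=> // B bB; rewrite hB// QE.
Qed.

(** As a function of [y], the value is the measure of a section of a measurable set in the product
    of [F] and the probability space. *)
Let kernel_measurable B : borel B ->
  measurable_fun [set: borelType F] (fun y : borelType F => normal_law (cm y) K B).
Proof.
move=> bB; have -> : (fun y => normal_law (cm y) K B) = fun y => P [set w | B (res w + cm y)].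
  by apply/funext => y; exact: (kernelP y).2.
have bs : borel_fun ((fun p => res p.2 + cm p.1) : (borelType F * T)%type -> E).
  apply: borel_funD => //.
    exact: (measurableT_comp bres measurable_snd).
  exact: (measurableT_comp borel_cm measurable_fst).
have mS := bs measurableT B bB; rewrite setTI in mS.
have := measurable_fun_xsection P mS; congr (measurable_fun _ _).
by apply/funext => y /=; congr (P _); apply/funext => w; rewrite /xsection/= inE.
Qed.

(** [X] is [res + cm (Y)], so the disintegration of the residual, with the translation [cm (v + mY)]
    of the centred observation [v], gives the defining identity. *)
Let kernel_regular : is_reg_cond_prob P X Y (fun y => normal_law (cm y) K).
Proof.
split; first exact: kernel_measurable.
move=> B C bB bC.
rewrite (@ge0_integral_pushforward _ _ _ _ R _ bY P C (fun y => normal_law (cm y) K B) bC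
  (measurable_funTS (kernel_measurable bB)) (fun y _ => measure_ge0 _ _)).
have mC : measurable (Y @^-1` C) by have := bY measurableT bC; rewrite setTI.
have bf : borel_fun ((fun v => cm (v + mY)) : borelType F -> E).
  by move=> _ V bV; have := borel_cm measurableT bV; rewrite !setTI; exact: borel_shift.
have YE w : Y0 w + mY = Y w by rewrite /Y0 subrK.
have := residual_disintegration sepE bX0 bY0 gaussXY0 meanXY0 X02 Lf_dual Lf_comb Lf_mono
  Phi_dual Phi_orth Lf_borel (borel_shift mY bC) bf bB.
rewrite -resE (_ : [set w | _ /\ _] = X @^-1` B `&` Y @^-1` C); last first.
  by apply/seteqP; split => w /=; rewrite YE X_decomposition => -[].
move=> ->; rewrite [RHS]integral_mkcond; apply: eq_integral => w _.
rewrite patchE indicE YE (_ : (Y0 w \in _) = (w \in Y @^-1` C)); last first.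
  by apply/idP/idP; rewrite !inE /= YE.
case: ifP => _; last by rewrite mul0e.
by rewrite mul1e /= (kernelP (Y w)).2.
Qed.

Lemma abstract_conditioning :
  (borel Fc /\ P (Y @^-1` Fc) = 1%E) /\
  [/\ borel S, is_subspace S & range (cov_op P Y X) `<=` S] /\
  (borel_fun (cm : borelType F -> E) /\ is_cond_expectation P X Y (cm \o Y)) /\
  ((forall y, is_normal (cm y) K (normal_law (cm y) K)) /\
   is_reg_cond_prob P X Y (fun y => normal_law (cm y) K)).
Proof.
split; first by split; [exact: borel_Fc|exact: Fc_probability].
split; first by split; [rewrite SE; exact: borel_shift|exact: S_subspace|exact: S_covariance].
split; first by split; [exact: borel_cm|exact: cm_expectation].
by split=> [y|]; [exact: (kernelP y).1|exact: kernel_regular].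
Qed.

End abstract_operator.

Lemma gaussian_conditioning :
  (borel (F_conv P X Y A) /\ P (Y @^-1` F_conv P X Y A) = 1%E) /\
  [/\ borel (F_cond P X Y A), is_subspace (F_cond P X Y A) &
      range (cov_op P Y X) `<=` F_cond P X Y A] /\
  (borel_fun (cond_mean P X Y A : borelType F -> E) /\
   is_cond_expectation P X Y (cond_mean P X Y A \o Y)) /\
  ((forall y : F, is_normal (cond_mean P X Y A y) (cond_cov P X Y A)
                            (cond_prob P X Y A y)) /\
   is_reg_cond_prob P X Y (cond_prob P X Y A)).
Proof.
have FcE y : F_conv P X Y A y = cvgn (fun n => regression_operator n (y - mY)).
  have <- : (fun n => cond_mean_approx P X Y A n y) =
      (fun n => regression_operator n (y - mY)).
    by apply/funext => n; exact: cond_mean_approxE.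
  reflexivity.
have cmE y : cond_mean P X Y A y =
    mX + limn (fun n => \1_(F_conv P X Y A) y *: regression_operator n (y - mY)).
  have uE : (fun n => \1_(F_conv P X Y A) y *: cond_mean_approx P X Y A n y) =
      (fun n => \1_(F_conv P X Y A) y *: regression_operator n (y - mY)).
    apply/funext => n.
    exact: (congr1 (fun v => \1_(F_conv P X Y A) y *: v) (cond_mean_approxE n y)).
  exact: (f_equal2 (fun a u => a + limn u) bmX uE).
have := abstract_conditioning regression_dual regression_orthogonal erefl erefl FcE cmE.
rewrite -bmY; exact: id.
Qed.

End gaussian_conditioning.

Theorem theorem3p5 (R : realType) (d : measure_display) (Omega : measurableType d)
    (P : probability Omega R) (E F : completeNormedModType R)
    (sepE : separable_space E) (sepF : separable_space F)
    (X : Omega -> E) (Y : Omega -> F) (XY : jointly_gaussian P X Y)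
    (A : forall n, {linear F -> 'rV[R]_n.+1}) (hA : filtering_sequence A) :
  (* (i) *)
  (sigma_dual F (F_conv P X Y A) /\
   pushforward P (Y : Omega -> borelType F) (F_conv P X Y A) = 1%E) /\
  (* (ii) *)
  [/\ borel (F_cond P X Y A), is_subspace (F_cond P X Y A) &
      range (cov_op P Y X) `<=` F_cond P X Y A] /\
  (* (iii) *)
  (borel_fun (cond_mean P X Y A : borelType F -> E) /\
   is_cond_expectation P X Y (cond_mean P X Y A \o Y)) /\
  (* (iv) *)
  ((forall y : F, is_normal (cond_mean P X Y A y) (cond_cov P X Y A)
                            (cond_prob P X Y A y)) /\
   is_reg_cond_prob P X Y (cond_prob P X Y A)).
Proof.
(* Part (i) speaks of [sigma_dual], which for separable [F] is the Borel sigma-algebra. *)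
rewrite -(borel_sigma_dual sepF).
exact: (gaussian_conditioning sepE sepF XY erefl erefl hA).
Qed.
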